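(* Let $d\in\mathbb{N}$ and let $\Omega_1,\Omega_2\subset\mathbb{C}^d$ be non-empty open sets with $\Omega_2\subset\!\!\!\subset\Omega_1$. Then the canonical identification $J:A^2(\Omega_1)\to A^2(\Omega_2)$, $Jf=f|_{\Omega_2}$, belongs to $E(1/d)$. More precisely, if $\{D_n\}_{1\le n\le N}$ is a relative cover of $(\Omega_1,\Omega_2)$ of size $N$ with efficiency $\Gamma$, then $$J\in E(c,1/d),\quad\text{where } c=\|\Gamma\|_d,$$ and $$|J|_{c,1/d}\le N e^{-\frac{d-1}{2}\min(\Gamma)}.$$
   Context: $\mathbb{N}$ is the set of strictly positive integers. $V$ is $2d$-dimensional Lebesgue measure on $\mathbb{C}^d$, normalised so that the Euclidean unit ball has mass $1$. For non-empty open $\Omega\subset\mathbb{C}^d$, Bergman space $A^2(\Omega)$ is the Hilbert space of holomorphic $f:\Omega\to\mathbb{C}$ with $\int_\Omega|f|^2\,dV<\infty$, with inner product $\int_\Omega f\overline{g}\,dV$. We write $S\subset\!\!\!\subset\Omega$ if the closure of $S$ is a compact subset of $\Omega$. A set $D\subset\mathbb{C}^d$ is strictly circled with centre $\zeta\in\mathbb{C}^d$ if $\mu(D-\zeta)\subset\!\!\!\subset D-\zeta$ for all $\mu\in\mathbb{C}$ with $|\mu|<1$; for $r>0$, $D(r):=r(D-\zeta)+\zeta$. If $\Omega_2\subset\!\!\!\subset\Omega_1$ are non-empty open subsets of $\mathbb{C}^d$, a relative cover of $(\Omega_1,\Omega_2)$ of size $N\in\mathbb{N}$ is a finite collection $D_1,\dots,D_N$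 of strictly circled open subsets of $\mathbb{C}^d$ with (a) $\Omega_2\subset\bigcup_{n=1}^N D_n$ and (b) for each $n$ there is $\gamma_n>1$ such that $\bigcup_{n=1}^N D_n(\gamma_n)\subset\Omega_1$. Then $(\gamma_1,\dots,\gamma_N)$ is called a scaling, and $\Gamma=(\log\gamma_1,\dots,\log\gamma_N)$ the efficiency, of the relative cover. $\min(\Gamma)$ is the smallest entry of $\Gamma$, and $\|(x_1,\dots,x_N)\|_d:=\left(\sum_{j=1}^N|x_j|^{-d}\right)^{-1/d}$. For a compact operator $A:H_1\to H_2$ between Hilbert spaces, $s_n(A)=\sqrt{\lambda_n(A^*A)}$ is its $n$-th singular value (eigenvalues $\lambda_n$ in decreasing order, with multiplicity). For $a,\alpha>0$, $E(a,\alpha)$ is the set of compact operators $A:H_1\to H_2$ with $|A|_{a,\alpha}:=\sup_{n\in\mathbb{N}}s_n(A)\exp(an^\alpha)<\infty$, and $E(\alpha):=\bigcup_{a>0}E(a,\alpha)$. *)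

(* Defs.v *)
From HB Require Import structures.
From mathcomp Require Import all_boot all_order all_algebra complex.
From mathcomp Require Import all_classical all_reals all_analysis.
Set Implicit Arguments.
Unset Strict Implicit.
Unset Printing Implicit Defensive.
Import Order.TTheory GRing.Theory Num.Theory numFieldNormedType.Exports.
Local Open Scope classical_set_scope.
Local Open Scope ring_scope.

(* Registering R[i] as a numClosedFieldType constant is what makes the
   topology, norm and (self-)module structures of a numFieldType available on
   it as a module over itself; they are not inferred on the bare R[i]. *)
Definition Cplx (R : realType) : numClosedFieldType := R[i].

(* The norm that 'rV carries is the sup norm; it is used only through its
   topology and through complex differentiability, both of which are the
   Euclidean ones. *)
Notation Cd R d := 'rV[Cplx R]_d.

(* The sigma-finite instance of product_measure1 in the library is shadowed by
   the one for subprobabilities; prod_sf carries it again. *)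
Section ProdSigmaFinite.
Context d1 d2 (T1 : measurableType d1) (T2 : measurableType d2) (R : realType).
Variables (m1 : {sigma_finite_measure set T1 -> \bar R})
          (m2 : {sigma_finite_measure set T2 -> \bar R}).

Definition prod_sf : set (T1 * T2)%type -> \bar R := (m1 \x m2)%E.

HB.instance Definition _ := Measure.on prod_sf.

Let prod_sf_sigma_finite : sigma_finite setT prod_sf.
Proof.
have /sigma_finiteP[F [TF ndF Foo]] := sigma_finiteT m1.
have /sigma_finiteP[G [TG ndG Goo]] := sigma_finiteT m2.
exists (fun n => F n `*` G n).
  rewrite -setXTT TF TG predeqE => -[x y]; split.
    move=> [/= [n _ Fnx] [k _ Gky]]; exists (maxn n k) => //; split.
    - by move: x Fnx; exact/subsetPset/ndF/leq_maxl.
    - by move: y Gky; exact/subsetPset/ndG/leq_maxr.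
  by move=> [n _ []/= ? ?]; split; exists n.
move=> k; have [? ?] := Foo k; have [? ?] := Goo k.
split; first exact: measurableX.
by rewrite /prod_sf product_measure1E// lte_mul_pinfty// ge0_fin_numE.
Qed.

HB.instance Definition _ := Measure_isSigmaFinite.Build _ _ _ prod_sf
  prod_sf_sigma_finite.

End ProdSigmaFinite.

Section PowerMeasure.
Context d (T : measurableType d) (R : realType).
Variable mu : {sigma_finite_measure set T -> \bar R}.

Section Cons.
Variables (n : nat) (nu : {sigma_finite_measure set (n.-tuple T) -> \bar R}).

Definition consT (p : T * n.-tuple T) : n.+1.-tuple T := [tuple of p.1 :: p.2].

Lemma measurable_consT : measurable_fun setT consT.
Proof. exact: measurable_cons. Qed.

Definition cons_measure : set (n.+1.-tuple T) -> \bar R :=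
  pushforward (prod_sf mu nu) consT.

Let pushforwardM : {measure set (n.+1.-tuple T) -> \bar R} :=
  measure_function_pushforward__canonical__measure_function_Measure
    (prod_sf mu nu) measurable_consT.

HB.instance Definition _ := isMeasure.Build _ _ _ cons_measure
  (measure0 pushforwardM) (measure_ge0 pushforwardM)
  (@measure_semi_sigma_additive _ _ _ pushforwardM).

Let uncons (t : n.+1.-tuple T) : T * n.-tuple T :=
  (tnth t ord0, [tuple of behead t]).

Let consTK : cancel consT uncons.
Proof. by move=> [x t]; congr pair; apply: val_inj. Qed.

Let measurable_uncons : measurable_fun setT uncons.
Proof.
by apply: measurable_fun_pair; [exact: measurable_tnth|exact: measurable_behead].
Qed.

Let cons_measure_sigma_finite : sigma_finite setT cons_measure.
Proof.
have [F UF mF] := sigma_finiteT (prod_sf mu nu).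
exists (fun i => uncons @^-1` F i).
  by rewrite -preimage_bigcup -UF preimage_setT.
move=> i; split.
  by rewrite -[X in measurable X]setTI; apply: measurable_uncons => //; have [] := mF i.
rewrite /cons_measure /pushforward -comp_preimage.
rewrite (_ : uncons \o consT = id) ?preimage_id; first by have [] := mF i.
exact/funext/consTK.
Qed.

HB.instance Definition _ := Measure_isSigmaFinite.Build _ _ _ cons_measure
  cons_measure_sigma_finite.

End Cons.

Fixpoint power_measure n : {sigma_finite_measure set (n.-tuple T) -> \bar R} :=
  if n is m.+1 then cons_measure (power_measure m)
  else \d_([tuple] : 0.-tuple T).

End PowerMeasure.

Section LebesgueCd.
Variables (R : realType) (d : nat).

Definition coords (z : Cd R d) : d.-tuple (R * R)%type :=
  [tuple (complex.Re (z ord0 j), complex.Im (z ord0 j)) | j < d].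

Definition of_coords (t : d.-tuple (R * R)%type) : Cd R d :=
  \row_j ((tnth t j).1 +i* (tnth t j).2)%C.

(* C^d with the sigma-algebra transported from (R * R)^d along coords, that is
   the Borel sigma-algebra. *)
Definition CdM := g_sigma_algebra_preimageType coords.

Lemma measurable_of_coords :
  measurable_fun [set: d.-tuple (R * R)%type] (of_coords : _ -> CdM).
Proof.
move=> _ _ [B mB <-]; rewrite !setTI -comp_preimage.
rewrite (_ : coords \o of_coords = id) ?preimage_id //.
apply/funext => t; apply: eq_from_tnth => j.
by rewrite tnth_mktuple mxE /=; case: (tnth t j).
Qed.

Definition lebesgue_Cd : {measure set CdM -> \bar R} :=
  measure_function_pushforward__canonical__measure_function_Measure
    (power_measure (prod_sf lebesgue_measure lebesgue_measure) d)
    measurable_of_coords.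

Definition unit_ball : set CdM :=
  [set z : Cd R d | \sum_j `|z ord0 j| ^+ 2 < 1].

Lemma ball_mass_inv_ge0 : 0 <= (fine (lebesgue_Cd unit_ball))^-1.
Proof. by rewrite invr_ge0 fine_ge0. Qed.

Definition volume : {measure set CdM -> \bar R} :=
  mscale (NngNum ball_mass_inv_ge0) lebesgue_Cd.

End LebesgueCd.

(* Data of a complex inner product space: a set of vectors inside an ambient
   C-module, and an inner product that is meaningful on that set only. *)
Record ipSpace (R : realType) := IpSpace {
  ambient :> lmodType (Cplx R);
  carrier : set ambient;
  inner : ambient -> ambient -> Cplx R }.

Section HilbertSpaces.
Variable R : realType.
Implicit Types H : ipSpace R.

Definition hnorm H (x : H) : R := Num.sqrt (complex.Re (inner x x)).

Definition hbounded H (u : nat -> H) := exists M : R, forall n, hnorm (u n) <= M.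

Definition hcauchy H (u : nat -> H) := forall e : R, 0 < e ->
  exists n0, forall m n, (n0 <= m)%N -> (n0 <= n)%N -> hnorm (u m - u n) < e.

Definition hcvg H (u : nat -> H) (l : H) :=
  (fun n => hnorm (u n - l)) @ \oo --> (0 : R).

Record is_hilbert H : Prop := IsHilbert {
  carrier0 : carrier (0 : H);
  carrierP : forall (a : Cplx R) (x y : H),
    carrier x -> carrier y -> carrier (a *: x + y);
  innerP : forall (a : Cplx R) (x y z : H),
    carrier x -> carrier y -> carrier z ->
    inner (a *: x + y) z = a * inner x z + inner y z;
  innerC : forall x y : H, carrier x -> carrier y ->
    inner y x = (inner x y)^*;
  inner_ge0 : forall x : H, carrier x -> 0 <= inner x x;
  inner_eq0 : forall x : H, carrier x -> inner x x = 0 -> x = 0;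
  hcomplete : forall u : nat -> H, (forall n, carrier (u n)) -> hcauchy u ->
    exists2 l : H, carrier l & hcvg u l }.

Record is_compact_operator (H1 H2 : ipSpace R) (A : H1 -> H2) : Prop :=
  IsCompactOperator {
  op_carrier : forall x : H1, carrier x -> carrier (A x);
  op_linear : forall (a : Cplx R) (x y : H1), carrier x -> carrier y ->
    A (a *: x + y) = a *: A x + A y;
  op_compact : forall u : nat -> H1, (forall n, carrier (u n)) -> hbounded u ->
    exists2 k : nat -> nat, {homo k : m n / (m < n)%N} &
    exists2 l : H2, carrier l & hcvg (A \o u \o k) l }.

(* adjoint A y is the Riesz representative of x |-> <A x, y>. *)
Definition adjoint (H1 H2 : ipSpace R) (A : H1 -> H2) (y : H2) : H1 :=
  xget 0 [set z : H1 | carrier z /\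
    forall x : H1, carrier x -> inner (A x) y = inner x z].

Definition lin_indep (V : lmodType (Cplx R)) n (e : 'I_n -> V) :=
  forall c : 'I_n -> Cplx R, \sum_i c i *: e i = 0 -> forall i, c i = 0.

Definition is_eigenvector H (T : H -> H) (nu : R) (x : H) :=
  [/\ carrier x, x <> 0 & T x = (nu%:C)%C *: x].

(* The n-th largest eigenvalue (n >= 1) of a positive compact operator, counted
   with multiplicity: the largest mu for which the eigenspaces of the
   eigenvalues >= mu have total dimension >= n.  Since sup set0 = 0, the
   enumeration is continued by zeros once the eigenvalues are exhausted. *)
Definition nth_eigenvalue H (T : H -> H) (n : nat) : R :=
  sup [set mu : R | exists2 e : 'I_n -> H, lin_indep e &
    forall i, exists2 nu : R, mu <= nu & is_eigenvector T nu (e i)].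

Definition singular_value (H1 H2 : ipSpace R) (A : H1 -> H2) (n : nat) : R :=
  Num.sqrt (nth_eigenvalue (adjoint A \o A) n).

Definition exp_gauge (a alpha : R) (H1 H2 : ipSpace R) (A : H1 -> H2) : \bar R :=
  ereal_sup [set (singular_value A n * expR (a * n%:R `^ alpha))%:E
            | n in [set n | (0 < n)%N]].

(* Since ipSpace is only data, membership records that the operator acts between
   genuine Hilbert spaces; in particular the adjoint exists. *)
Definition in_E2 (a alpha : R) (H1 H2 : ipSpace R) (A : H1 -> H2) : Prop :=
  [/\ is_hilbert H1, is_hilbert H2, is_compact_operator A &
      (exp_gauge a alpha A < +oo)%E].

Definition in_E (alpha : R) (H1 H2 : ipSpace R) (A : H1 -> H2) : Prop :=
  exists2 a : R, 0 < a & in_E2 a alpha A.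

End HilbertSpaces.

Section Bergman.
Variables (R : realType) (d : nat).
Implicit Types (Omega S D : set (Cd R d)) (f g : Cd R d -> (Cplx R)^o).

(* f : Omega -> C is represented by its extension by zero to C^d.  The base field
   of both normed modules is Cplx R, so [differentiable] is complex
   differentiability, i.e. holomorphy on the open set Omega. *)
Definition bergman_carrier Omega : set (Cd R d -> (Cplx R)^o) :=
  [set f | [/\ forall z, Omega z -> differentiable f z,
               forall z, ~ Omega z -> f z = 0 &
    (\int[volume R d]_(z in Omega) (complex.Re (`|f z| ^+ 2))%:E < +oo)%E]].

Definition bergman_inner Omega f g : Cplx R :=
  ((\int[volume R d]_(z in Omega) complex.Re (f z * (g z)^* ))
   +i* (\int[volume R d]_(z in Omega) complex.Im (f z * (g z)^* )))%C.

Definition bergman Omega : ipSpace R :=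
  IpSpace (bergman_carrier Omega) (bergman_inner Omega).

Definition bergman_restr Omega1 Omega2 (f : bergman Omega1) : bergman Omega2 :=
  patch (fun=> 0) Omega2 f.

Definition rel_compact S Omega := compact (closure S) /\ closure S `<=` Omega.

Definition translate D (zeta : Cd R d) : set (Cd R d) := [set z - zeta | z in D].

Definition strictly_circled D (zeta : Cd R d) := forall mu : Cplx R, `|mu| < 1 ->
  rel_compact [set mu *: z | z in translate D zeta] (translate D zeta).

Definition dilate D (zeta : Cd R d) (r : R) : set (Cd R d) :=
  [set (r%:C)%C *: z + zeta | z in translate D zeta].

Record is_relative_cover Omega1 Omega2 (N : nat) (D : 'I_N -> set (Cd R d))
    (zeta : 'I_N -> Cd R d) (gamma : 'I_N -> R) : Prop := IsRelativeCover {
  rcover_size : (0 < N)%N;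
  rcover_open : forall n, open (D n);
  rcover_circled : forall n, strictly_circled (D n) (zeta n);
  rcover_cover : Omega2 `<=` \bigcup_n D n;
  rcover_scaling : forall n, 1 < gamma n;
  rcover_dilate : \bigcup_n dilate (D n) (zeta n) (gamma n) `<=` Omega1 }.

End Bergman.

Definition efficiency (R : realType) N (gamma : 'I_N -> R) (n : 'I_N) : R :=
  ln (gamma n).

Definition min_entry (R : realType) N (x : 'I_N -> R) : R := inf (range x).

Definition dual_norm (R : realType) (d N : nat) (x : 'I_N -> R) : R :=
  (\sum_j `|x j| `^ (- d%:R)) `^ (- d%:R^-1).

(* Main.v *)
Require Import Defs.
From HB Require Import structures.
From mathcomp Require Import all_boot all_order all_algebra complex.
From mathcomp Require Import all_classical all_reals all_analysis.
From mathcomp Require Import measurable_realfun.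
From mathcomp Require Import ring lra.
Set Implicit Arguments.
Unset Strict Implicit.
Unset Printing Implicit Defensive.
Import Order.TTheory GRing.Theory Num.Theory numFieldNormedType.Exports.
Local Open Scope classical_set_scope.
Local Open Scope ring_scope.

(* Let f in A^2(Omega1) have vanishing Taylor coefficients of degree < k_n at
   the centre zeta_n of D_n.  On a complex line through zeta_n the circle mean M(u)
   of |f|^2 at radius e^u satisfies M(u - h) <= e^(-2 k_n h) M(u) (Hadamard's
   convexity argument); integrating this over the circled set D_n gives
     ||f||_{D_n} <= gamma_n^-(k_n + d) ||f||_{D_n(gamma_n)}.
   Hence ||J f||^2 <= sum_n gamma_n^(-2 (k_n + d)) ||f||^2 on a subspace whose
   codimension is the number of these coefficients, about sum_n k_n^d, and
   min-max bounds s_m(J)^2 by that sum once m exceeds the codimension.  Taking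
   k_n just above c m^(1/d) / log gamma_n - (d+1)/2 gives the theorem.

   Min-max only uses that eigenvectors of J^* J for different eigenvalues are
   orthogonal; neither the spectral theorem nor the Riesz representation theorem
   is needed.  Complex analysis rests on Goursat's lemma for functions of
   two real variables satisfying the Cauchy-Riemann equations, applied to
   g(e^(x+iy)) on rectangles of height 2 pi, where the integrals over the
   horizontal sides cancel. *)

(** The constants come from an exact balance. There are at most (k + (d-1)/2)^d Taylor coefficients
    of degree < k, and rounding k_n up to an integer costs at most 1 more: together these give the
    shift (d+1)/2. The codimension then stays strictly below sum_n (c m^(1/d) / log gamma_n)^d,
    which equals m by the definition of ||Gamma||_d. In the decay exponent k_n + d the summand d is
    the Jacobian of the dilation; since d - (d+1)/2 = (d-1)/2, it follows that (k_n + d) log gamma_n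
    >= c m^(1/d) + (d-1)/2 log gamma_n, whence the factor e^(-(d-1)/2 min Gamma). The factor N comes
    from bounding a sum of N squares by N^2 times a common bound.

    No power series is formed. The analysis on C^d rests on one estimate, a first-order Taylor
    remainder whose constant depends only on a radius and a bound of the function. Being uniform
    over bounded families, it yields holomorphy of pointwise limits and of derivatives, and from
    these the completeness of Bergman space and the compactness of J. *)

(** * The complex modulus as a real number *)

Section ComplexBasics.
Variable R : realType.
Implicit Types z w : Cplx R.

(** The norm of [Cplx R] takes its values in [Cplx R]; real integrals and real arithmetic need the
    modulus in [R]. *)
Definition cabs z : R := complex.Re `|z|.

Lemma normE z : `|z| = (cabs z)%:C%C. Proof. by []. Qed.
Lemma ReD z w : complex.Re (z + w) = complex.Re z + complex.Re w.
Proof. by case: z w => [a b] [c d]. Qed.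
Lemma ImD z w : complex.Im (z + w) = complex.Im z + complex.Im w.
Proof. by case: z w => [a b] [c d]. Qed.
Lemma ReN z : complex.Re (- z) = - complex.Re z.
Proof. by case: z. Qed.
Lemma ImN z : complex.Im (- z) = - complex.Im z.
Proof. by case: z. Qed.
Lemma ReM z w : complex.Re (z * w) =
  complex.Re z * complex.Re w - complex.Im z * complex.Im w.
Proof. by case: z w => [a b] [c d]. Qed.
Lemma ImM z w : complex.Im (z * w) =
  complex.Re z * complex.Im w + complex.Im z * complex.Re w.
Proof. by case: z w => [a b] [c d]. Qed.
Lemma cabsM z w : cabs (z * w) = cabs z * cabs w.
Proof. exact: complex.ComplexField.Normc.normcM. Qed.
Lemma cabsD z w : cabs (z + w) <= cabs z + cabs w.
Proof. by rewrite -lecR rmorphD /= -!normE ler_normD. Qed.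
Lemma cabsN z : cabs (- z) = cabs z.
Proof. by rewrite /cabs normrN. Qed.
Lemma cabsB z w : cabs (z - w) <= cabs z + cabs w.
Proof. by rewrite -(cabsN w) cabsD. Qed.
Lemma cabs_sub z w : cabs (z - w) = cabs (w - z).
Proof. by rewrite -cabsN opprB. Qed.
Lemma cabs_ge0 z : 0 <= cabs z.
Proof. by rewrite -ler0c -normE normr_ge0. Qed.
Lemma cabs0 : cabs 0 = 0.
Proof. by rewrite /cabs normr0. Qed.
Lemma cabs1 : cabs 1 = 1.
Proof. by rewrite /cabs normr1. Qed.
Lemma cabs_eq0 z : cabs z = 0 -> z = 0.
Proof. exact: complex.ComplexField.Normc.eq0_normc. Qed.
Lemma cabs_gt0 z : z != 0 -> 0 < cabs z.
Proof.
move=> z0; rewrite lt_def cabs_ge0 andbT; apply: contra z0 => /eqP/cabs_eq0 ->//.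
Qed.
Lemma cabsV z : cabs z^-1 = (cabs z)^-1.
Proof.
have [->|z0] := eqVneq z 0; first by rewrite invr0 cabs0 invr0.
apply: (mulfI (lt0r_neq0 (cabs_gt0 z0))).
by rewrite -cabsM !divff ?cabs1// lt0r_neq0 ?cabs_gt0.
Qed.
Lemma sqr_cabs z : cabs z ^+ 2 = complex.Re z ^+ 2 + complex.Im z ^+ 2.
Proof.
by case: z => a b; rewrite /cabs /= sqr_sqrtr// addr_ge0// sqr_ge0.
Qed.
Lemma cabs_real (a : R) : cabs a%:C%C = `|a|.
Proof. by rewrite /cabs /= expr0n /= addr0 sqrtr_sqr. Qed.
Lemma cabs_Re z : `|complex.Re z| <= cabs z.
Proof.
rewrite -(@ler_pXn2r _ 2)// ?nnegrE ?cabs_ge0// sqr_cabs real_normK ?num_real//.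
by rewrite lerDl sqr_ge0.
Qed.
Lemma cabs_Im z : `|complex.Im z| <= cabs z.
Proof.
rewrite -(@ler_pXn2r _ 2)// ?nnegrE ?cabs_ge0// sqr_cabs real_normK ?num_real//.
by rewrite lerDr sqr_ge0.
Qed.
Lemma Re_le_cabs z : complex.Re z <= cabs z.
Proof. exact: le_trans (ler_norm _) (cabs_Re _). Qed.
Lemma cabs_conj z : cabs (z^*) = cabs z.
Proof. by rewrite /cabs norm_conjC. Qed.
Lemma cabs_le_ReIm z : cabs z <= `|complex.Re z| + `|complex.Im z|.
Proof.
rewrite -(@ler_pXn2r _ 2)// ?nnegrE ?cabs_ge0 ?addr_ge0// sqr_cabs sqrrD.
by rewrite !real_normK ?num_real// lerD2r lerDl mulrn_wge0 ?mulr_ge0.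
Qed.
Lemma mul_conj_cabs z : z * z^* = ((cabs z) ^+ 2)%:C%C.
Proof. by rewrite -normCK normE rmorphXn. Qed.
Lemma Re_mul_conj z : complex.Re (z * z^*) = cabs z ^+ 2.
Proof. by rewrite mul_conj_cabs. Qed.
(** Rotating a number onto the positive axis turns an estimate of its modulus into one of a real
    part; the circle integrals below are integrals of real parts only. *)
Lemma cabs_phase z : exists2 c, cabs c = 1 & c * z = (cabs z)%:C%C.
Proof.
have [->|z0] := eqVneq z 0; first by exists 1; rewrite ?cabs1// mul1r cabs0.
exists (z^* / (cabs z)%:C%C).
  rewrite cabsM cabsV cabs_conj cabs_real ger0_norm ?cabs_ge0//.
  by rewrite divff// lt0r_neq0// cabs_gt0.
rewrite mulrAC [_ * z]mulrC mul_conj_cabs rmorphXn /= expr2 -mulrA divff ?mulr1//.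
by rewrite -normE normr_eq0.
Qed.
Lemma Re_phase c z : cabs c = 1 -> complex.Re (c * z) <= cabs z.
Proof. by move=> c1; rewrite (le_trans (Re_le_cabs _))// cabsM c1 mul1r. Qed.

End ComplexBasics.

(** * Integrals of continuous functions over segments *)

Section IntervalIntegrals.
Variable R : realType.
Implicit Types (f g : R -> R) (a b : R).
Notation mu := (@lebesgue_measure R).

Definition itg f a b : R := \int[mu]_(t in `[a, b]) f t.
Definition ctn_on f a b := forall t, a <= t <= b -> {for t, continuous f}.

Lemma ctn_within f a b : ctn_on f a b -> {within `[a, b], continuous f}.
Proof.
move=> cf; apply/continuous_in_subspaceT => t /set_mem /=.
by rewrite in_itv /= => tab; exact: cf.
Qed.

Lemma ctn_integrable f a b :
  ctn_on f a b -> mu.-integrable `[a, b] (EFin \o f).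
Proof.
move=> cf; apply: continuous_compact_integrable; first exact: segment_compact.
exact: ctn_within.
Qed.

Lemma ctn_onB f g a b : ctn_on f a b -> ctn_on g a b ->
  ctn_on (fun t => f t - g t) a b.
Proof. by move=> cf cg t tab; apply: cvgB; [exact: cf|exact: cg]. Qed.

Lemma ctn_on_sub f a b a' b' : a <= a' -> b' <= b -> ctn_on f a b ->
  ctn_on f a' b'.
Proof.
move=> aa bb cf t /andP[at_ tb]; apply: cf.
by rewrite (le_trans aa at_) (le_trans tb bb).
Qed.

Lemma lebesgue_itv_fine a b : a <= b -> fine (mu `[a, b]%classic) = b - a.
Proof.
move=> ab; rewrite lebesgue_measure_itv /= lte_fin.
have [//|] := ltP a b => ba; by rewrite (@le_anti _ _ a b) ?subrr// ab ba.
Qed.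

Lemma itgB f g a b : ctn_on f a b -> ctn_on g a b ->
  itg (fun t => f t - g t) a b = itg f a b - itg g a b.
Proof.
by move=> cf cg; rewrite /itg RintegralB//; exact: ctn_integrable.
Qed.

Lemma itg_cst c a b : a <= b -> itg (fun=> c) a b = c * (b - a).
Proof.
by move=> ab; rewrite /itg Rintegral_cst ?lebesgue_itv_fine.
Qed.

Lemma ctn_on_cst c a b : ctn_on (fun=> c) a b.
Proof. by move=> t _; exact: cvg_cst. Qed.

Lemma le_itg f g a b : ctn_on f a b -> ctn_on g a b ->
  (forall t, a <= t <= b -> f t <= g t) -> itg f a b <= itg g a b.
Proof.
move=> cf cg fg; by apply: le_Rintegral => //; exact: ctn_integrable.
Qed.

Lemma itg_near_cst f a b c eta : a <= b -> ctn_on f a b ->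
  (forall t, a <= t <= b -> `|f t - c| <= eta) ->
  `|itg f a b - c * (b - a)| <= eta * (b - a).
Proof.
move=> ab cf fc; rewrite ler_distl -(itg_cst c ab) -(itg_cst eta ab); apply/andP; split.
  rewrite -itgB; try exact: ctn_on_cst.
  apply: le_itg => //; first by apply: ctn_onB; exact: ctn_on_cst.
  by move=> t /fc; rewrite ler_distl => /andP[].
rewrite (itg_cst eta ab) (itg_cst c ab) -mulrDl -itg_cst//.
apply: le_itg => //; first exact: ctn_on_cst.
by move=> t /fc; rewrite ler_distl => /andP[].
Qed.

Lemma itg_split f a m b : a <= m -> m <= b -> ctn_on f a b ->
  itg f a b = itg f a m + itg f m b.
Proof.
move=> am mb cf; rewrite /itg -(@Rintegral_itv_obnd_cbnd R m (BRight b)).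
  rewrite -Rintegral_setU//=.
  - by congr Rintegral; rewrite -itv_bndbnd_setU// bnd_simp.
  - by rewrite -itv_bndbnd_setU ?bnd_simp//; exact: ctn_integrable.
  - by rewrite disj_set2E; apply/eqP; rewrite -subset0 => t [/=]; rewrite !in_itv /=; lra.
apply: (@integrableS _ _ _ mu `[m, b]) => //.
  by apply: subset_itvr; rewrite bnd_simp.
by apply: ctn_integrable; exact: ctn_on_sub cf.
Qed.

End IntervalIntegrals.

(** * Goursat's lemma *)

Section Goursat.
Variable R : realType.

(* F has at (x, y) the complex-linear differential m: the Cauchy-Riemann equations. *)
Definition CRd (F : R -> R -> Cplx R) (x y : R) (m : Cplx R) :=
  forall e : R, 0 < e -> exists2 dl : R, 0 < dl & forall a b : R, `|a| < dl -> `|b| < dl ->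
    cabs (F (x + a) (y + b) - F x y - m * (a +i* b)%C) <= e * (`|a| + `|b|).

Lemma half_exp2 (a : R) n : a / 2 ^+ n = a / 2 ^+ n.+1 + a / 2 ^+ n.+1.
Proof. by rewrite exprS; field; rewrite expf_neq0. Qed.

Section Dyadic.
Variables (x0 y0 a b : R) (P : R -> R -> nat -> Prop).
Hypotheses (a0 : 0 <= a) (b0 : 0 <= b).

Definition inside x y n := [/\ x0 <= x, x + a / 2 ^+ n <= x0 + a,
  y0 <= y & y + b / 2 ^+ n <= y0 + b].

Hypothesis step : forall x y n, inside x y n ->
  P x y n.+1 -> P (x + a / 2 ^+ n.+1) y n.+1 ->
  P x (y + b / 2 ^+ n.+1) n.+1 ->
  P (x + a / 2 ^+ n.+1) (y + b / 2 ^+ n.+1) n.+1 -> P x y n.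
Hypothesis loc : forall px py, x0 <= px <= x0 + a -> y0 <= py <= y0 + b ->
  exists N, forall n x y, (N <= n)%N -> inside x y n ->
    x <= px <= x + a / 2 ^+ n -> y <= py <= y + b / 2 ^+ n -> P x y n.

(** Bisection: if P failed, some quarter would fail, then a quarter of that quarter, and so on;
    these rectangles shrink to a point, and near that point [loc] makes P true. *)
Lemma dyadic_induction : P x0 y0 0.
Proof.
apply: contrapT => nP.
pose bad (s : R * R) n := inside s.1 s.2 n /\ ~ P s.1 s.2 n.
(* [f] selects a bad quarter of a bad rectangle; its value elsewhere is arbitrary. *)
have /boolp.choice[f fP] : forall s : (R * R) * nat, exists t : R * R,
    bad s.1 s.2 -> [/\ bad t s.2.+1, s.1.1 <= t.1,
     t.1 + a / 2 ^+ s.2.+1 <= s.1.1 + a / 2 ^+ s.2,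
     s.1.2 <= t.2 & t.2 + b / 2 ^+ s.2.+1 <= s.1.2 + b / 2 ^+ s.2].
  move=> [[x y] n] /=.
  have [|nb] := pselect (bad (x, y) n); last by exists 0.
  move=> [/= ins nPn].
  have ha : 0 <= a / 2 ^+ n.+1 by rewrite divr_ge0.
  have hb : 0 <= b / 2 ^+ n.+1 by rewrite divr_ge0.
  have ea := half_exp2 a n; have eb := half_exp2 b n.
  have [i1 i2 i3 i4] := ins.
  have [P1|N1] := pselect (P x y n.+1); last first.
    exists (x, y) => _; split => /=; try lra.
    by split => //=; split; lra.
  have [P2|N2] := pselect (P (x + a / 2 ^+ n.+1) y n.+1); last first.
    exists (x + a / 2 ^+ n.+1, y) => _; split => /=; try lra.
    by split => //=; split; lra.
  have [P3|N3] := pselect (P x (y + b / 2 ^+ n.+1) n.+1); last first.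
    exists (x, y + b / 2 ^+ n.+1) => _; split => /=; try lra.
    by split => //=; split; lra.
  exists (x + a / 2 ^+ n.+1, y + b / 2 ^+ n.+1) => _; split => /=; try lra.
  split => //=; first by split; lra.
  by move=> P4; apply: nPn; exact: step.
pose u := fix u n := if n is m.+1 then f (u m, m) else (x0, y0).
have ub n : bad (u n) n.
  elim: n => [|n IH] /=; last by have [] := fP (u n, n) IH.
  by split => //=; split; rewrite /= ?expr0 ?divr1.
have mono n k : [/\ (u n).1 <= (u (n + k)%N).1,
     (u (n + k)%N).1 + a / 2 ^+ (n + k) <= (u n).1 + a / 2 ^+ n,
     (u n).2 <= (u (n + k)%N).2 &
     (u (n + k)%N).2 + b / 2 ^+ (n + k) <= (u n).2 + b / 2 ^+ n].
  elim: k => [|k [h1 h2 h3 h4]]; first by rewrite addn0.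
  rewrite addnS; have [_ /= g1 g2 g3 g4] := fP (u (n + k)%N, (n + k)%N) (ub _).
  by split; [exact: le_trans g1|exact: le_trans h2|exact: le_trans g3|exact: le_trans h4].
(* Nested intervals: the supremum of the left ends lies in all of them. *)
have lim (v : nat -> R) (c : R) : 0 <= c ->
    (forall n k, v n <= v (n + k)%N /\ v (n + k)%N + c / 2 ^+ (n + k) <= v n + c / 2 ^+ n) ->
    exists p, forall n, v n <= p <= v n + c / 2 ^+ n.
  move=> c0 vm.
  have vle n m : v m <= v n + c / 2 ^+ n.
    have [nm|/ltnW mn] := leqP n m.
      have [_ h] := vm n (m - n)%N; rewrite subnKC// in h.
      by apply: le_trans h; rewrite lerDl divr_ge0.
    have [h _] := vm m (n - m)%N; rewrite subnKC// in h.
    by rewrite (le_trans h)// lerDl divr_ge0.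
  have hs : has_sup (range v).
    split; first by exists (v 0), 0.
    by exists (v 0 + c / 2 ^+ 0) => _ [m _ <-].
  exists (sup (range v)) => n; apply/andP; split.
    by apply: ub_le_sup; [case: hs|exists n].
  by apply: ge_sup; [case: hs|move=> _ [m _ <-]].
have [px pxP] : exists px, forall n, (u n).1 <= px <= (u n).1 + a / 2 ^+ n.
  by apply: lim => // n k; have [] := mono n k.
have [py pyP] : exists py, forall n, (u n).2 <= py <= (u n).2 + b / 2 ^+ n.
  by apply: lim => // n k; have [] := mono n k.
have [||N NP] := loc (px := px) (py := py).
- by have := pxP 0; rewrite /= expr0 divr1.
- by have := pyP 0; rewrite /= expr0 divr1.
have [ins nPN] := ub N.
by apply: nPN; exact: NP.
Qed.

End Dyadic.

Lemma CRd_continuous F x y m : CRd F x y m ->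
  forall e : R, 0 < e -> exists2 dl : R, 0 < dl & forall a b : R, `|a| < dl -> `|b| < dl ->
    cabs (F (x + a) (y + b) - F x y) <= e.
Proof.
move=> Fm e e0; have [dl dl0 H] := Fm 1 ltr01.
have c0 : 0 < 2 + 2 * cabs m by have := cabs_ge0 m; lra.
pose k := e / (2 + 2 * cabs m).
have k0 : 0 < k by rewrite divr_gt0.
have ek : e = (2 + 2 * cabs m) * k by rewrite mulrC divfK// gt_eqF.
exists (Num.min dl k); first by rewrite lt_min dl0 k0.
move=> a b; rewrite !lt_min => /andP[a1 a2] /andP[b1 b2].
have ab : `|a| + `|b| <= 2 * k by rewrite mulr2n mulrDl mul1r lerD// ltW.
rewrite -(subrK (m * (a +i* b)%C) (_ - _)) (le_trans (cabsD _ _))// cabsM ek mulrDl.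
apply: lerD; first by rewrite (le_trans (H a b a1 b1))// mul1r.
rewrite [2 * cabs m]mulrC -mulrA ler_wpM2l ?cabs_ge0//.
by apply: le_trans ab; exact: (cabs_le_ReIm (a +i* b)%C).
Qed.

Lemma continuous_eps (f : R -> R) x :
  (forall e : R, 0 < e -> exists2 dl : R, 0 < dl & forall a, `|a| < dl -> `|f (x + a) - f x| <= e) ->
  {for x, continuous f}.
Proof.
move=> H; apply/cvgrPdist_le => e e0; have [dl dl0 Hd] := H e e0.
near=> z; rewrite distrC -[in f z](subrK x z) [_ + x]addrC; apply: Hd.
near: z; exists dl => //= z /=; by rewrite distrC.
Unshelve. all: by end_near. Qed.

Lemma CRd_cont1 F x y m : CRd F x y m ->
  {for x, continuous (fun t => complex.Re (F t y))} /\
  {for x, continuous (fun t => complex.Im (F t y))}.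
Proof.
move=> /CRd_continuous H; split; apply: continuous_eps => e /H[dl dl0 Hd];
  exists dl => // a adl; have := Hd a 0 adl; rewrite normr0 addr0 => /(_ dl0);
  apply: le_trans.
  by rewrite -ReN -ReD cabs_Re.
by rewrite -ImN -ImD cabs_Im.
Qed.

Lemma CRd_cont2 F x y m : CRd F x y m ->
  {for y, continuous (fun t => complex.Re (F x t))} /\
  {for y, continuous (fun t => complex.Im (F x t))}.
Proof.
move=> /CRd_continuous H; split; apply: continuous_eps => e /H[dl dl0 Hd];
  exists dl => // a adl; have := Hd 0 a; rewrite normr0 addr0 => /(_ dl0 adl);
  apply: le_trans.
  by rewrite -ReN -ReD cabs_Re.
by rewrite -ImN -ImD cabs_Im.
Qed.

(** The sum is the imaginary part of the integral of F dz around the rectangle. The derivative is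
    not assumed continuous, so the proof bisects instead of using Green's formula. *)
Lemma goursat (F : R -> R -> Cplx R) (x0 x1 y0 y1 : R) : x0 <= x1 -> y0 <= y1 ->
  (forall x y, x0 <= x <= x1 -> y0 <= y <= y1 -> exists m, CRd F x y m) ->
  itg (fun t => complex.Im (F t y0) - complex.Im (F t y1)) x0 x1 +
  itg (fun t => complex.Re (F x1 t) - complex.Re (F x0 t)) y0 y1 = 0.
Proof.
move=> x01 y01 FC.
pose A x y := complex.Im (F x y); pose B x y := complex.Re (F x y).
pose I x y a b := itg (fun t => A t y - A t (y + b)) x (x + a) +
  itg (fun t => B (x + a) t - B x t) y (y + b).
pose a := x1 - x0; pose b := y1 - y0.
have a0 : 0 <= a by rewrite subr_ge0.
have b0 : 0 <= b by rewrite subr_ge0.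
have ea : x0 + a = x1 by rewrite addrC subrK.
have eb : y0 + b = y1 by rewrite addrC subrK.
have cA y : y0 <= y <= y1 -> ctn_on (A^~ y) x0 x1.
  by move=> yy x xx; have [m /CRd_cont1[]] := FC x y xx yy.
have cB x : x0 <= x <= x1 -> ctn_on (B x) y0 y1.
  by move=> xx y yy; have [m /CRd_cont2[]] := FC x y xx yy.
suff : forall e : R, 0 < e -> `|I x0 y0 a b| <= e.
  move=> H; have : `|I x0 y0 a b| <= 0.
    by apply/ler_addgt0Pr => e e0; rewrite add0r H.
  by rewrite normr_le0 => /eqP; rewrite /I ea eb.
move=> e' e'0.
(* The final bound is 2 e (a + b)^2; the added 1 keeps the denominator positive for a degenerate
   rectangle. *)
pose e := e' / (2 * (a + b + 1) ^+ 2).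
have s0 : 0 < 2 * (a + b + 1) ^+ 2 by rewrite mulr_gt0// exprn_gt0// ltr_wpDl// addr_ge0.
have e0 : 0 < e by rewrite divr_gt0.
(* A bound quadratic in the size is stable under quartering: four times the bound at half the size
   is the bound at full size. *)
pose P x y n : Prop := `|I x y (a / 2 ^+ n) (b / 2 ^+ n)| <=
  2 * e * (a / 2 ^+ n + b / 2 ^+ n) ^+ 2.
suff : P x0 y0 0.
  rewrite /P expr0 !divr1 => /le_trans; apply.
  rewrite [2 * e]mulrC -mulrA -[leRHS](divfK (lt0r_neq0 s0)) -/e.
  rewrite ler_wpM2l ?(ltW e0)// ler_wpM2l//.
  have ab0 : 0 <= a + b by rewrite addr_ge0.
  by apply: lerXn2r; rewrite ?nnegrE; lra.
have IE x y p q : 0 <= p -> 0 <= q -> x0 <= x -> x + p <= x1 -> y0 <= y -> y + q <= y1 ->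
    I x y p q = itg (A^~ y) x (x + p) - itg (A^~ (y + q)) x (x + p) +
      (itg (B (x + p)) y (y + q) - itg (B x) y (y + q)).
  move=> p0 q0 i1 i2 i3 i4; rewrite /I !itgB//.
  - by apply: (ctn_on_sub i3 i4); apply: cB; rewrite ?i1 ?i2 ?(le_trans i1) ?(le_trans _ i2) ?lerDl.
  - by apply: (ctn_on_sub i3 i4); apply: cB; rewrite ?i1 ?i2 ?(le_trans i1) ?(le_trans _ i2) ?lerDl.
  - by apply: (ctn_on_sub i1 i2); apply: cA; rewrite ?i3 ?i4 ?(le_trans i3) ?(le_trans _ i4) ?lerDl.
  - by apply: (ctn_on_sub i1 i2); apply: cA; rewrite ?i3 ?i4 ?(le_trans i3) ?(le_trans _ i4) ?lerDl.
have Isplit x y p q : 0 <= p -> 0 <= q -> x0 <= x -> x + p + p <= x1 -> y0 <= y ->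
    y + q + q <= y1 -> I x y (p + p) (q + q) =
    I x y p q + I (x + p) y p q + I x (y + q) p q + I (x + p) (y + q) p q.
  move=> p0 q0 i1 i2 i3 i4.
  have j1 : x + p <= x1 by apply: le_trans i2; rewrite lerDl.
  have j2 : x0 <= x + p by apply: le_trans i1 _; rewrite lerDl.
  have j3 : y + q <= y1 by apply: le_trans i4; rewrite lerDl.
  have j4 : y0 <= y + q by apply: le_trans i3 _; rewrite lerDl.
  have xp : x <= x + p by rewrite lerDl.
  have yq : y <= y + q by rewrite lerDl.
  have k1 : y0 <= y <= y1 by rewrite i3 (le_trans yq j3).
  have k2 : y0 <= y + q + q <= y1 by rewrite i4 (le_trans j4)// lerDl.
  have k3 : x0 <= x <= x1 by rewrite i1 (le_trans xp j1).
  have k4 : x0 <= x + p + p <= x1 by rewrite i2 (le_trans j2)// lerDl.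
  rewrite !IE ?addrA//; [|by rewrite addr_ge0..].
  rewrite (@itg_split _ (A^~ y) x (x + p) (x + p + p)) ?lerDl//; last first.
    by apply: (ctn_on_sub i1 i2); exact: cA.
  rewrite (@itg_split _ (A^~ (y + q + q)) x (x + p) (x + p + p)) ?lerDl//; last first.
    by apply: (ctn_on_sub i1 i2); exact: cA.
  rewrite (@itg_split _ (B (x + p + p)) y (y + q) (y + q + q)) ?lerDl//; last first.
    by apply: (ctn_on_sub i3 i4); exact: cB.
  rewrite (@itg_split _ (B x) y (y + q) (y + q + q)) ?lerDl//; last first.
    by apply: (ctn_on_sub i3 i4); exact: cB.
  ring.
apply: (@dyadic_induction x0 y0 a b P) => //.
- move=> x y n [i1 i2 i3 i4]; rewrite /P.
  rewrite ea half_exp2 addrA in i2; rewrite eb half_exp2 addrA in i4; rewrite !(half_exp2 _ n).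
  set p := a / _ in i2 *; set q := b / _ in i4 * => H1 H2 H3 H4.
  have p0 : 0 <= p by rewrite divr_ge0.
  have q0 : 0 <= q by rewrite divr_ge0.
  rewrite Isplit//.
  apply: le_trans (ler_normD _ _) _; apply: le_trans (lerD (ler_normD _ _) (lexx _)) _.
  apply: le_trans (lerD (lerD (ler_normD _ _) (lexx _)) (lexx _)) _.
  apply: le_trans (lerD (lerD (lerD H1 H2) H3) H4) _.
  by rewrite le_eqVlt; apply/orP; left; apply/eqP; ring.
- rewrite ea eb => px py pxx pyy; have [m Fm] := FC px py pxx pyy.
  have [dl dl0 Hd] := Fm e e0.
  have [N NP] : exists N, forall n, (N <= n)%N -> a / 2 ^+ n < dl /\ b / 2 ^+ n < dl.
    exists (maxn (Num.bound (a / dl)) (Num.bound (b / dl))) => n.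
    rewrite geq_max => /andP[/upper_nthrootP h1 /upper_nthrootP h2].
    by rewrite !ltr_pdivrMr ?exprn_gt0// ![dl * _]mulrC -!ltr_pdivrMr.
  exists N => n x y Nn [i1 i2 i3 i4] xp yp; have [ad bd] := NP n Nn; rewrite /P.
  rewrite ea in i2; rewrite eb in i4.
  move: ad bd i2 i4 xp yp; set p := a / _; set q := b / _ => ad bd i2 i4 xp yp.
  have p0 : 0 <= p by rewrite divr_ge0.
  have q0 : 0 <= q by rewrite divr_ge0.
  have xx : x0 <= x <= x1 by rewrite i1 (le_trans _ i2)// lerDl.
  have xx' : x0 <= x + p <= x1 by rewrite i2 (le_trans i1)// lerDl.
  have yy : y0 <= y <= y1 by rewrite i3 (le_trans _ i4)// lerDl.
  have yy' : y0 <= y + q <= y1 by rewrite i4 (le_trans i3)// lerDl.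
  have H u v : x <= u <= x + p -> y <= v <= y + q ->
      cabs (F u v - F px py - m * ((u - px) +i* (v - py))%C) <= e * (p + q).
    move=> ux vy.
    have h1 : `|u - px| <= p by rewrite ler_norml; lra.
    have h2 : `|v - py| <= q by rewrite ler_norml; lra.
    have := Hd (u - px) (v - py) (le_lt_trans h1 ad) (le_lt_trans h2 bd).
    rewrite ![_ + (_ - _)]addrC !subrK => /le_trans; apply.
    by rewrite ler_wpM2l ?(ltW e0)// lerD.
  (* The linear part of F contributes the constant [- Re m * q] to the first integrand and
     [Re m * p] to the second, and their integrals cancel. The remainders add up to 2 e (p + q) p +
     2 e (p + q) q. *)
  have HA : `|itg (fun t => A t y - A t (y + q)) x (x + p) -
      (- (complex.Re m * q)) * (x + p - x)| <= 2 * (e * (p + q)) * (x + p - x).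
    apply: itg_near_cst; first by rewrite lerDl.
      by apply: ctn_onB; apply: (ctn_on_sub i1 i2); exact: cA.
    move=> t tx.
    have hy : y <= y <= y + q by rewrite lexx lerDl.
    have hyq : y <= y + q <= y + q by rewrite lexx lerDl q0.
    have K1 := le_trans (cabs_Im _) (H t y tx hy).
    have K2 := le_trans (cabs_Im _) (H t (y + q) tx hyq).
    rewrite (_ : _ - _ - _ = complex.Im (F t y - F px py - m * ((t - px) +i* (y - py))%C) -
       complex.Im (F t (y + q) - F px py - m * ((t - px) +i* (y + q - py))%C)); last first.
      by rewrite /A !(ImD, ImN, ImM) /=; ring.
    by rewrite (le_trans (ler_normB _ _))// mulr2n mulrDl mul1r lerD.
  have HB : `|itg (fun t => B (x + p) t - B x t) y (y + q) -
      (complex.Re m * p) * (y + q - y)| <= 2 * (e * (p + q)) * (y + q - y).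
    apply: itg_near_cst; first by rewrite lerDl.
      by apply: ctn_onB; apply: (ctn_on_sub i3 i4); exact: cB.
    move=> t ty.
    have hx : x <= x <= x + p by rewrite lexx lerDl.
    have hxp : x <= x + p <= x + p by rewrite lexx lerDl p0.
    have K1 := le_trans (cabs_Re _) (H (x + p) t hxp ty).
    have K2 := le_trans (cabs_Re _) (H x t hx ty).
    rewrite (_ : _ - _ - _ = complex.Re (F (x + p) t - F px py - m * ((x + p - px) +i* (t - py))%C) -
       complex.Re (F x t - F px py - m * ((x - px) +i* (t - py))%C)); last first.
      by rewrite /B !(ReD, ReN, ReM) /=; ring.
    by rewrite (le_trans (ler_normB _ _))// mulr2n mulrDl mul1r lerD.
  rewrite (_ : I x y p q =
    (itg (fun t => A t y - A t (y + q)) x (x + p) - (- (complex.Re m * q)) * (x + p - x)) +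
    (itg (fun t => B (x + p) t - B x t) y (y + q) - (complex.Re m * p) * (y + q - y))).
    apply: le_trans (ler_normD _ _) _; apply: le_trans (lerD HA HB) _.
    by rewrite le_eqVlt; apply/orP; left; apply/eqP; ring.
  rewrite /I; ring.
Qed.

End Goursat.

(** * One complex variable *)

Section CRcalculus.
Variable R : realType.
Implicit Types (F G : R -> R -> Cplx R) (g : Cplx R -> Cplx R).

Definition cdiff g (w m : Cplx R) := forall e : R, 0 < e ->
  exists2 dl : R, 0 < dl & forall h, cabs h < dl ->
    cabs (g (w + h) - g w - m * h) <= e * cabs h.

Lemma CRd_comp g F x y m1 m2 : cdiff g (F x y) m1 -> CRd F x y m2 ->
  CRd (fun x y => g (F x y)) x y (m1 * m2).
Proof.
move=> dg dF e e0.
have c1 : 0 < 1 + cabs m1 by rewrite ltr_pwDl// cabs_ge0.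
have c2 : 0 < 1 + cabs m2 by rewrite ltr_pwDl// cabs_ge0.
pose e2 := e / 2 / (1 + cabs m1); have e20 : 0 < e2 by rewrite !divr_gt0.
pose e1 := e / 2 / (1 + cabs m2); have e10 : 0 < e1 by rewrite !divr_gt0.
have [d1 d10 H1] := dg e1 e10.
have [d2 d20 H2] := dF (Num.min e2 1) ltac:(by rewrite lt_min e20 ltr01).
have [d3 d30 H3] := CRd_continuous dF (e := d1 / 2) ltac:(by rewrite divr_gt0).
exists (Num.min d2 d3); first by rewrite lt_min d20 d30.
move=> a b; rewrite !lt_min => /andP[a1 a2] /andP[b1 b2].
set h := F (x + a) (y + b) - F x y.
have Hh : cabs h < d1.
  by apply: le_lt_trans (H3 a b a2 b2) _; rewrite ltr_pdivrMr// ltr_pMr// ltr1n.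
have Hg := H1 _ Hh; rewrite [F x y + h]addrC subrK in Hg.
have HF := H2 a b a1 b1.
set s := `|a| + `|b| in HF *; set q := (a +i* b)%C in HF *.
have s0 : 0 <= s by rewrite addr_ge0.
have qs : cabs q <= s by exact: (cabs_le_ReIm q).
have HFe : cabs (h - m2 * q) <= e2 * s by rewrite (le_trans HF)// ler_wpM2r// ge_min lexx.
have HF1 : cabs (h - m2 * q) <= s by rewrite (le_trans HF)// ler_piMl// ge_min lexx orbT.
have hs : cabs h <= (1 + cabs m2) * s.
  rewrite -(subrK (m2 * q) h) (le_trans (cabsD _ _))// mulrDl mul1r lerD//.
  by rewrite cabsM ler_wpM2l// cabs_ge0.
rewrite (_ : _ - _ - _ = g (F (x + a) (y + b)) - g (F x y) - m1 * h + m1 * (h - m2 * q)); last by ring.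
rewrite (le_trans (cabsD _ _))// cabsM.
have -> : e * s = e1 * ((1 + cabs m2) * s) + (1 + cabs m1) * (e2 * s).
  by rewrite /e1 /e2; field; rewrite !gt_eqF.
apply: lerD; first by rewrite (le_trans Hg)// ler_wpM2l// ltW.
by apply: ler_pM => //; rewrite ?cabs_ge0// lerDr.
Qed.

Lemma CRd_mul F G x y m1 m2 : CRd F x y m1 -> CRd G x y m2 ->
  CRd (fun x y => F x y * G x y) x y (m1 * G x y + F x y * m2).
Proof.
move=> dF dG e e0.
pose K := 1 + cabs (G x y) + cabs (F x y) + cabs m1.
have h1 := cabs_ge0 (G x y); have h2 := cabs_ge0 (F x y); have h3 := cabs_ge0 m1.
have K0 : 0 < K by rewrite /K; lra.
pose e1 := e / (2 * K); have e10 : 0 < e1 by rewrite divr_gt0// mulr_gt0.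
have [d1 d10 H1] := dF e1 e10.
have [d2 d20 H2] := dG e1 e10.
have [d3 d30 H3] := CRd_continuous dG (e := Num.min e1 1) ltac:(by rewrite lt_min e10 ltr01).
exists (Num.min (Num.min d1 d2) d3); first by rewrite !lt_min d10 d20 d30.
move=> a b; rewrite !lt_min => /andP[/andP[a1 a2] a3] /andP[/andP[b1 b2] b3].
have K1 := H1 a b a1 b1; have K2 := H2 a b a2 b2; have K3 := H3 a b a3 b3.
move: K1 K2 K3; set s := `|a| + `|b|; set q := (a +i* b)%C.
set F' := F (x + a) _; set G' := G (x + a) _ => K1 K2 K3.
have s0 : 0 <= s by rewrite addr_ge0.
have qs : cabs q <= s by exact: (cabs_le_ReIm q).
have K3a : cabs (G' - G x y) <= e1 by rewrite (le_trans K3)// ge_min lexx.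
have K3b : cabs (G' - G x y) <= 1 by rewrite (le_trans K3)// ge_min lexx orbT.
have G'b : cabs G' <= 1 + cabs (G x y).
  by rewrite -(subrK (G x y) G') (le_trans (cabsD _ _))// lerD2r.
rewrite (_ : _ - _ - _ = (F' - F x y - m1 * q) * G' + m1 * q * (G' - G x y) +
  F x y * (G' - G x y - m2 * q)); last by ring.
rewrite (le_trans (cabsD _ _))// (le_trans (lerD (cabsD _ _) (lexx _)))// !cabsM.
have -> : e * s = (e1 * s) * K + (e1 * s) * K by rewrite /e1; field; rewrite gt_eqF.
have es0 : 0 <= e1 * s by rewrite mulr_ge0// ltW.
have T1 : cabs (F' - F x y - m1 * q) * cabs G' <= (e1 * s) * (1 + cabs (G x y)).
  by apply: ler_pM; rewrite ?cabs_ge0.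
have T2 : cabs m1 * cabs q * cabs (G' - G x y) <= (e1 * s) * cabs m1.
  rewrite mulrAC -mulrA [leRHS]mulrC ler_wpM2l ?cabs_ge0// .
  by apply: ler_pM; rewrite ?cabs_ge0.
have T3 : cabs (F x y) * cabs (G' - G x y - m2 * q) <= (e1 * s) * cabs (F x y).
  by rewrite [leRHS]mulrC ler_wpM2l// cabs_ge0.
have T4 : 0 <= (e1 * s) * K by rewrite mulr_ge0// ltW.
apply: le_trans (lerD (lerD T1 T2) T3) _.
rewrite [leLHS](_ : _ = (e1 * s) * K) ?lerDl// /K; ring.
Qed.

Lemma CRd_cst (c : Cplx R) (x y : R) : CRd (fun _ _ => c) x y 0.
Proof.
move=> e e0; exists 1 => // a b _ _.
by rewrite subrr mul0r subrr cabs0 mulr_ge0// ?ltW// addr_ge0.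
Qed.

Lemma CRd_add F G x y m1 m2 : CRd F x y m1 -> CRd G x y m2 ->
  CRd (fun x y => F x y + G x y) x y (m1 + m2).
Proof.
move=> dF dG e e0; have e20 : 0 < e / 2 by rewrite divr_gt0.
have [d1 d10 H1] := dF _ e20; have [d2 d20 H2] := dG _ e20.
exists (Num.min d1 d2); first by rewrite lt_min d10.
move=> a b; rewrite !lt_min => /andP[a1 a2] /andP[b1 b2].
rewrite [X in cabs X](_ : _ = (F (x + a) (y + b) - F x y - m1 * (a +i* b)%C) +
   (G (x + a) (y + b) - G x y - m2 * (a +i* b)%C)); last by ring.
apply: le_trans (cabsD _ _) _; apply: le_trans (lerD (H1 a b a1 b1) (H2 a b a2 b2)) _.
by rewrite -mulrDl -splitr.
Qed.

(** With z = x + iy, the point (s - x, y) is s - conj z, so two conjugations compose to a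
    holomorphic function. This makes |g|^2 on a circle the restriction of a holomorphic product. *)
Lemma CRd_reflect F s x y m : CRd F (s - x) y m ->
  CRd (fun x y => (F (s - x) y)^*) x y (- m^*).
Proof.
move=> dF e e0; have [d d0 H] := dF e e0; exists d => // a b ad bd.
have := H (- a) b; rewrite normrN => /(_ ad bd).
rewrite opprD addrA; apply: le_trans; rewrite -cabs_conj !(rmorphB, rmorphN, rmorphM) /= !conjCK.
rewrite le_eqVlt; apply/orP; left; apply/eqP; congr cabs; congr (_ - _).
rewrite mulNr -mulrN; congr (_ * _).
by apply/eqP; rewrite eq_complex /= opprK !eqxx.
Qed.

(** For F = [polar] this is the holomorphy of e^(-z), which replaces a quotient rule in Cauchy's
    estimate. *)
Lemma CRd_opp F x y m : CRd F (- x) (- y) m ->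
  CRd (fun x y => F (- x) (- y)) x y (- m).
Proof.
move=> dF e e0; have [d d0 H] := dF e e0; exists d => // a b ad bd.
have := H (- a) (- b); rewrite !normrN => /(_ ad bd).
rewrite !opprD; apply: le_trans.
rewrite le_eqVlt; apply/orP; left; apply/eqP; congr cabs; congr (_ - _).
by rewrite mulNr -mulrN; congr (_ * _).
Qed.

Lemma CRd_shift F s x y m : CRd F (s + x) y m -> CRd (fun x y => F (s + x) y) x y m.
Proof.
by move=> dF e e0; have [d d0 H] := dF e e0; exists d => // a b ad bd; rewrite addrA H.
Qed.

(** The exponential e^(u + it). In the coordinates (u, t) concentric circles are vertical segments,
    a punctured disc is a left half-plane, and its centre lies at u = -oo. *)
Definition polar (u t : R) : Cplx R := (expR u)%:C%C * (cos t +i* sin t)%C.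

Lemma cabs_polar u t : cabs (polar u t) = expR u.
Proof.
rewrite /polar cabsM cabs_real ger0_norm ?expR_ge0// /cabs /= cos2Dsin2.
by rewrite sqrtr1 mulr1.
Qed.

Lemma polarD u t a b : polar (u + a) (t + b) = polar u t * polar a b.
Proof.
rewrite /polar expRD rmorphM /= mulrACA; congr (_ * _).
by apply/eqP; rewrite eq_complex cosD sinD /= eqxx/= addrC [sin t * _]mulrC mulrC eqxx.
Qed.

Lemma polar00 : polar 0 0 = 1.
Proof. by rewrite /polar expR0 cos0 sin0 mul1r. Qed.

Lemma polar_opp u t : polar (- u) (- t) * polar u t = 1.
Proof. by rewrite -polarD !addNr polar00. Qed.

Lemma polar_2pi u t : polar u (t + 2 * pi) = polar u t.
Proof.
by rewrite /polar mulr_natl cosD2pi sinD2pi.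
Qed.

End CRcalculus.

(** * Cauchy's theorem and Cauchy's estimate on circles *)

Section CircleMeans.
Variable R : realType.
Implicit Types (F G : R -> R -> Cplx R) (g : Cplx R -> Cplx R).

Lemma derive_eps (K : numFieldType) (V : normedModType K) (f : V -> K^o) (a v : V) (df : K) :
  is_derive a v f df ->
  forall e : K, 0 < e -> exists2 dl : K, 0 < dl & forall h : K, `|h| < dl ->
    `|f (a + h *: v) - f a - h * df| <= e * `|h|.
Proof.
move=> [dfx <-] e e0.
move: (dfx) => /cvgrPdist_le/(_ e e0); rewrite /dnbhs near_withinE => -[dl /= dl0 H].
exists dl => // h hdl.
have [->|h0] := eqVneq h 0.
  by rewrite scale0r addr0 subrr mul0r subrr normr0 mulr0.
have {H} := H h; rewrite /= sub0r normrN => /(_ hdl h0).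
rewrite -[X in `|X - _|]/('D_v f a) => H.
have -> : f (a + h *: v) - f a - h * 'D_v f a =
    - (h * ('D_v f a - h^-1 * (f (h *: v + a) - f a))).
  by rewrite mulrBr mulVKf// opprB [h *: v + a]addrC.
by rewrite normrN normrM mulrC ler_wpM2r.
Qed.

Lemma is_derive_eps (f : R -> R) (x df : R) : is_derive x 1 f df ->
  forall e : R, 0 < e -> exists2 dl : R, 0 < dl & forall a : R, `|a| < dl ->
    `|f (x + a) - f x - df * a| <= e * `|a|.
Proof.
move=> D e e0; have [dl dl0 H] := @derive_eps R R f x 1 df D e e0.
by exists dl => // a /H; rewrite [a *: 1]mulr1 [a * df]mulrC.
Qed.

(** The functional equation [polarD] reduces the claim to the origin, where the derivatives of exp,
    cos and sin give it. *)
Lemma CRd_polar (x y : R) : CRd (@polar R) x y (polar x y).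
Proof.
suff H0 : CRd (@polar R) 0 0 1.
  move=> e e0; have K0 := expR_gt0 x.
  have [d d0 H] := H0 (e / expR x) ltac:(by rewrite divr_gt0).
  exists d => // a b ad bd; have := H a b ad bd; rewrite !add0r polar00 mul1r => H1.
  rewrite polarD (_ : _ - _ - _ = polar x y * (polar a b - 1 - (a +i* b)%C)); last by ring.
  by rewrite cabsM cabs_polar mulrC -ler_pdivlMr// mulrAC.
move=> e e0.
(* The errors below add up to at most e1 |a| + 8 e1 |b|. *)
have [e1 e10 [e1e e11]] : exists2 e1 : R, 0 < e1 & e1 <= e / 10 /\ e1 <= 1.
  exists (Num.min (e / 10) 1); first by rewrite lt_min ltr01 divr_gt0.
  by rewrite !ge_min !lexx orbT.
have [d1 d10 H1] := is_derive_eps (is_derive_expR 0) e10.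
have [d2 d20 H2] := is_derive_eps (is_derive_cos 0) e10.
have [d3 d30 H3] := is_derive_eps (is_derive_sin 0) e10.
exists (Num.min (Num.min d1 e1) (Num.min d2 (Num.min d3 1))).
  by rewrite !lt_min d10 d20 d30 e10 ltr01.
move=> a b; rewrite !lt_min => /andP[/andP[a1 ae] _] /andP[/andP[_ be] /andP[b2 /andP[b3 b1]]].
have {H1} := H1 a a1; have {H2} := H2 b b2; have {H3} := H3 b b3.
rewrite !add0r cos0 sin0 expR0 !oppr0 mul0r ?(addr0, subr0) !mul1r => H3 H2 H1.
have {}ae : `|a| <= e1 := ltW ae.
have E2 : `|expR a - 1| <= 2 * `|a|.
  rewrite -(subrK a (_ - _)) (le_trans (ler_normD _ _))// mulr2n mulrDl mul1r lerD2r.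
  by rewrite (le_trans H1)// ler_piMl.
have E3 : expR a <= 3.
  have := ler_norm (expR a - 1); have := normr_ge0 a; lra.
rewrite polar00; apply: le_trans (cabs_le_ReIm _) _.
rewrite !(ReD, ImD, ReN, ImN, ReM, ImM) /= !(mul0r, subr0, oppr0, addr0).
have -> : expR a * cos b - 1 - a = (expR a - 1 - a) + expR a * (cos b - 1) by ring.
have -> : expR a * sin b - b = expR a * (sin b - b) + b * (expR a - 1) by ring.
apply: le_trans (lerD (ler_normD _ _) (ler_normD _ _)) _.
rewrite !normrM [`|expR a|]ger0_norm ?expR_ge0//.
have a0 := normr_ge0 a; have b0 := normr_ge0 b.
have T1 : expR a * `|cos b - 1| <= 3 * (e1 * `|b|) by apply: ler_pM; rewrite ?expR_ge0.
have T2 : expR a * `|sin b - b| <= 3 * (e1 * `|b|) by apply: ler_pM; rewrite ?expR_ge0.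
have T3 : `|b| * `|expR a - 1| <= `|b| * (2 * e1).
  by rewrite ler_wpM2l// (le_trans E2)// ler_pM2l.
apply: le_trans (lerD (lerD H1 T1) (lerD T2 T3)) _.
have : e1 * `|a| <= e / 10 * `|a| by rewrite ler_wpM2r.
have : e1 * `|b| <= e / 10 * `|b| by rewrite ler_wpM2r.
have : 0 <= e * `|a| by rewrite mulr_ge0// ltW.
have : 0 <= e * `|b| by rewrite mulr_ge0// ltW.
clear; lra.
Qed.

(** Cauchy's theorem for an annulus, in logarithmic coordinates. *)
Lemma itg_circle F (u0 u1 : R) : u0 <= u1 ->
  (forall x y, u0 <= x <= u1 -> exists m, CRd F x y m) ->
  (forall x, F x (2 * pi) = F x 0) ->
  itg (fun t => complex.Re (F u0 t)) 0 (2 * pi) =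
  itg (fun t => complex.Re (F u1 t)) 0 (2 * pi).
Proof.
move=> u01 dF perF; have pi0 : 0 <= 2 * pi :> R by rewrite mulr_ge0// pi_ge0.
have := goursat u01 pi0 (fun x y xx _ => dF x y xx).
rewrite [X in itg X u0 u1](_ : _ = fun=> 0); last first.
  by apply/funext => t; rewrite perF subrr.
rewrite itg_cst// mul0r add0r itgB.
- by move/eqP; rewrite subr_eq0 => /eqP ->.
- by move=> t _; have [|m /CRd_cont2[]//] := dF u1 t; rewrite u01 lexx.
- by move=> t _; have [|m /CRd_cont2[]//] := dF u0 t; rewrite u01 lexx.
Qed.

(** The centre of the disc is only reached as u tends to -oo, so it enters through a limit. With F =
    c g^2 this is the mean value property, with F = c (g - g 0) / w Cauchy's formula for the
    derivative at 0. *)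
Lemma itg_circle_lim F (u1 L : R) :
  (forall x y, x <= u1 -> exists m, CRd F x y m) ->
  (forall x, F x (2 * pi) = F x 0) ->
  (forall e : R, 0 < e -> exists u0, forall u t, u <= u0 ->
     `|complex.Re (F u t) - L| <= e) ->
  itg (fun t => complex.Re (F u1 t)) 0 (2 * pi) = L * (2 * pi).
Proof.
move=> dF perF limF; have pi0 : 0 < 2 * pi :> R by rewrite mulr_gt0// pi_gt0.
apply/eqP; rewrite -subr_eq0 -normr_le0; apply/ler_addgt0Pr => e e0; rewrite add0r.
have [u0 H] := limF (e / (2 * pi)) ltac:(by rewrite divr_gt0).
pose u := Num.min u0 u1.
rewrite -(@itg_circle F u u1) ?ge_min ?lexx ?orbT//; last first.
  by move=> x y /andP[_ xu]; exact: dF.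
have := @itg_near_cst R (fun t => complex.Re (F u t)) 0 (2 * pi) L (e / (2 * pi)).
rewrite subr0 divfK ?gt_eqF//; apply; first exact: ltW.
  by move=> t _; have [|m /CRd_cont2[]//] := dF u t; rewrite ge_min lexx orbT.
by move=> t _; apply: H; rewrite ge_min lexx.
Qed.

Definition cdiff_on g (r : R) := forall w, cabs w <= r -> exists m, cdiff g w m.

Lemma cdiff_on_polar g r u : cdiff_on g r -> expR u <= r ->
  forall x y, x <= u -> exists m, CRd (fun x y => g (polar x y)) x y m.
Proof.
move=> dg ur x y xu; have [|m dm] := dg (polar x y).
  by rewrite cabs_polar (le_trans _ ur)// ler_expR.
by exists (m * polar x y); apply: CRd_comp => //; exact: CRd_polar.
Qed.

Lemma cdiff_continuous g w m : cdiff g w m ->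
  forall e : R, 0 < e -> exists2 dl : R, 0 < dl & forall h, cabs h <= dl ->
    cabs (g (w + h) - g w) <= e.
Proof.
move=> dg e e0; have [d d0 H] := dg 1 ltr01.
have c0 : 0 < 1 + cabs m by rewrite ltr_pwDl// cabs_ge0.
exists (Num.min (d / 2) (e / (1 + cabs m))); first by rewrite lt_min !divr_gt0.
move=> h; rewrite !le_min => /andP[h1 h2].
have hd : cabs h < d by apply: le_lt_trans h1 _; rewrite ltr_pdivrMr// ltr_pMr// ltr1n.
rewrite -(subrK (m * h) (_ - _)) (le_trans (cabsD _ _))// cabsM.
rewrite (le_trans (lerD (H h hd) (lexx _)))// -mulrDl.
by rewrite mulrC -ler_pdivlMr.
Qed.

Lemma small_expR (e : R) : 0 < e -> exists u0, forall u, u <= u0 -> expR u <= e.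
Proof.
move=> e0; exists (ln e) => u ue; rewrite -(@lnK _ e) ?posrE//.
by rewrite ler_expR.
Qed.

(** The mean value property is used for g^2, rotated so that its value at the centre is |g 0|^2; on
    the circle its real part is at most |g|^2. *)
Lemma mean_value_sqr g u : cdiff_on g (expR u) ->
  cabs (g 0) ^+ 2 * (2 * pi) <= itg (fun t => cabs (g (polar u t)) ^+ 2) 0 (2 * pi).
Proof.
move=> dg; have [c c1 cg] := cabs_phase (g 0 * g 0).
pose F (x y : R) := c * (g (polar x y) * g (polar x y)).
have dF x y : x <= u -> exists m, CRd F x y m.
  move=> xu; have [m dm] := cdiff_on_polar dg (lexx _) y xu.
  by eexists; apply: CRd_mul; [exact: CRd_cst|apply: CRd_mul; exact: dm].
have pF x : F x (2 * pi) = F x 0 by rewrite /F -{1 2}[2 * pi]add0r polar_2pi.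
have := @itg_circle_lim F u (cabs (g 0) ^+ 2) dF pF.
rewrite expr2 -cabsM => <-.
  apply: le_itg.
  - by move=> t _; have [m /CRd_cont2[]] := dF u t (lexx _).
  - move=> t _; have [m dm] := cdiff_on_polar dg (lexx _) t (lexx u).
    have [K1 K2] := CRd_cont2 dm.
    rewrite (_ : (fun t => _) = (fun t => complex.Re (g (polar u t)) * complex.Re (g (polar u t)) +
       complex.Im (g (polar u t)) * complex.Im (g (polar u t)))); last first.
      by apply/funext => s; rewrite sqr_cabs !expr2.
    by apply: cvgD; apply: cvgM.
  - by move=> t _; rewrite /F expr2 -cabsM; exact: Re_phase.
move=> e e0.
have [m0 dm0] : exists m, cdiff g 0 m by apply: dg; rewrite cabs0 expR_ge0.
pose K := 1 + cabs (g 0) + cabs (g 0).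
have K0 : 0 < K by have := cabs_ge0 (g 0); rewrite /K; lra.
have [dl dl0 H] := cdiff_continuous dm0 (e := Num.min 1 (e / K)) ltac:(by rewrite lt_min ltr01 divr_gt0).
have [u0 Hu0] := small_expR dl0.
exists u0 => v t vu0; have := H (polar v t); rewrite cabs_polar => /(_ (Hu0 _ vu0)).
rewrite add0r le_min => /andP[g1 g2].
rewrite -[X in _ - X]/(complex.Re (cabs (g 0 * g 0))%:C%C) -cg -ReN -ReD.
apply: le_trans (cabs_Re _) _; rewrite -mulrBr cabsM c1 mul1r.
rewrite (_ : _ - _ = (g (polar v t) - g 0) * (g (polar v t) - g 0 + g 0 + g 0)); last by ring.
rewrite cabsM -[leRHS](divfK (lt0r_neq0 K0)); apply: ler_pM; rewrite ?cabs_ge0//.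
by rewrite (le_trans (cabsD _ _))// lerD2r (le_trans (cabsD _ _))// lerD2r.
Qed.

(** The quotient (g w - g 0) / w tends to m0 at the centre, and on the circle of radius r its
    modulus is at most M / r. *)
Lemma cauchy_estimate g (m0 : Cplx R) (r M : R) : 0 < r -> cdiff_on g r -> cdiff g 0 m0 ->
  (forall w, cabs w = r -> cabs (g w - g 0) <= M) -> cabs m0 <= M / r.
Proof.
move=> r0 dg d0 gM; pose u := ln r; have ur : expR u = r by rewrite lnK.
have ur' : expR u <= r by rewrite ur.
have [c c1 cm] := cabs_phase m0.
pose F (x y : R) := (c * (g (polar x y) - g 0)) * polar (- x) (- y).
have pi0 : 0 < 2 * pi :> R by rewrite mulr_gt0// pi_gt0.
have dF x y : x <= u -> exists m, CRd F x y m.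
  move=> xu; have [m dm] := cdiff_on_polar dg ur' y xu.
  eexists; apply: CRd_mul; last by apply: CRd_opp; exact: CRd_polar.
  by apply: CRd_mul; [exact: CRd_cst|apply: CRd_add; [exact: dm|exact: CRd_cst]].
have pF x : F x (2 * pi) = F x 0.
  rewrite /F; congr (_ * _); first by rewrite -{1}[2 * pi]add0r polar_2pi.
  by rewrite oppr0 -(polar_2pi _ (- _)) addNr.
have lF (e : R) : 0 < e -> exists v0, forall v t, v <= v0 ->
    `|complex.Re (F v t) - cabs m0| <= e.
  move=> e0; have [dl dl0 H] := d0 e e0.
  have [v0 Hv0] := small_expR (e := dl / 2) ltac:(by rewrite divr_gt0).
  exists v0 => v t vv0; have := H (polar v t); rewrite cabs_polar add0r.
  have vdl : expR v < dl.
    by apply: le_lt_trans (Hv0 _ vv0) _; rewrite ltr_pdivrMr// ltr_pMr// ltr1n.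
  move=> /(_ vdl) H'.
  rewrite -[X in _ - X]/(complex.Re (cabs m0)%:C%C) -cm -ReN -ReD.
  apply: le_trans (cabs_Re _) _.
  rewrite (_ : _ - _ = c * (g (polar v t) - g 0 - m0 * polar v t) * polar (- v) (- t)).
    rewrite cabsM cabs_polar cabsM c1 mul1r expRN -ler_pdivlMr ?invr_gt0 ?expR_gt0//.
    by rewrite invrK.
  rewrite /F -[X in _ - X]mulr1 -(polar_opp v t); ring.
have Fc t : {for t, continuous (fun t => complex.Re (F u t))}.
  by have [m /CRd_cont2[]] := dF u t (lexx _).
rewrite -(ler_pM2r pi0) -(itg_circle_lim dF pF lF).
rewrite -[X in _ <= _ * X]subr0 -itg_cst ?(ltW pi0)//.
apply: le_itg => //; first exact: ctn_on_cst.
move=> t _; apply: le_trans (Re_le_cabs _) _; rewrite cabsM cabs_polar cabsM c1 mul1r expRN ur.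
by rewrite ler_wpM2r ?invr_ge0 ?(ltW r0)// gM// cabs_polar.
Qed.

End CircleMeans.

(** * First-order Taylor estimates with explicit constants *)

Section TaylorEstimates.
Variable R : realType.
Implicit Types (g : Cplx R -> Cplx R).

Lemma derive_of_eps (K : numFieldType) (V : normedModType K) (f : V -> K^o) (a v : V) (df : K) :
  (forall e : K, 0 < e -> exists2 dl : K, 0 < dl & forall h : K, `|h| < dl ->
    `|f (a + h *: v) - f a - h * df| <= e * `|h|) -> is_derive a v f df.
Proof.
move=> H; have cv : (fun h => h^-1 *: ((f \o shift a) (h *: v) - f a)) @ 0^' --> (df : K^o).
  apply/cvgrPdist_le => e e0; have [dl dl0 Hd] := H e e0.
  rewrite /dnbhs near_withinE; exists dl => //= h; rewrite /ball_ /= sub0r normrN => hdl h0.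
  have := Hd h hdl.
  have -> : f (a + h *: v) - f a - h * df = - (h * (df - h^-1 * (f (h *: v + a) - f a))).
    by rewrite mulrBr mulVKf// opprB [h *: v + a]addrC.
  by rewrite normrN normrM mulrC ler_pM2r ?normr_gt0.
by apply: DeriveDef; [apply/cvg_ex; exists df|exact: cvg_lim].
Qed.

(** The mean value theorem fails for complex values; it is applied to the real part of c g along the
    segment, where c rotates the increment onto the positive axis. *)
Lemma lipschitz_bound g (w h : Cplx R) (K : R) :
  (forall t : R, 0 <= t <= 1 -> exists2 m, cdiff g (w + t%:C%C * h) m & cabs m <= K) ->
  cabs (g (w + h) - g w) <= K * cabs h.
Proof.
move=> dg.
have [c c1 cE] := cabs_phase (g (w + h) - g w).
have /boolp.choice[m mP] : forall t : R, exists m, 0 <= t <= 1 ->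
    cdiff g (w + t%:C%C * h) m /\ cabs m <= K.
  by move=> t; have [/dg[m]|] := boolP (0 <= t <= 1); [exists m|exists 0].
pose phi t := complex.Re (c * g (w + t%:C%C * h)).
have dphi (t : R) : 0 <= t <= 1 -> is_derive t 1 phi (complex.Re (c * (m t * h))).
  move=> /mP[dm _]; apply: (@derive_of_eps R R phi) => e e0.
  have h0 : 0 < 1 + cabs h by rewrite ltr_pwDl// cabs_ge0.
  have [dl dl0 H] := dm (e / (1 + cabs h)) ltac:(by rewrite divr_gt0).
  exists (dl / (1 + cabs h)); first by rewrite divr_gt0.
  move=> a; rewrite ltr_pdivlMr// => adl.
  have ah : cabs (a%:C%C * h) < dl.
    by rewrite cabsM cabs_real (le_lt_trans _ adl)// ler_wpM2l// lerDr.
  have := H _ ah; rewrite cabsM cabs_real => H'.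
  have -> : phi (t + a *: 1) - phi t - a * complex.Re (c * (m t * h)) =
     complex.Re (c * (g (w + t%:C%C * h + a%:C%C * h) - g (w + t%:C%C * h) - m t * (a%:C%C * h))).
    rewrite /phi scaler1 rmorphD mulrDl addrA /=.
    move: (g _) (g _) (m t) => x y z.
    rewrite !(ReM, ReD, ReN, ImM, ImD, ImN) /=; ring.
  apply: le_trans (cabs_Re _) _; rewrite cabsM c1 mul1r; apply: le_trans H' _.
  rewrite mulrAC mulrA -mulrA -[leRHS]mulr1 ler_wpM2l ?mulr_ge0 ?(ltW e0)//.
  by rewrite ler_pdivrMr// mul1r lerDr.
have [||t] := @MVT_segment _ phi (fun t => complex.Re (c * (m t * h))) 0 1 ler01.
- by move=> t; rewrite in_itv /= => /andP[t0 t1]; apply: dphi; rewrite !ltW.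
- apply/continuous_in_subspaceT => t /set_mem /=; rewrite in_itv /= => /dphi d.
  by apply: differentiable_continuous; apply/derivable1_diffP; case: d.
rewrite in_itv /= => /mP[_ mK]; rewrite subr0 mulr1 /phi mul1r mul0r addr0 -ReN -ReD -mulrBr cE /= => ->.
by apply: le_trans (Re_phase _ c1) _; rewrite cabsM ler_wpM2r// cabs_ge0.
Qed.

Lemma cdiff_shift g (a w m : Cplx R) : cdiff g (a + w) m -> cdiff (fun z => g (a + z)) w m.
Proof. by move=> dg e /dg[dl dl0 H]; exists dl => // h /H; rewrite addrA. Qed.

Lemma cdiff_sub g1 g2 (w m1 m2 : Cplx R) : cdiff g1 w m1 -> cdiff g2 w m2 ->
  cdiff (fun z => g1 z - g2 z) w (m1 - m2).
Proof.
move=> d1 d2 e e0; have e20 : 0 < e / 2 by rewrite divr_gt0.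
have [a a0 H1] := d1 _ e20; have [b b0 H2] := d2 _ e20.
exists (Num.min a b); first by rewrite lt_min a0.
move=> h; rewrite lt_min => /andP[/H1 K1 /H2 K2].
rewrite [X in cabs X](_ : _ = (g1 (w + h) - g1 w - m1 * h) - (g2 (w + h) - g2 w - m2 * h)); last by ring.
apply: le_trans (cabsB _ _) _; apply: le_trans (lerD K1 K2) _.
by rewrite -mulrDl -splitr.
Qed.

Lemma cdiff_lin (k w : Cplx R) : cdiff (fun z => k * z) w k.
Proof.
move=> e e0; exists 1 => // h _.
by rewrite [X in cabs X](_ : _ = 0) ?cabs0 ?mulr_ge0 ?cabs_ge0 ?ltW//; ring.
Qed.

(** The constants depend on M and rho only, so the estimates hold uniformly over a bounded family
    and pass to limits. *)
Lemma taylor2 g (dg : Cplx R -> Cplx R) (rho M : R) : 0 < rho ->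
  (forall w, cabs w < rho -> cdiff g w (dg w)) ->
  (forall w, cabs w < rho -> cabs (g w) <= M) ->
  cabs (dg 0) <= 8 * M / rho /\
  forall l, cabs l <= rho / 4 ->
    cabs (g l - g 0 - dg 0 * l) <= 64 * M / rho ^+ 2 * cabs l ^+ 2.
Proof.
move=> rho0 Hd HM.
have r40 : 0 < rho / 4 by rewrite divr_gt0.
have M0 : 0 <= M by apply: le_trans (HM 0 _); rewrite ?cabs_ge0// cabs0.
have dgb w : cabs w <= rho / 2 -> cabs (dg w) <= 8 * M / rho.
  move=> wr; have sm z : cabs z <= rho / 4 -> cabs (w + z) < rho.
    move=> zr; apply: le_lt_trans (cabsD _ _) _; lra.
  have := @cauchy_estimate _ (fun z => g (w + z)) (dg w) (rho / 4) (2 * M) r40.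
  have -> : 2 * M / (rho / 4) = 8 * M / rho by field; rewrite gt_eqF.
  apply.
  - by move=> z zr; exists (dg (w + z)); apply: cdiff_shift; apply: Hd; exact: sm.
  - by apply: cdiff_shift; rewrite addr0; apply: Hd; lra.
  - move=> z zr; apply: le_trans (cabsB _ _) _; rewrite mulr2n mulrDl mul1r.
    by apply: lerD; apply: HM; apply: sm; rewrite ?zr// cabs0 ltW.
split; first by apply: dgb; rewrite cabs0 divr_ge0// ltW.
(* The derivative is not yet known to be differentiable. Cauchy's estimate for z |-> g (w + z) - g
   z, whose derivative at 0 is [dg w - dg 0], shows that it is Lipschitz at 0: the function is
   bounded by (8 M / rho) |w|, so its increments are at most twice that, and the radius is rho /
   4. *)
have dgl w : cabs w <= rho / 4 -> cabs (dg w - dg 0) <= 64 * M / rho ^+ 2 * cabs w.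
  move=> wr.
  have gl z : cabs z <= rho / 4 -> cabs (g (w + z) - g z) <= 8 * M / rho * cabs w.
    move=> zr; rewrite [w + z]addrC; apply: lipschitz_bound => t /andP[t0 t1].
    have tb : cabs (z + t%:C%C * w) <= rho / 2.
      rewrite (le_trans (cabsD _ _))// cabsM cabs_real ger0_norm//.
      have : t * cabs w <= cabs w by rewrite ler_piMl// cabs_ge0.
      lra.
    by exists (dg (z + t%:C%C * w)); [apply: Hd; lra|exact: dgb].
  have := @cauchy_estimate _ (fun z => g (w + z) - g z) (dg w - dg 0) (rho / 4) (16 * M / rho * cabs w) r40.
  have -> : 16 * M / rho * cabs w / (rho / 4) = 64 * M / rho ^+ 2 * cabs w by field; rewrite gt_eqF.
  apply.
  - move=> z zr; exists (dg (w + z) - dg z); apply: cdiff_sub.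
      by apply: cdiff_shift; apply: Hd; apply: le_lt_trans (cabsD _ _) _; lra.
    by apply: Hd; lra.
  - apply: cdiff_sub; last by apply: Hd; rewrite cabs0.
    by apply: cdiff_shift; rewrite addr0; apply: Hd; lra.
  - move=> z zr; apply: le_trans (cabsB _ _) _.
    have := gl z; rewrite zr lexx => /(_ isT) K1.
    have := gl 0; rewrite cabs0 (ltW r40) => /(_ isT) K2.
    by have := lerD K1 K2; rewrite -mulrDl; congr (_ <= _ * _); field; rewrite gt_eqF.
move=> l lr; have H := @lipschitz_bound (fun z => g z - dg 0 * z) 0 l (64 * M / rho ^+ 2 * cabs l).
rewrite add0r mulr0 subr0 [g l - _ - _]addrAC in H; rewrite [cabs l ^+ 2]expr2 mulrA; apply: H.
move=> t /andP[t0 t1].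
have tl : cabs (t%:C%C * l) <= cabs l.
  by rewrite cabsM cabs_real ger0_norm// ler_piMl// cabs_ge0.
exists (dg (t%:C%C * l) - dg 0).
  by rewrite add0r; apply: cdiff_sub; [apply: Hd; lra|exact: cdiff_lin].
rewrite (le_trans (dgl _ (le_trans tl lr)))// ler_wpM2l//.
by rewrite divr_ge0 ?exprn_ge0 ?mulr_ge0// ltW.
Qed.

End TaylorEstimates.

(** * Hadamard convexity and growth of circle means *)

Section Hadamard.
Variable R : realType.
Implicit Types (g : Cplx R -> Cplx R).

Definition circle_mean g (u : R) : R := itg (fun t => cabs (g (polar u t)) ^+ 2) 0 (2 * pi).

Lemma ctn_circle g r u : cdiff_on g r -> expR u <= r ->
  forall t, {for t, continuous (fun t => cabs (g (polar u t)) ^+ 2)}.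
Proof.
move=> dg ur t; have [m dm] := cdiff_on_polar dg ur t (lexx u).
have [K1 K2] := CRd_cont2 dm.
rewrite (_ : (fun t => _) = (fun t => complex.Re (g (polar u t)) * complex.Re (g (polar u t)) +
   complex.Im (g (polar u t)) * complex.Im (g (polar u t)))); last first.
  by apply/funext => s; rewrite sqr_cabs !expr2.
by apply: cvgD; apply: cvgM.
Qed.

Lemma pi2_gt0 : 0 < 2 * pi :> R.
Proof. by rewrite mulr_gt0// pi_gt0. Qed.

(* The function [F] below is holomorphic in [x + iy], so its integral over a
   vertical period is the same on the lines [x = 0], where it is the mean of
   [|g|^2], and [x = h]. *)
Lemma circle_mean_convex g r (s h tau : R) : cdiff_on g r -> 0 <= h ->
  expR (s + h) <= r -> 0 < tau ->
  2 * circle_mean g s <= tau * circle_mean g (s + h) + tau^-1 * circle_mean g (s - h).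
Proof.
move=> dg h0 shr tau0.
pose F (x y : R) := g (polar (s + x) y) * (g (polar (s - x) y))^*.
have dF x y : 0 <= x <= h -> exists m, CRd F x y m.
  move=> /andP[x0 xh].
  have [|m1 d1] := cdiff_on_polar dg shr y (x := s + x); first by rewrite lerD2l.
  have [|m2 d2] := cdiff_on_polar dg shr y (x := s - x); first by lra.
  eexists; apply: CRd_mul; first by apply: (CRd_shift d1).
  exact: (CRd_reflect d2).
have pF x : F x (2 * pi) = F x 0 by rewrite /F -{1 2}[2 * pi]add0r !polar_2pi.
have := itg_circle h0 dF pF.
rewrite (_ : itg (fun t => complex.Re (F 0 t)) _ _ = circle_mean g s); last first.
  by congr itg; apply/funext => t; rewrite /F addr0 subr0 Re_mul_conj.
move=> ->.
have shr' : expR (s - h) <= r by apply: le_trans shr; rewrite ler_expR; lra.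
have c1 := ctn_circle dg shr; have c2 := ctn_circle dg shr'.
pose G (t : R) := (tau * cabs (g (polar (s + h) t)) ^+ 2 + tau^-1 * cabs (g (polar (s - h) t)) ^+ 2) / 2.
have cG t : {for t, continuous G}.
  by apply: cvgM; [apply: cvgD; (apply: cvgM; [exact: cvg_cst|]); [exact: c1|exact: c2]|exact: cvg_cst].
have cF t : {for t, continuous (fun t => complex.Re (F h t))}.
  by have [|m /CRd_cont2[]] := dF h t; rewrite ?h0 ?lexx.
have -> : tau * circle_mean g (s + h) + tau^-1 * circle_mean g (s - h) = 2 * itg G 0 (2 * pi).
  rewrite /circle_mean /itg /G RintegralZr//; last first.
    apply: (@ctn_integrable _ _ 0 (2 * pi)) => t _.
    by apply: cvgD; (apply: cvgM; [exact: cvg_cst|]); [exact: c1|exact: c2].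
  rewrite [RHS]mulrC divfK// RintegralD//.
  - rewrite !RintegralZl//; first by apply: (@ctn_integrable _ _ 0 (2 * pi)) => t _; exact: c2.
    by apply: (@ctn_integrable _ _ 0 (2 * pi)) => t _; exact: c1.
  - by apply: (@ctn_integrable _ _ 0 (2 * pi)) => t _; apply: cvgM; [exact: cvg_cst|exact: c1].
  - by apply: (@ctn_integrable _ _ 0 (2 * pi)) => t _; apply: cvgM; [exact: cvg_cst|exact: c2].
rewrite ler_pM2l//; apply: le_itg => // t _.
apply: le_trans (Re_le_cabs _) _; rewrite /F cabsM cabs_conj /G.
set a := cabs _; set b := cabs _.
rewrite ler_pdivlMr// -subr_ge0.
have -> : tau * a ^+ 2 + tau^-1 * b ^+ 2 - a * b * 2 = tau^-1 * (tau * a - b) ^+ 2.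
  by field; rewrite gt_eqF.
by rewrite mulr_ge0 ?invr_ge0 ?(ltW tau0)// sqr_ge0.
Qed.

(** The increments of a convex sequence do not decrease, so a positive first increment would force
    linear growth. *)
Lemma convex_bounded_nonincreasing (y : nat -> R) (B : R) (N : nat) :
  (forall n, 2 * y n.+1 <= y n + y n.+2) -> (forall n, (N <= n)%N -> y n <= B) ->
  y 1%N <= y 0%N.
Proof.
move=> cvx bdd; rewrite leNgt; apply/negP => y01.
pose dl := y 1%N - y 0%N; have dl0 : 0 < dl by rewrite subr_gt0.
have inc n : dl <= y n.+1 - y n.
  by elim: n => [//|n IH]; have := cvx n; rewrite /dl in IH *; lra.
have low n : y 0%N + n%:R * dl <= y n.
  elim: n => [|n IH]; first by rewrite mul0r addr0.
  have := inc n; rewrite -natr1 mulrDl mul1r; lra.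
pose k := Num.bound `|(B - y 0%N) / dl|.
have h : (B - y 0%N) / dl < k%:R.
  exact: le_lt_trans (ler_norm _) (archi_boundP (normr_ge0 _)).
have := bdd (maxn N k) (leq_maxl _ _); have := low (maxn N k).
have : k%:R * dl <= (maxn N k)%:R * dl by rewrite ler_pM2r// ler_nat leq_maxr.
rewrite ltr_pdivrMr// in h; lra.
Qed.

(** The zero of order k serves only to keep the sequence M(u - nh) e^(2knh) bounded as n grows.
    Convexity then makes the sequence nonincreasing at its first step, which is the claim. *)
Lemma circle_mean_growth g r (u h C eps : R) (k : nat) : cdiff_on g r -> 0 < h ->
  expR u <= r -> 0 < eps -> (forall w, cabs w <= eps -> cabs (g w) <= C * cabs w ^+ k) ->
  circle_mean g (u - h) <= expR (- (2 * k%:R * h)) * circle_mean g u.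
Proof.
move=> dg h0 ur eps0 gk.
pose q := expR (2 * k%:R * h); have q0 : 0 < q by exact: expR_gt0.
have qV : expR (- (2 * k%:R * h)) = q^-1 by rewrite expRN.
pose y n := circle_mean g (u - n%:R * h) * q ^+ n.
suff : y 1%N <= y 0%N.
  have -> : y 0%N = circle_mean g u by rewrite /y mul0r subr0 expr0 mulr1.
  have -> : y 1%N = circle_mean g (u - h) * q by rewrite /y mul1r expr1.
  move=> H; rewrite qV.
  by rewrite mulrC ler_pdivlMr.
have [u0 Hu0] := small_expR eps0.
pose N := Num.bound ((`|u| + `|u0|) / h).
have HN n : (N <= n)%N -> u - n%:R * h <= u0.
  move=> Nn; have : (`|u| + `|u0|) / h < N%:R by apply: archi_boundP; rewrite divr_ge0 ?addr_ge0 ?(ltW h0).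
  rewrite ltr_pdivrMr// => H1.
  have : N%:R * h <= n%:R * h by rewrite ler_pM2r// ler_nat.
  have := ler_norm u; have := ler_norm (- u0); rewrite normrN; lra.
apply: (@convex_bounded_nonincreasing y (C ^+ 2 * expR (2 * k%:R * u) * (2 * pi)) N) => n.
(* With tau = 1 / q the inequality, multiplied by q^(n+1), is the convexity of [y] at n + 1. *)
- have := @circle_mean_convex g r (u - n.+1%:R * h) h q^-1 dg (ltW h0).
  have e1 : u - n.+1%:R * h + h = u - n%:R * h by rewrite -natr1; ring.
  have e2 : u - n.+1%:R * h - h = u - n.+2%:R * h by rewrite -[n.+2%:R]natr1; ring.
  rewrite e1 e2 invr_gt0 invrK => /(_ _ q0) H.
  have /H {}H : expR (u - n%:R * h) <= r.
    by apply: le_trans ur; rewrite ler_expR gerBl mulr_ge0// ltW.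
  rewrite /y mulrA -(ler_pM2r (exprn_gt0 n.+1 q0)) in H *.
  apply: le_trans H _; rewrite le_eqVlt; apply/orP; left; apply/eqP.
  rewrite !exprS; move: (circle_mean g _) (circle_mean g _) (q ^+ n) => a b z.
  by field; rewrite gt_eqF.
move=> /HN un.
have ge : expR (u - n%:R * h) <= eps by exact: Hu0.
have -> : C ^+ 2 * expR (2 * k%:R * u) * (2 * pi) =
    itg (fun=> (C * expR (u - n%:R * h) ^+ k) ^+ 2) 0 (2 * pi) * q ^+ n.
  have E : C ^+ 2 * expR (2 * k%:R * u) = (C * expR (u - n%:R * h) ^+ k) ^+ 2 * q ^+ n.
    have E1 (v : R) : (expR v ^+ k) ^+ 2 = expR (2 * k%:R * v).
      by rewrite -exprM -expRM_natl natrM [k%:R * _]mulrC.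
    by rewrite exprMn E1 /q -expRM_natl -[RHS]mulrA -expRD; congr (_ * expR _); ring.
  by rewrite E itg_cst ?(ltW pi2_gt0)// subr0 mulrAC.
rewrite ler_pM2r ?exprn_gt0//; apply: le_itg.
- move=> t _; apply: ctn_circle; first exact: dg.
  by apply: le_trans ur; rewrite ler_expR gerBl mulr_ge0// ltW.
- exact: ctn_on_cst.
- move=> t _; have := gk (polar (u - n%:R * h) t); rewrite cabs_polar => /(_ ge) H.
  by apply: lerXn2r => //; rewrite nnegrE ?cabs_ge0// (le_trans _ H)// cabs_ge0.
Qed.

End Hadamard.

(** * Holomorphic functions on normed spaces *)

Section Holomorphic.
Variable R : realType.
Variable V : normedModType (Cplx R).
Implicit Types (f : V -> (Cplx R)^o) (z v w : V).

Definition vnm v : R := complex.Re `|v|.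

Lemma vnmE v : `|v| = (vnm v)%:C%C.
Proof. by rewrite /vnm RRe_real// ger0_real. Qed.
Lemma vnm_ge0 v : 0 <= vnm v.
Proof. by rewrite -ler0c -vnmE normr_ge0. Qed.
Lemma vnm0 : vnm 0 = 0.
Proof. by rewrite /vnm normr0. Qed.
Lemma vnmD v w : vnm (v + w) <= vnm v + vnm w.
Proof. by rewrite -lecR rmorphD /= -!vnmE ler_normD. Qed.
Lemma vnmN v : vnm (- v) = vnm v.
Proof. by rewrite /vnm normrN. Qed.
Lemma vnmZ (c : Cplx R) v : vnm (c *: v) = cabs c * vnm v.
Proof. by rewrite /vnm normrZ normE vnmE ReM /= mulr0 subr0. Qed.
Lemma vnm_eq0 v : vnm v = 0 -> v = 0.
Proof. by move=> h; apply/eqP; rewrite -normr_eq0 vnmE h. Qed.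
Lemma vnm_gt0 v : v != 0 -> 0 < vnm v.
Proof.
move=> v0; rewrite lt_def vnm_ge0 andbT; apply: contra v0 => /eqP/vnm_eq0 ->//.
Qed.

Lemma nbhs_vnm z (A : set V) : nbhs z A <->
  exists2 r : R, 0 < r & forall v, vnm v < r -> A (z + v).
Proof.
split.
  move=> /nbhs_ballP[e /= e0 H]; exists (complex.Re e).
    by move: e0; rewrite ltcE => /andP[_].
  move=> v vr; apply: H; rewrite -ball_normE /= opprD addrA subrr sub0r normrN vnmE.
  by move: e0; rewrite !ltcE /= => /andP[/eqP -> _]; rewrite eqxx.
move=> [r r0 H]; apply/nbhs_ballP; exists (r%:C)%C; first by rewrite /= ltcR.
move=> y; rewrite -ball_normE /= distrC vnmE ltcR => yr.
by rewrite -(subrK z y) addrC; exact: H.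
Qed.

Lemma near_vnm (x : V) (r : R) : 0 < r -> \forall y \near x, vnm (y - x) < r.
Proof. by move=> r0; apply/nbhs_vnm; exists r => // v vr /=; rewrite addrC addKr. Qed.

Lemma cvg_cplx T (F : set_system T) {FF : Filter F} (u : T -> (Cplx R)^o) (l : Cplx R) :
  u @ F --> (l : (Cplx R)^o) <-> forall e : R, 0 < e -> \forall t \near F, cabs (u t - l) <= e.
Proof.
split.
  move=> /cvgrPdist_le H e e0; have := H (e%:C)%C; rewrite ltcR => /(_ e0).
  by apply: filterS => t; rewrite distrC normE lecR.
move=> H; apply/cvgrPdist_le => e e0; have er : e = (complex.Re e)%:C%C.
  by rewrite RRe_real// gtr0_real.
have := H (complex.Re e); rewrite -ltcR -er => /(_ e0).
by apply: filterS => t; rewrite distrC normE er lecR.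
Qed.

Definition feps f z (L : V -> Cplx R) := forall e : R, 0 < e ->
  exists2 dl : R, 0 < dl & forall v, vnm v < dl ->
    cabs (f (z + v) - f z - L v) <= e * vnm v.

Lemma diff_eps f z : differentiable f z -> feps f z ('d f z).
Proof.
move=> df e e0; have /eqaddoP H := diff_locally df.
have := H (e%:C)%C; rewrite ltcR => /(_ e0)/nbhs_vnm[r r0 Hr].
exists r => // v vr; have := Hr v vr; rewrite /= add0r !fctE /=.
by rewrite normE vnmE -rmorphM lecR [v + z]addrC opprD addrA.
Qed.

(** V may have infinite dimension; the bound K supplies the continuity of the differential. *)
Lemma diff_of_eps f z (L : {linear V -> (Cplx R)^o}) (K : R) :
  (forall v, cabs (L v) <= K * vnm v) -> feps f z L -> differentiable f z.
Proof.
move=> LK H.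
have cL : continuous L.
  apply/bounded_linear_continuous/linear_boundedP.
  near=> M => x; rewrite normE vnmE (le_trans (y := (K * vnm x)%:C%C)) ?lecR//.
  rewrite rmorphM ler_wpM2r// ?lecR ?vnm_ge0//.
  by near: M; apply: nbhs_pinfty_ge; apply/complex_realP; exists K.
have E : f \o shift z = cst (f z) + L +o_ 0 id.
  apply/eqaddoP => e e0; have er : e = (complex.Re e)%:C%C.
    by rewrite RRe_real// gtr0_real.
  have [|r r0 Hr] := H (complex.Re e); first by rewrite -ltcR -er.
  apply/nbhs_vnm; exists r => // v vr; rewrite add0r !fctE /=.
  by rewrite er normE vnmE -rmorphM lecR [v + z]addrC opprD addrA; exact: Hr.
apply/diff_locallyP; rewrite (diff_unique cL E); split => //.
Unshelve. all: by end_near. Qed.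

(** The bridge to one variable: functions on V are studied along complex lines. *)
Lemma line_cdiff f z v (l : Cplx R) : differentiable f (z + l *: v) ->
  cdiff (fun l => f (z + l *: v)) l ('d f (z + l *: v) v).
Proof.
move=> /diff_eps H e e0.
have v0 : 0 < 1 + vnm v by rewrite ltr_pwDl// vnm_ge0.
have [dl dl0 Hd] := H (e / (1 + vnm v)) ltac:(by rewrite divr_gt0).
exists (dl / (1 + vnm v)); first by rewrite divr_gt0.
move=> h; rewrite ltr_pdivlMr// => hdl.
have hv : vnm (h *: v) < dl.
  by rewrite vnmZ (le_lt_trans _ hdl)// ler_wpM2l ?cabs_ge0// lerDr.
have := Hd _ hv; rewrite linearZ /= vnmZ scalerDl addrA [_ *: ('d f _ v)]mulrC => /le_trans; apply.
rewrite mulrCA mulrC ler_wpM2r ?cabs_ge0//.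
rewrite mulrAC ler_pdivrMr// ler_wpM2l ?ltW//; lra.
Qed.

Definition hol_ball f z (r : R) := forall w, vnm w < r -> differentiable f (z + w).
Definition bnd_ball f z (r M : R) := forall w, vnm w < r -> cabs (f (z + w)) <= M.

(** On the line l |-> f (z + l v) the ball becomes a disc of radius r / |v|, and the one-variable
    estimate is read off at l = 1. *)
Lemma taylor2_ball f z (r M : R) : 0 < r -> hol_ball f z r -> bnd_ball f z r M ->
  (forall v, cabs ('d f z v) <= 8 * M / r * vnm v) /\
  forall v, vnm v <= r / 4 ->
    cabs (f (z + v) - f z - 'd f z v) <= 64 * M / r ^+ 2 * vnm v ^+ 2.
Proof.
move=> r0 hf bf.
have key v : v != 0 ->  cabs ('d f z v) <= 8 * M / r * vnm v /\
    (vnm v <= r / 4 ->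
    cabs (f (z + v) - f z - 'd f z v) <= 64 * M / r ^+ 2 * vnm v ^+ 2).
  move=> v0; have vn0 := vnm_gt0 v0.
  pose g (l : Cplx R) : Cplx R := f (z + l *: v).
  pose dg (l : Cplx R) : Cplx R := 'd f (z + l *: v) v.
  have lv (l : Cplx R) : cabs l < r / vnm v -> vnm (l *: v) < r.
    by rewrite vnmZ ltr_pdivlMr.
  have [|||H1 H2] := @taylor2 R g dg (r / vnm v) M.
  - by rewrite divr_gt0.
  - by move=> l lr; apply: line_cdiff; apply: hf; exact: lv.
  - by move=> l lr; apply: bf; exact: lv.
  have d0 : dg 0 = 'd f z v by rewrite /dg scale0r addr0.
  have g0 : g 0 = f z by rewrite /g scale0r addr0.
  rewrite d0 invf_div mulrA in H1; split; first by rewrite mulrAC.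
  move=> vr; have := H2 1; rewrite cabs1 d0 g0 /g scale1r expr1n !mulr1 => H3.
  have E : 64 * M / (r / vnm v) ^+ 2 = 64 * M / r ^+ 2 * vnm v ^+ 2.
    by field; rewrite !gt_eqF.
  by rewrite -E; apply: H3; rewrite mulrAC ler_pdivlMr// mul1r.
split=> v; have [->|v0] := eqVneq v 0.
- by rewrite linear0 cabs0 vnm0 mulr0.
- by have [] := key v v0.
- by move=> _; rewrite addr0 linear0 subrr subr0 cabs0 vnm0 expr0n /= mulr0.
- by have [] := key v v0.
Qed.

(** The comparison value c need not be a value of u. This allows derivatives to be compared with a
    difference quotient of the limit function. *)
Lemma cvg_sub_cauchy T (F : set_system T) {FF : ProperFilter F} (u : T -> Cplx R) :
  (forall e : R, 0 < e -> exists c, \forall t \near F, cabs (u t - c) <= e) ->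
  exists l : Cplx R, u @ F --> (l : (Cplx R)^o).
Proof.
move=> H.
have C (p : Cplx R -> R) : (forall x y, `|p x - p y| <= cabs (x - y)) ->
    cvg ((p \o u) @ F).
  move=> pl; apply/cauchy_cvgP/cauchy_exP => e e0.
  have [c Hc] := H (e / 2) ltac:(by rewrite divr_gt0).
  exists (p c); apply: filterS Hc => t tc /=.
  rewrite /ball /= distrC (le_lt_trans (pl _ _))// (le_lt_trans tc)//.
  by rewrite ltr_pdivrMr// ltr_pMr// ltr1n.
have cR : cvg ((fun t => complex.Re (u t)) @ F).
  by apply: (C (@complex.Re R)) => x y; rewrite -ReN -ReD cabs_Re.
have cI : cvg ((fun t => complex.Im (u t)) @ F).
  by apply: (C (@complex.Im R)) => x y; rewrite -ImN -ImD cabs_Im.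
exists (lim ((fun t => complex.Re (u t)) @ F) +i* lim ((fun t => complex.Im (u t)) @ F))%C.
apply/cvg_cplx => e e0; have e20 : 0 < e / 2 by rewrite divr_gt0.
move/cvgrPdist_le : cR => /(_ _ e20) h1; move/cvgrPdist_le : cI => /(_ _ e20) h2.
near=> t; apply: le_trans (cabs_le_ReIm _) _; rewrite [e]splitr ReD ReN ImD ImN /=.
by apply: lerD; rewrite distrC; near: t.
Unshelve. all: by end_near. Qed.

End Holomorphic.

(** * Holomorphy of limits and of derivatives *)

Section Limits.
Variable R : realType.
Variable V : normedModType (Cplx R).
Implicit Types (f : V -> (Cplx R)^o) (z v w : V).

Lemma cabs_limit_le T (F : set_system T) {FF : ProperFilter F} (u : T -> Cplx R) (l : Cplx R) (B : R) :
  u @ F --> (l : (Cplx R)^o) -> (\forall t \near F, cabs (u t) <= B) -> cabs l <= B.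
Proof.
move=> /cvg_cplx ul uB; apply/ler_addgt0Pr => e e0.
have [t [t1 t2]] := filter_ex (filterI (ul _ e0) uB).
rewrite -(subrK (u t) l) addrC (le_trans (cabsD _ _))// lerD//.
by rewrite cabs_sub.
Qed.

Lemma cvg_cplxB T (F : set_system T) {FF : Filter F} (a b : T -> (Cplx R)^o) (l m : Cplx R) :
  a @ F --> (l : (Cplx R)^o) -> b @ F --> (m : (Cplx R)^o) ->
  (fun t => a t - b t) @ F --> (l - m : (Cplx R)^o).
Proof. exact: cvgB. Qed.

(** Pointwise convergence suffices because of the uniform bound M: difference quotients with one
    fixed small step approximate all the derivatives at z equally well, so these converge, and their
    limit inherits linearity and the quadratic remainder. The filter is arbitrary, since both
    sequences and ultrafilters occur below. *)
Lemma limit_holomorphic T (F : set_system T) {FF : ProperFilter F}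
    (u : T -> V -> (Cplx R)^o) f z (r M : R) : 0 < r ->
  (forall i, hol_ball (u i) z r) -> (forall i, bnd_ball (u i) z r M) ->
  (forall w, vnm w < r -> (fun i => u i (z + w)) @ F --> f (z + w)) ->
  differentiable f z.
Proof.
move=> r0 hu bu uf.
pose K1 := 8 * M / r; pose K2 := 64 * M / r ^+ 2.
have M0 : 0 <= M.
  have [i _] := filter_ex (@filterT _ F _).
  by rewrite (le_trans _ (bu i 0 _)) ?cabs_ge0// vnm0.
have K10 : 0 <= K1 by rewrite divr_ge0 ?mulr_ge0// ltW.
have K20 : 0 <= K2 by rewrite divr_ge0 ?sqr_ge0 ?mulr_ge0.
have T1 i v : cabs ('d (u i) z v) <= K1 * vnm v.
  by have [] := taylor2_ball r0 (hu i) (bu i).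
have T2 i v : vnm v <= r / 4 ->
    cabs (u i (z + v) - u i z - 'd (u i) z v) <= K2 * vnm v ^+ 2.
  by have [_] := taylor2_ball r0 (hu i) (bu i); apply.
have r4 : r / 4 < r by rewrite ltr_pdivrMr// ltr_pMr// ltr1n.
have uf0 : (fun i => u i z) @ F --> f z.
  by have := uf 0; rewrite vnm0 addr0; apply.
have /boolp.choice[L HL] : forall v, exists l : Cplx R,
    (fun i => 'd (u i) z v) @ F --> (l : (Cplx R)^o).
  move=> v; apply: cvg_sub_cauchy => e e0.
  have v0 := vnm_ge0 v.
  (* One step t for all i: each difference quotient of [u i] is within e / 2 of the derivative. *)
  have [t t0 [t1 t2]] : exists2 t : R, 0 < t & t * vnm v <= r / 4 /\ K2 * vnm v ^+ 2 * t <= e / 2.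
    have h1 : 0 < 1 + vnm v by lra.
    have Kv : 0 <= K2 * vnm v ^+ 2 by rewrite mulr_ge0// sqr_ge0.
    have h2 : 0 < 1 + K2 * vnm v ^+ 2 by lra.
    exists (Num.min (r / 4 / (1 + vnm v)) (e / 2 / (1 + K2 * vnm v ^+ 2))).
      by rewrite lt_min !divr_gt0.
    split.
      apply: (@le_trans _ _ (r / 4 / (1 + vnm v) * vnm v)).
        by rewrite ler_wpM2r// ge_min lexx.
      by rewrite mulrAC ler_pdivrMr// ler_wpM2l ?divr_ge0 ?(ltW r0)// lerDr.
    apply: (@le_trans _ _ (K2 * vnm v ^+ 2 * (e / 2 / (1 + K2 * vnm v ^+ 2)))).
      by rewrite ler_wpM2l// ge_min lexx orbT.
    rewrite mulrA ler_pdivrMr// [leLHS]mulrC ler_wpM2l ?divr_ge0 ?(ltW e0)//.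
    by rewrite lerDr.
  pose x := t%:C%C *: v.
  have xn : vnm x = t * vnm v by rewrite vnmZ cabs_real gtr0_norm.
  have tC : t%:C%C != 0 :> Cplx R by rewrite (inj_eq (@complexI _) _ 0) gt_eqF.
  exists ((f (z + x) - f z) / t%:C%C).
  have e4 : 0 < e * t / 4 by rewrite divr_gt0// mulr_gt0.
  have /cvg_cplx/(_ _ e4) A1 : (fun i => u i (z + x)) @ F --> f (z + x).
    by apply: uf; rewrite xn (le_lt_trans t1).
  move/cvg_cplx : uf0 => /(_ _ e4) A2.
  near=> i.
  have B1 : cabs (u i (z + x) - f (z + x)) <= e * t / 4 by near: i.
  have B2 : cabs (u i z - f z) <= e * t / 4 by near: i.
  have B3 := T2 i x; rewrite xn in B3; have {}B3 := B3 t1.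
  have tE : t = cabs t%:C%C by rewrite cabs_real gtr0_norm.
  rewrite -(ler_pM2r t0) [X in _ * X <= _]tE -cabsM mulrBl divfK//.
  have -> : 'd (u i) z v * t%:C%C = 'd (u i) z x by rewrite linearZ /= mulrC.
  rewrite (_ : _ - _ = - (u i (z + x) - u i z - 'd (u i) z x) +
     (u i (z + x) - f (z + x)) - (u i z - f z)); last by ring.
  apply: le_trans (cabsB _ _) _; apply: le_trans (lerD (cabsD _ _) (lexx _)) _.
  rewrite cabsN; apply: le_trans (lerD (lerD B3 B1) B2) _.
  have -> : K2 * (t * vnm v) ^+ 2 = K2 * vnm v ^+ 2 * t * t by ring.
  have : K2 * vnm v ^+ 2 * t * t <= e / 2 * t by rewrite ler_pM2r.
  lra.
have linL : linear (L : V -> (Cplx R)^o).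
  move=> a x y; apply: (@cvg_unique _ (@norm_hausdorff _ _) ((fun i => 'd (u i) z (a *: x + y)) @ F)).
    exact: HL.
  rewrite /= (_ : (fun i => _) = fun i => a *: ('d (u i) z x : (Cplx R)^o) + 'd (u i) z y); last first.
    by apply/funext => i; rewrite linearP.
  by apply: cvgD; [apply: cvgZr; exact: HL|exact: HL].
pose L' : {linear V -> (Cplx R)^o} := HB.pack (L : V -> (Cplx R)^o)
  (GRing.isLinear.Build _ _ _ _ _ linL).
apply: (@diff_of_eps _ _ _ _ L' K1).
  by move=> v; apply: cabs_limit_le (HL v) _; apply: nearW => i; exact: T1.
move=> e e0; have K21 : 0 < 1 + K2 by lra.
exists (Num.min (r / 4) (e / (1 + K2))); first by rewrite lt_min !divr_gt0.
move=> v; rewrite lt_min => /andP[v1 v2].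
apply: (@le_trans _ _ (K2 * vnm v ^+ 2)).
  apply: (@cabs_limit_le _ F _ (fun i => u i (z + v) - u i z - 'd (u i) z v)).
    by apply: cvg_cplxB (HL v); apply: cvg_cplxB uf0; apply: uf; exact: lt_trans r4.
  by apply: nearW => i; apply: T2; exact: ltW.
rewrite expr2 mulrA ler_wpM2r ?vnm_ge0//.
apply: (@le_trans _ _ (K2 * (e / (1 + K2)))); first by rewrite ler_wpM2l// ltW.
by rewrite mulrCA ler_piMr ?(ltW e0)// ler_pdivrMr// mul1r lerDr.
Unshelve. all: by end_near. Qed.

Lemma hol_bounded f z : (\forall w \near z, differentiable f w) ->
  exists2 r : R, 0 < r & exists2 M, hol_ball f z r & bnd_ball f z r M.
Proof.
move=> df; have [d2 d20 H2] := (nbhs_vnm _ _).1 df.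
have dz : differentiable f z by rewrite -[z]addr0; apply: H2; rewrite vnm0.
have cf : {for z, continuous f} by exact: differentiable_continuous.
have [r r0 Hr] : exists2 r : R, 0 < r & forall v, vnm v < r -> cabs (f (z + v) - f z) <= 1.
  by apply/(nbhs_vnm z (fun w => cabs (f w - f z) <= 1)); have /cvg_cplx/(_ _ ltr01) := cf.
exists (Num.min r d2); first by rewrite lt_min r0.
exists (1 + cabs (f z)) => w; rewrite lt_min => /andP[w1 w2]; first exact: H2.
by rewrite -(subrK (f z) (f _)) (le_trans (cabsD _ _))// lerD2r Hr.
Qed.

Lemma diff_shift f a w : differentiable f (w + a) -> differentiable (fun x => f (x + a)) w.
Proof.
by move=> df; exact: (@differentiable_comp _ _ _ _ (fun x : V => x + a) f).
Qed.

(** The derivative is a pointwise limit of difference quotients, which are holomorphic and uniformly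
    bounded near z. *)
Lemma derive_holomorphic f z v : (\forall w \near z, differentiable f w) ->
  differentiable ('D_v f) z.
Proof.
move=> /hol_bounded[r r0 [M hf bf]].
have r20 : 0 < r / 2 by rewrite divr_gt0.
have sub w : vnm w < r / 2 -> hol_ball f (z + w) (r / 2) /\ bnd_ball f (z + w) (r / 2) M.
  move=> wr; split=> x xr; rewrite -addrA; [apply: hf|apply: bf];
    by apply: le_lt_trans (vnmD _ _) _; lra.
have M0 : 0 <= M by rewrite (le_trans _ (bf 0 _)) ?cabs_ge0// vnm0.
pose K1 := 8 * M / (r / 2); pose K2 := 64 * M / (r / 2) ^+ 2.
have K20 : 0 <= K2 by rewrite divr_ge0 ?sqr_ge0 ?mulr_ge0.
have K10 : 0 <= K1 by rewrite divr_ge0 ?mulr_ge0// ltW.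
(* All steps [(c / n.+1) *: v] have length at most r / 8, so the translates of f stay inside the
   ball where it is holomorphic. *)
pose c := r / 8 / (1 + vnm v).
have v1 : 0 < 1 + vnm v by rewrite ltr_pwDl// vnm_ge0.
have c0 : 0 < c by rewrite !divr_gt0.
have cn n : 0 < c / n.+1%:R by rewrite divr_gt0.
have hv n : vnm ((c / n.+1%:R)%:C%C *: v) <= r / 8.
  rewrite vnmZ cabs_real gtr0_norm//.
  apply: (@le_trans _ _ (c * vnm v)).
    by rewrite ler_wpM2r ?vnm_ge0// ler_pdivrMr// ler_pMr// ler1n.
  have -> : r / 8 = c * (1 + vnm v) by rewrite /c divfK ?gt_eqF.
  by rewrite ler_wpM2l ?(ltW c0)// lerDr.
have Kv : 0 <= K2 * vnm v ^+ 2 by rewrite mulr_ge0// sqr_ge0.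
pose h n : Cplx R := (c / n.+1%:R)%:C%C.
have h0 n : h n != 0 by rewrite (inj_eq (@complexI _) _ 0) gt_eqF// divr_gt0.
have hn n : cabs (h n) = c / n.+1%:R by rewrite cabs_real gtr0_norm// divr_gt0.
pose q n (w : V) : (Cplx R)^o := (h n)^-1 * (f (w + h n *: v) - f w).
have est w n : vnm w < r / 2 -> cabs (q n (z + w) - 'd f (z + w) v) <= K2 * vnm v ^+ 2 * cabs (h n).
  move=> wr; have [hb bb] := sub w wr; have [_] := taylor2_ball r20 hb bb.
  move=> /(_ (h n *: v)); rewrite -/K2 => H.
  have {}H := H (le_trans (hv n) _); rewrite -(ler_pM2r (cabs_gt0 (h0 n))) -cabsM mulrC.
  rewrite mulrBr /q mulVKf//.
  have -> : h n * 'd f (z + w) v = 'd f (z + w) (h n *: v) by rewrite linearZ.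
  apply: le_trans (H _) _; first by lra.
  by rewrite vnmZ exprMn le_eqVlt; apply/orP; left; apply/eqP; ring.
have d4 : r / 8 < r / 2 by lra.
apply: (@limit_holomorphic _ \oo _ q _ z (r / 8) (K2 * vnm v ^+ 2 * c + K1 * vnm v)).
- by rewrite divr_gt0.
- move=> n w wr; apply: differentiableM; first by [].
  apply: differentiableB; last by apply: hf; lra.
  apply: diff_shift; rewrite -addrA; apply: hf.
  by rewrite (le_lt_trans (vnmD _ _))//; have := hv n; rewrite -/(h n); lra.
- move=> n w wr.
  have wr2 := lt_trans wr d4; have [hb bb] := sub w wr2.
  rewrite -(subrK ('d f (z + w) v) (q _ _)) (le_trans (cabsD _ _))// lerD//.
    apply: le_trans (est w n wr2) _; rewrite ler_wpM2l//.
    by rewrite hn ler_pdivrMr// ler_pMr// ler1n.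
  by have [] := taylor2_ball r20 hb bb.
- move=> w wr; have wr2 := lt_trans wr d4; rewrite deriveE; last by apply: hf; lra.
  apply/cvg_cplx => e e0.
  pose B := K2 * vnm v ^+ 2 * c; have B0 : 0 <= B by rewrite mulr_ge0// ltW.
  exists (Num.bound (B / e)) => // n /= Nn; apply: le_trans (est w n wr2) _.
  rewrite hn mulrA ler_pdivrMr// -/B mulrC -ler_pdivrMr//.
  have : B / e < (Num.bound (B / e))%:R by apply: archi_boundP; rewrite divr_ge0// ltW.
  move=> /ltW/le_trans; apply; rewrite ler_nat; exact: leqW.
Qed.

End Limits.

(** * Taylor coefficients *)

Section TaylorCoefficients.
Variables (R : realType) (d : nat).
Notation V := 'rV[Cplx R]_d.
Implicit Types (f g : V -> (Cplx R)^o) (v w : V).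

Lemma vnm_lt v (e : R) : 0 < e -> (vnm v < e) <-> (forall j, cabs (v 0 j) < e).
Proof.
move=> e0; have B : ball (0 : V) (e%:C)%C v <-> vnm v < e.
  by rewrite -ball_normE /= sub0r normrN vnmE ltcR.
rewrite -B; split => [[_ H] j|H].
  by have := H ord0 j; rewrite -ball_normE /= mxE sub0r normrN normE ltcR.
split; first by rewrite ltcR.
by move=> i j; rewrite -ball_normE /= mxE sub0r normrN normE ltcR ord1.
Qed.

Lemma cabs_coord v j : cabs (v 0 j) <= vnm v.
Proof.
apply/ler_addgt0Pr => e e0; apply: ltW.
have p : 0 < vnm v + e by rewrite ltr_wpDl// vnm_ge0.
by apply: (vnm_lt v p).1; rewrite ltrDl.
Qed.

Lemma vnm_le_coord v (e : R) : 0 <= e -> (forall j, cabs (v 0 j) <= e) -> vnm v <= e.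
Proof.
move=> e0 H; apply/ler_addgt0Pr => x x0; apply/ltW/vnm_lt; first by rewrite ltr_wpDl.
by move=> j; rewrite (le_lt_trans (H j))// ltrDl.
Qed.

Variable zeta : V.

(** The index is a natural number so that the recursion on the number of variables carries no bound;
    for n >= d the vector is 0. *)
Definition basis_vec (n : nat) : V := \row_j ((j == n :> nat)%:R).

(* Sealed, because unifying two unfolded directional derivatives diverges. *)
Fact pderiv_subproof : {D : nat -> (V -> (Cplx R)^o) -> V -> (Cplx R)^o |
  D = fun n f => 'D_(basis_vec n) f}.
Proof. by eexists. Qed.

Definition pderiv := sval pderiv_subproof.

Lemma pderivE n f z : pderiv n f z = 'D_(basis_vec n) f z.
Proof. by rewrite /pderiv; case: pderiv_subproof => _ /= ->. Qed.

Lemma differentiable_pderiv n f z : (\forall w \near z, differentiable f w) ->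
  differentiable (pderiv n f) z.
Proof.
by rewrite /pderiv; case: pderiv_subproof => _ /= ->; exact: derive_holomorphic.
Qed.

(* The values at [zeta] of the partial derivatives of order less than [k] in
   the first [n] variables, taken in a fixed order of the variables. *)
Fixpoint taylor (n : nat) : nat -> (V -> (Cplx R)^o) -> seq (Cplx R) :=
  match n with
  | 0%N => fun k f => if k is 0%N then [::] else [:: f zeta]
  | n'.+1 => fix tk k f :=
      if k is k'.+1 then tk k' (pderiv n' f) ++ taylor n' k f else [::]
  end.

Lemma taylorS n k f : taylor n.+1 k.+1 f =
  taylor n.+1 k (pderiv n f) ++ taylor n k.+1 f.
Proof. by []. Qed.

Lemma taylor0 k f : taylor 0 k f = if k is 0%N then [::] else [:: f zeta].
Proof. by []. Qed.

Lemma taylorn0 n f : taylor n 0 f = [::].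
Proof. by case: n. Qed.

Local Opaque taylor.

(** For k > 0 this is the binomial coefficient of n + k - 1 over n. The recursion is Pascal's rule:
    a monomial either contains the last variable or it does not. *)
Fixpoint taylor_dim (n : nat) : nat -> nat :=
  match n with
  | 0%N => fun k => if k is 0%N then 0%N else 1%N
  | n'.+1 => fix tk k :=
      if k is k'.+1 then (tk k' + taylor_dim n' k)%N else 0%N
  end.

Lemma size_taylor n k f : size (taylor n k f) = taylor_dim n k.
Proof.
elim: n k f => [|n IH] k f; first by rewrite taylor0; case: k.
by elim: k f => [|k IHk] f; rewrite ?taylorn0// taylorS size_cat IHk IH.
Qed.

(** The binomial is k (k + 1) ... (k + n) / (n + 1)!, and the factors of the numerator have mean k +
    n / 2, so the bound is AM-GM with the factorial given up. The induction is along Pascal's rule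
    and uses y^(n+2) + (y + 1)^(n+1) <= (y + 1)^(n+2). *)
Lemma taylor_dim_le n k :
  (taylor_dim n.+1 k)%:R <= (k%:R + n%:R / 2) ^+ n.+1 :> R.
Proof.
elim: n k => [|n IH] k.
  elim: k => [|k IHk]; first by rewrite mul0r addr0 expr1.
  by rewrite [taylor_dim _ _]/= natrD -[k.+1%:R]natr1 mul0r addr0 expr1 lerD2r (le_trans IHk)// mul0r addr0 expr1.
elim: k => [|k IHk]; first by rewrite exprn_ge0// add0r divr_ge0.
rewrite [taylor_dim _ _]/= natrD -/(taylor_dim n.+2) -/(taylor_dim n.+1).
apply: le_trans (lerD IHk (IH k.+1)) _.
set y := k%:R + n.+1%:R / 2.
have y0 : 0 <= y by rewrite addr_ge0// divr_ge0.
have -> : k.+1%:R + n.+1%:R / 2 = y + 1 by rewrite /y -[k.+1%:R]natr1 addrAC.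
have : k.+1%:R + n%:R / 2 <= y + 1 by rewrite /y -[k.+1%:R]natr1 -[n.+1%:R]natr1; lra.
move=> h; have {h} H : (k.+1%:R + n%:R / 2) ^+ n.+1 <= (y + 1) ^+ n.+1.
  by apply: lerXn2r => //; rewrite nnegrE ?addr_ge0// divr_ge0.
apply: le_trans (lerD (lexx _) H) _.
rewrite [leRHS]exprS [leRHS]mulrDl mul1r lerD2r [leLHS]exprS ler_wpM2l//.
by apply: lerXn2r; rewrite ?nnegrE ?addr_ge0// lerDl.
Qed.

Definition near_hol f (z : V) := \forall w \near z, differentiable f w.

Lemma near_hol_derive n f : near_hol f zeta -> near_hol (pderiv n f) zeta.
Proof.
move=> H; have {}H : \forall w \near zeta, \forall x \near w, differentiable f x.
  exact: near_join.
by apply: filterS H => w; exact: differentiable_pderiv.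
Qed.

(** Needed for linearity: a derivative of [a * f + g] splits only near zeta, where both functions
    are differentiable. *)
Lemma taylor_near n k f g : (\forall w \near zeta, f w = g w) -> taylor n k f = taylor n k g.
Proof.
elim: n k f g => [|n IH] k f g fg.
  by rewrite !taylor0; case: k => // k; rewrite (nbhs_singleton fg).
elim: k f g fg => [|k IHk] f g fg; first by rewrite !taylorn0.
 rewrite !taylorS (IH _ _ _ fg).
have H : \forall w \near zeta, \forall x \near w, f x = g x by exact: near_join.
have E : taylor n.+1 k (pderiv n f) = taylor n.+1 k (pderiv n g).
  by apply: IHk; apply: filterS H => w; rewrite !pderivE; exact: near_eq_derive.
by rewrite E.
Qed.

Lemma taylor_linear n k f g (a : Cplx R) i : near_hol f zeta -> near_hol g zeta ->
  (taylor n k (fun x => a * f x + g x : (Cplx R)^o))`_i =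
  a * (taylor n k f)`_i + (taylor n k g)`_i.
Proof.
elim: n k f g i => [|n IH] k f g i hf hg.
  by rewrite !taylor0; case: k => [|k] /=; rewrite ?nth_nil ?mulr0 ?addr0//; case: i => [//|i] /=; rewrite ?nth_nil mulr0 addr0.
elim: k f g i hf hg => [|k IHk] f g i hf hg; first by rewrite !taylorn0 !nth_nil mulr0 addr0.
rewrite !taylorS !nth_cat !size_taylor; case: ifP => _; last exact: IH.
rewrite -(IHk _ _ _ (near_hol_derive _ hf) (near_hol_derive _ hg)).
congr (_`_i).
apply: taylor_near; apply: filterS2 hf hg => w fw gw.
rewrite !pderivE deriveD ?deriveZ//; first by apply: diff_derivable.
by apply: derivableZ; apply: diff_derivable.
by apply: diff_derivable.
Qed.

Definition supported (n : nat) v := forall j : 'I_d, (n <= j)%N -> v 0 j = 0.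

(** Induction along the recursion of [taylor], without a Taylor expansion. By the case k the n-th
    partial derivative is O(|v|^k) in n + 1 variables; integrating along the n-th coordinate gains
    one power, and at the starting point, where that coordinate is 0, the case of n variables
    applies. *)
Lemma taylor_vanish n k f : near_hol f zeta -> (forall i, (taylor n k f)`_i = 0) ->
  exists2 C, 0 <= C & exists2 r : R, 0 < r & forall v, supported n v -> vnm v < r ->
    cabs (f (zeta + v)) <= C * vnm v ^+ k.
Proof.
elim: n k f => [|n IH] k f hf.
  move=> T0; exists (cabs (f zeta)); first exact: cabs_ge0.
  exists 1 => // v sv _.
  have -> : v = 0 by apply/rowP => j; rewrite sv// mxE.
  rewrite addr0 vnm0; case: k T0 => [_|k T0]; first by rewrite expr0 mulr1.
  by have := T0 0%N; rewrite taylor0 /= => ->; rewrite expr0n mulr0 cabs0.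
elim: k f hf => [|k IHk] f hf T0.
  have [r r0 [M _ bf]] := hol_bounded hf.
  exists M; first by rewrite (le_trans _ (bf 0 _)) ?cabs_ge0// vnm0.
  by exists r => // v _ vr; rewrite expr0 mulr1 bf.
have [r0 r00 hr0] := (nbhs_vnm _ _).1 hf.
have [C1 C10 [r1 r10 H1]] : exists2 C, 0 <= C & exists2 r : R, 0 < r & forall v, supported n.+1 v ->
    vnm v < r -> cabs (pderiv n f (zeta + v)) <= C * vnm v ^+ k.
  apply: IHk; first exact: near_hol_derive.
  move=> i; have := T0 i; rewrite taylorS nth_cat.
  case: ltnP => // h _; exact: nth_default.
have [C2 C20 [r2 r20 H2]] : exists2 C, 0 <= C & exists2 r : R, 0 < r & forall v, supported n v ->
    vnm v < r -> cabs (f (zeta + v)) <= C * vnm v ^+ k.+1.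
  apply: IH => // i; have := T0 (size (taylor n.+1 k (pderiv n f)) + i)%N.
  by rewrite taylorS nth_cat ltnNge leq_addr /= addKn.
exists (C1 + C2); first by rewrite addr_ge0.
exists (Num.min r0 (Num.min r1 r2)); first by rewrite !lt_min r00 r10 r20.
move=> v sv; rewrite !lt_min => /andP[v0 /andP[v1 v2]].
(* For n >= d there is no further variable, and the bound for n variables is already enough. *)
have [dn|nd] := ltnP n d; last first.
  have sn : supported n v by move=> j nj; have := ltn_ord j; rewrite ltnNge (leq_trans nd nj).
  by rewrite (le_trans (H2 v sn v2))// ler_wpM2r ?exprn_ge0 ?vnm_ge0// lerDr.
(* [v'] is v with its n-th coordinate set to 0. As the norm is the maximum of the coordinates, no
   point of the segment from [v'] to v is longer than v. *)
pose t := v 0 (Ordinal dn); pose v' := v - t *: basis_vec n.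
have co (s : Cplx R) j : (v' + s *: basis_vec n) 0 j = if j == n :> nat then s else v 0 j.
  rewrite !mxE; case: eqP => [jn|_]; last by rewrite !mulr0 subr0 addr0.
  by rewrite !mulr1 (_ : j = Ordinal dn) ?subrr ?add0r//; exact: val_inj.
have nv (s : Cplx R) : cabs s <= cabs t -> vnm (v' + s *: basis_vec n) <= vnm v.
  move=> st; apply: vnm_le_coord; first exact: vnm_ge0.
  move=> j; rewrite co; case: eqP => _; last exact: cabs_coord.
  by rewrite (le_trans st)// cabs_coord.
have sv1 (s : Cplx R) : supported n.+1 (v' + s *: basis_vec n).
  by move=> j nj; rewrite co gtn_eqF// sv.
have v'E : v' = v' + 0 *: basis_vec n by rewrite scale0r addr0.
have vE : v = v' + t *: basis_vec n by rewrite subrK.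
have sv' : supported n v'.
  move=> j nj; rewrite v'E co; case: eqP => // /eqP jn; apply: sv.
  by rewrite ltn_neqAle eq_sym jn.
have nv' : vnm v' <= vnm v by rewrite v'E nv// cabs0 cabs_ge0.
have A1 : cabs (f (zeta + v')) <= C2 * vnm v' ^+ k.+1 by apply: H2 => //; exact: le_lt_trans v2.
have A2 : cabs (f (zeta + v) - f (zeta + v')) <= C1 * vnm v ^+ k * cabs t.
  have := @lipschitz_bound R (fun l => f (zeta + v' + l *: basis_vec n)) 0 t (C1 * vnm v ^+ k).
  rewrite add0r scale0r addr0 -addrA -vE; apply => s /andP[s0 s1]; rewrite add0r.
  have st : cabs (s%:C%C * t) <= cabs t.
    by rewrite cabsM cabs_real ger0_norm// ler_piMl// cabs_ge0.
  have := nv _ st; set w := v' + _ => wv.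
  have dw : differentiable f (zeta + v' + (s%:C%C * t) *: basis_vec n).
    by rewrite -addrA; apply: hr0; exact: le_lt_trans v0.
  exists ('d f (zeta + v' + (s%:C%C * t) *: basis_vec n) (basis_vec n)); first exact: line_cdiff.
  rewrite -deriveE// -pderivE -addrA.
  apply: le_trans (H1 w (sv1 _) (le_lt_trans wv v1)) _.
  by rewrite ler_wpM2l// lerXn2r ?nnegrE ?vnm_ge0.
rewrite -(subrK (f (zeta + v')) (f _)) (le_trans (cabsD _ _))// mulrDl lerD//.
  by rewrite (le_trans A2)// exprSr mulrA ler_wpM2l ?mulr_ge0 ?exprn_ge0 ?vnm_ge0// cabs_coord.
apply: le_trans A1 _.
by rewrite ler_wpM2l// lerXn2r ?nnegrE ?vnm_ge0.
Qed.

End TaylorCoefficients.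

(** * Volume under affine maps *)

Section ScalingMaps.
Context {R : realType}.

(** For an affine bijection k is the reciprocal of the Jacobian. Preimages make composition and the
    change of variables in integrals immediate. *)
Definition scales d (T : measurableType d) (mu : set T -> \bar R) (f : T -> T) (k : R) :=
  measurable_fun setT f /\
  forall E, measurable E -> mu (f @^-1` E) = (k%:E * mu E)%E.

Lemma scales_comp d (T : measurableType d) (mu : set T -> \bar R) f g k l :
  scales mu f k -> scales mu g l -> scales mu (f \o g) (k * l).
Proof.
move=> [mf f_] [mg g_]; split; first exact: measurableT_comp.
move=> E mE; rewrite comp_preimage g_.
  by rewrite f_// muleA -EFinM [l * k]mulrC.
by rewrite -[X in measurable X]setTI; exact: mf.
Qed.

Lemma scales_integral d (T : measurableType d) (mu : {measure set T -> \bar R}) f (k : R)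
    (h : T -> \bar R) : 0 <= k -> scales mu f k -> measurable_fun [set: T] h ->
  (forall x, 0 <= h x)%E -> (\int[mu]_x h (f x) = k%:E * \int[mu]_x h x)%E.
Proof.
move=> k0 [mf f_] mh h0.
rewrite -(ge0_integral_mscale mu measurableT (NngNum k0))//.
have -> : (\int[mu]_x h (f x) = \int[mu]_x (h \o f) x)%E by [].
rewrite -[setT in LHS](preimage_setT f) -(ge0_integral_pushforward mf)//.
apply: eq_measure_integral => A mA _; exact: f_.
Qed.

(** Tonelli's theorem for triangular maps: each fibre map may depend on the base point, as in a
    shear, provided its factor does not. *)
Lemma scales_skew d1 d2 (T1 : measurableType d1) (T2 : measurableType d2)
   (mu : {sigma_finite_measure set T1 -> \bar R}) (nu : {sigma_finite_measure set T2 -> \bar R})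
   (f : T1 -> T1) (g : T1 -> T2 -> T2) (k l : R) : 0 <= k -> 0 <= l ->
  scales mu f k -> (forall x, scales nu (g x) l) ->
  measurable_fun setT (fun p : T1 * T2 => (f p.1, g p.1 p.2)) ->
  scales (prod_sf mu nu) (fun p => (f p.1, g p.1 p.2)) (k * l).
Proof.
move=> k0 l0 fk gl mS; split => // E mE.
rewrite /prod_sf /product_measure1 /=.
have -> : (fun x => nu (xsection ((fun p => (f p.1, g p.1 p.2)) @^-1` E) x)) =
    (fun x => l%:E * nu (xsection E (f x)))%E.
  apply/funext => x; have [mg <-//] := gl x; last exact: measurable_xsection.
rewrite ge0_integralZl_EFin//; last first.
  apply: (@measurableT_comp _ _ _ _ _ _ (nu \o xsection E)); last by case: fk.
  exact: measurable_fun_xsection.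
rewrite (scales_integral k0 fk (h := nu \o xsection E))//; last exact: measurable_fun_xsection.
by rewrite muleA -EFinM mulrC.
Qed.

Lemma scales_swap d (T : measurableType d) (mu : {sigma_finite_measure set T -> \bar R}) :
  scales (prod_sf mu mu) (fun p : T * T => (p.2, p.1)) 1.
Proof.
have ms : measurable_fun [set: T * T] (fun p : T * T => (p.2, p.1)).
  exact: measurable_fun_pair.
split => // E mE; rewrite mul1e.
pose m' := measure_function_pushforward__canonical__measure_function_Measure
  (prod_sf mu mu) ms.
rewrite -[LHS]/(m' E); apply/esym.
apply: (@product_measure_unique _ _ _ _ _ mu mu m') => // A B mA mB.
rewrite -[LHS]/(prod_sf mu mu ((fun p : T * T => (p.2, p.1)) @^-1` (A `*` B))).
rewrite (_ : _ @^-1` _ = B `*` A).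
  by rewrite /prod_sf product_measure1E// muleC.
by apply/seteqP; split => -[x y] [].
Qed.

Lemma lebesgue_affine (a b : R) : a != 0 ->
  scales (@lebesgue_measure R) (fun x : R => a * x + b) `|a|^-1.
Proof.
move=> a0.
have mf : measurable_fun setT (fun x : measurableTypeR R => a * x + b : measurableTypeR R).
  by apply: measurable_funD => //; apply: measurable_funM.
split => // E mE.
have an0 : 0 < `|a| by rewrite normr_gt0.
pose m' := mscale (NngNum (ltW an0)) (measure_function_pushforward__canonical__measure_function_Measure
  (@lebesgue_measure R) mf).
suff -> : lebesgue_measure E = m' E.
  by rewrite /m' /mscale /= muleA -EFinM mulVf ?gt_eqF// mul1e.
apply: (@lebesgue_measure_unique R m') => // _ [[x y] /= xy <-].
rewrite /m' /mscale /= /pushforward.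
have [a_gt0|a_lt0|a00] := ltrgt0P a; last by rewrite a00 eqxx in a0.
- have -> : (fun t : R => a * t + b) @^-1` `]x, y]%classic = `](x - b) / a, (y - b) / a]%classic.
    apply/seteqP; split => t /=; rewrite !in_itv /= ltr_pdivrMr// ler_pdivlMr// [t * a]mulrC;
    by rewrite ltrBlDr lerBrDr.
  rewrite !lebesgue_measure_itv /= !lte_fin ltr_pM2r ?invr_gt0// ltrD2r.
  case: ifPn => xy'; last by rewrite mule0.
  by rewrite -!EFinB -EFinM; congr EFin; field; rewrite gt_eqF.
- have -> : (fun t : R => a * t + b) @^-1` `]x, y]%classic = `[(y - b) / a, (x - b) / a[%classic.
    apply/seteqP; split => t /=; rewrite !in_itv /= ler_ndivrMr// ltr_ndivlMr// [t * a]mulrC;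
    by rewrite ltrBlDr lerBrDr andbC.
  rewrite !lebesgue_measure_itv /= !lte_fin ltr_nM2r ?invr_lt0// ltrD2r.
  case: ifPn => xy'; last by rewrite mule0.
  by rewrite -!EFinB -EFinM; congr EFin; field; rewrite lt_eqF.
Qed.

Notation lam2 := (prod_sf (@lebesgue_measure R) (@lebesgue_measure R)).

(* If [a != 0], multiplication by [a + ib] is a product of two maps each of
   which changes one coordinate affinely; otherwise it is the coordinate swap
   followed by a diagonal map. *)
Lemma lebesgue2_affine (a b p q : R) : a ^+ 2 + b ^+ 2 != 0 ->
  scales lam2 (fun z : R * R => (a * z.1 - b * z.2 + p, b * z.1 + a * z.2 + q))
    (a ^+ 2 + b ^+ 2)^-1.
Proof.
move=> ab0.
have mlin (u v w : R) : measurable_fun [set: (measurableTypeR R * measurableTypeR R)%type]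
    (fun z : measurableTypeR R * measurableTypeR R => u * z.1 + v * z.2 + w : measurableTypeR R).
  by apply: measurable_funD => //; apply: measurable_funD; apply: measurable_funM => //.
have skew (u v w u' w' : R) : u' != 0 -> v != 0 ->
    scales lam2 (fun z : R * R => (u' * z.1 + w', u * z.1 + v * z.2 + w)) (`|u'|^-1 * `|v|^-1).
  move=> u'0 v0.
  apply: (@scales_skew _ _ _ _ (@lebesgue_measure R) (@lebesgue_measure R)
    (fun x => u' * x + w') (fun x y => u * x + v * y + w)); rewrite ?invr_ge0//.
  - exact: lebesgue_affine.
  - move=> x; have [mm h] := @lebesgue_affine v (u * x + w) v0; split.
      by rewrite (_ : (fun y => _) = (fun y => v * y + (u * x + w))) //; apply/funext => y; ring.
    by move=> E /h <-; congr (lebesgue_measure _); apply/funext => y /=; congr (E _); ring.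
  - apply: measurable_fun_pair; last exact: mlin.
    rewrite (_ : (fun z => _) = (fun z : measurableTypeR R * measurableTypeR R => u' * z.1 + 0 * z.2 + w')); first exact: mlin.
    by apply/funext => z; rewrite mul0r addr0.
have sw := scales_swap (@lebesgue_measure R).
have [a0|a0] := eqVneq a 0.
  have b0 : b != 0 by apply: contra ab0 => /eqP ->; rewrite a0 expr0n addr0.
  have := scales_comp (@skew 0 b q (- b) p ltac:(by rewrite oppr_eq0) b0) sw.
  rewrite normrN mulr1 -invfM -expr2 real_normK ?num_real// a0 expr0n /= add0r.
  rewrite (_ : _ \o _ = (fun z : R * R => (0 * z.1 - b * z.2 + p, b * z.1 + 0 * z.2 + q)))//.
  by apply/funext => -[x y] /=; congr pair; ring.
have s1 := scales_comp sw (scales_comp (@skew (- b) a p 1 0 (oner_neq0 _) a0) sw).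
(* In terms of x' = a x - b y + p, the second coordinate b x + a y + q is (b / a) x' + ((a^2 + b^2)
   / a) y + q - (b / a) p. *)
have s2 := @skew (b / a) ((a ^+ 2 + b ^+ 2) / a) (q - b / a * p) 1 0 (oner_neq0 _) ltac:(by rewrite mulf_neq0 ?invr_eq0).
have := scales_comp s2 s1.
have -> : `|1|^-1 / `|(a ^+ 2 + b ^+ 2) / a| * (1 * (`|1|^-1 / `|a| * 1)) = (a ^+ 2 + b ^+ 2)^-1.
  rewrite normrM normfV [`|_ + _|]ger0_norm ?addr_ge0 ?sqr_ge0// normr1.
  by field; rewrite ab0 normr_eq0.
rewrite (_ : _ \o _ = (fun z : R * R => (a * z.1 - b * z.2 + p, b * z.1 + a * z.2 + q)))//.
by apply/funext => -[x y] /=; congr pair; field.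
Qed.

Section Power.
Context d (T : measurableType d) (mu : {sigma_finite_measure set T -> \bar R}).

(** The maps are indexed by natural numbers so that induction on n can shift the family. They may
    differ, as the translations in the coordinates do. *)
Definition tmap (f : nat -> T -> T) n (t : n.-tuple T) : n.-tuple T :=
  [tuple f i (tnth t i) | i < n].

Lemma scales_power (f : nat -> T -> T) (k : R) n : 0 <= k -> (forall i, scales mu (f i) k) ->
  scales (power_measure mu n) (@tmap f n) (k ^+ n).
Proof.
move=> k0; elim: n f => [|n IH] f fk.
  have -> : @tmap f 0 = id by apply/funext => t; apply: eq_from_tnth => -[].
  by split=> // E mE; rewrite expr0 mul1e.
have ms : forall i, measurable_fun setT (f i) by move=> i; case: (fk i).
split.
  apply/measurable_fun_tnthP => i.
  rewrite (_ : _ \o _ = (fun t => f i (tnth t i))); last by apply/funext => t /=; rewrite tnth_mktuple.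
  by apply: measurableT_comp => //; exact: measurable_tnth.
move=> E mE.
have [_ sk] := @scales_skew _ _ _ _ mu (power_measure mu n) (f 0%N) (fun _ => @tmap (fun i => f i.+1) n)
  k (k ^+ n) k0 (exprn_ge0 _ k0) (fk 0%N) (fun _ => IH _ (fun i => fk i.+1))
  ltac:(apply: measurable_fun_pair => //; apply: measurableT_comp => //; case: (IH _ (fun i => fk i.+1)) => //).
have mcE : measurable (@consT _ _ n @^-1` E).
  by rewrite -[X in measurable X]setTI; exact: measurable_consT.
rewrite exprS; have := sk _ mcE; rewrite -[RHS]/(_ * power_measure mu n.+1 E)%E => <-.
rewrite -[LHS]/(prod_sf mu (power_measure mu n) (@consT _ _ n @^-1` (@tmap f n.+1 @^-1` E))).
have e1 : @tmap f n.+1 \o @consT _ _ n =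
    @consT _ _ n \o (fun p => (f 0%N p.1, tmap (fun i => f i.+1) p.2)).
  apply/funext => -[x t]; apply: eq_from_tnth => i; rewrite /= tnth_mktuple.
  by case: (unliftP ord0 i) => [j ->|->]; rewrite ?tnthS ?tnth0 ?tnth_mktuple.
apply: (f_equal (prod_sf mu (power_measure mu n))).
exact: (f_equal (fun g => g @^-1` E) e1).
Qed.

End Power.

End ScalingMaps.

(** * Borel sets and affine maps of C^d *)

Section VolumeCd.
Variables (R : realType) (d : nat).
Notation V := 'rV[Cplx R]_d.

Lemma measurable_to_Cd d' (T : measurableType d') (g : T -> CdM R d) :
  (forall j, measurable_fun setT (fun x => complex.Re ((g x : V) 0 j))) ->
  (forall j, measurable_fun setT (fun x => complex.Im ((g x : V) 0 j))) ->
  measurable_fun setT g.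
Proof.
move=> mRe mIm _ _ [B mB <-]; rewrite setTI -comp_preimage.
suff : measurable_fun setT (@coords R d \o g) by move=> /(_ measurableT _ mB).
apply/measurable_fun_tnthP => j.
rewrite (_ : _ \o _ = fun x => (complex.Re ((g x : V) 0 j), complex.Im ((g x : V) 0 j))).
  exact: measurable_fun_pair.
by apply/funext => x /=; rewrite tnth_mktuple.
Qed.

Lemma measurable_coords : measurable_fun [set: CdM R d] (@coords R d).
Proof. by move=> _ B mB; exists B. Qed.

Lemma measurable_coord j :
  measurable_fun [set: CdM R d] (fun z => complex.Re ((z : V) 0 j)) /\
  measurable_fun [set: CdM R d] (fun z => complex.Im ((z : V) 0 j)).
Proof.
have H : measurable_fun [set: CdM R d]
    (fun z => (complex.Re ((z : V) 0 j) : measurableTypeR R, complex.Im ((z : V) 0 j) : measurableTypeR R)).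
  rewrite (_ : (fun z => _) = (fun t => tnth t j) \o @coords R d).
    by apply: measurableT_comp; [exact: measurable_tnth|exact: measurable_coords].
  by apply/funext => z /=; rewrite tnth_mktuple.
split; first exact: (measurableT_comp measurable_fst H).
exact: (measurableT_comp measurable_snd H).
Qed.

Lemma coord_ball (x z : V) (e : R) : 0 < e ->
  (forall j, `|complex.Re (z 0 j) - complex.Re (x 0 j)| < e /\
             `|complex.Im (z 0 j) - complex.Im (x 0 j)| < e) -> vnm (z - x) < 2 * e.
Proof.
move=> e0 H; apply/vnm_lt; first by rewrite mulr_gt0.
move=> j; have [h1 h2] := H j; apply: le_lt_trans (cabs_le_ReIm _) _.
by rewrite !mxE ReD ImD ReN ImN mulr2n mulrDl mul1r ltrD.
Qed.

(** The sigma-algebra of [CdM] comes from the coordinates and not from the topology. An open set is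
    the union of the countably many boxes with rational centre and half-width 1 / (n + 1) that it
    contains. *)
Lemma open_measurable_Cd (A : set V) : open A -> measurable (A : set (CdM R d)).
Proof.
move=> oA.
pose I := ({ffun 'I_d -> rat * rat} * nat)%type.
pose e (i : I) : R := i.2.+1%:R^-1.
have e0 i : 0 < e i by rewrite invr_gt0.
pose B (i : I) : set (CdM R d) := [set z | forall j,
  `|complex.Re ((z : V) 0 j) - ratr (i.1 j).1| < e i /\
  `|complex.Im ((z : V) 0 j) - ratr (i.1 j).2| < e i].
pose F (i : I) : set (CdM R d) := if pselect (B i `<=` A) then B i else set0.
have -> : A = \bigcup_i F i.
  apply/seteqP; split; last by move=> z [i _]; rewrite /F; case: pselect => // BA /BA.
  move=> z Az; have [r r0 Hr] := (nbhs_vnm z A).1 (open_nbhs_nbhs (conj oA Az)).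
  (* Two points of one box are at distance less than 4 / (n + 1): a box bounds real and imaginary
     parts separately, and the path goes through the centre. *)
  have [n nr] : exists n : nat, (n.+1%:R^-1 : R) < r / 4.
    exists (Num.bound (4 / r)); rewrite invf_plt ?posrE ?divr_gt0// invf_div.
    have : 4 / r < (Num.bound (4 / r))%:R by apply: archi_boundP; rewrite divr_ge0// ltW.
    by move=> /lt_trans; apply; rewrite ltr_nat.
  have Q (x : R) : exists q : rat, `|x - ratr q| < n.+1%:R^-1.
    have [|q] := @rat_in_itvoo R (x - n.+1%:R^-1) (x + n.+1%:R^-1).
      by rewrite ltrBlDr -addrA ltrDl addr_gt0 ?invr_gt0.
    rewrite in_itv /= => /andP[q1 q2]; exists q; by rewrite distrC ltr_distl q1 q2.
  have /boolp.choice[q Hq] : forall j : 'I_d, exists q : rat * rat,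
      `|complex.Re (z 0 j) - ratr q.1| < n.+1%:R^-1 /\ `|complex.Im (z 0 j) - ratr q.2| < n.+1%:R^-1.
    move=> j; have [a Ha] := Q (complex.Re (z 0 j)); have [b Hb] := Q (complex.Im (z 0 j)).
    by exists (a, b).
  exists ([ffun j => q j], n) => //; rewrite /F; case: pselect => /= [_ j|nB].
    by rewrite ffunE.
  exfalso; apply: nB.
  move=> w Bw; rewrite -(subrK z w) addrC; apply: Hr.
  have -> : (w : V) - z = (w - \row_j (ratr (q j).1 +i* ratr (q j).2)%C) -
      (z - \row_j (ratr (q j).1 +i* ratr (q j).2)%C) by rewrite opprB addrA subrK.
  apply: le_lt_trans (vnmD _ _) _; rewrite vnmN.
  have n0 : 0 < n.+1%:R^-1 :> R by rewrite invr_gt0.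
  have H1 : vnm ((w : V) - \row_j (ratr (q j).1 +i* ratr (q j).2)%C) < 2 * n.+1%:R^-1.
    by apply: coord_ball => // j; rewrite !mxE /=; have := Bw j; rewrite /= ffunE.
  have H2 : vnm (z - \row_j (ratr (q j).1 +i* ratr (q j).2)%C) < 2 * n.+1%:R^-1.
    by apply: coord_ball => // j; rewrite !mxE /=; exact: Hq.
  apply: lt_trans (ltrD H1 H2) _; rewrite -mulrDl; rewrite ltr_pdivlMr// in nr.
  by rewrite mulrC (_ : 2 + 2 = 4) //; ring.
apply: countable_bigcupT_measurable => [|i]; first exact: countableP.
rewrite /F; case: pselect => h /=; last exact: measurable0.
clear h.
have -> : B i = \bigcap_(j in [set: 'I_d]) [set z : CdM R d |
  `|complex.Re ((z : V) 0 j) - ratr (i.1 j).1| < e i /\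
  `|complex.Im ((z : V) 0 j) - ratr (i.1 j).2| < e i].
  by apply/seteqP; split => z Bz j; [move=> _; exact: Bz|exact: Bz].
apply: (@fin_bigcap_measurable _ (CdM R d)) => [|j _]; first exact: finite_finset.
have [m1 m2] := measurable_coord j.
have -> : [set z : CdM R d | `|complex.Re ((z : V) 0 j) - ratr (i.1 j).1| < e i /\
  `|complex.Im ((z : V) 0 j) - ratr (i.1 j).2| < e i] =
  ([set: CdM R d] `&` (fun z => complex.Re ((z : V) 0 j)) @^-1`
     `]ratr (i.1 j).1 - e i, ratr (i.1 j).1 + e i[%classic) `&`
  ([set: CdM R d] `&` (fun z => complex.Im ((z : V) 0 j)) @^-1`
     `]ratr (i.1 j).2 - e i, ratr (i.1 j).2 + e i[%classic).
  rewrite !setTI; apply/seteqP; split => z /=; rewrite !in_itv /= -!ltr_distl.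
    by move=> [-> ->].
  by move=> [-> ->].
by apply: measurableI; [apply: m1|apply: m2].
Qed.

Lemma continuous_measurable_Cd (A : set V) (f : V -> R) : open A ->
  (forall z, A z -> {for z, continuous f}) -> measurable_fun (A : set (CdM R d)) (f : CdM R d -> R).
Proof.
move=> oA cf; apply: (measurability _ (RGenOInfty.measurableE R)).
move=> _ [_ [x ->] <-]; apply: open_measurable_Cd.
rewrite openE => z [Az fz]; apply: filterI; first exact: open_nbhs_nbhs.
have : nbhs (f z) `]x, +oo[%classic by apply: open_nbhs_nbhs; split => //; exact: interval_open.
exact: cf.
Qed.

Notation lam2 := (prod_sf (@lebesgue_measure R) (@lebesgue_measure R)).

Lemma scales_lebesgue_Cd (c : Cplx R) (b : V) : c != 0 ->
  scales (lebesgue_Cd R d) (fun z : CdM R d => c *: (z : V) + b) ((cabs c ^+ 2)^-1 ^+ d).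
Proof.
move=> c0; have r0 : complex.Re c ^+ 2 + complex.Im c ^+ 2 != 0.
  by rewrite -sqr_cabs expf_neq0// gt_eqF// cabs_gt0.
split.
  by apply: measurable_to_Cd => j; have [mr mi] := measurable_coord j;
    [rewrite (_ : (fun z => _) = fun z => complex.Re c * complex.Re ((z : V) 0 j) - complex.Im c * complex.Im ((z : V) 0 j) + complex.Re (b 0 j))|
     rewrite (_ : (fun z => _) = fun z => complex.Re c * complex.Im ((z : V) 0 j) + complex.Im c * complex.Re ((z : V) 0 j) + complex.Im (b 0 j))];
    try (by apply/funext => z; rewrite !mxE ?ReD ?ImD ?ReM ?ImM);
    apply: measurable_funD => //; [apply: measurable_funB|apply: measurable_funD];
    apply: measurable_funM.
move=> E mE.
(* [tmap] expects a family over all natural numbers, so b is extended by 0. *)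
pose bi (i : nat) : Cplx R := if insub i is Some j then b 0 (j : 'I_d) else 0.
pose f (i : nat) (z : R * R) := (complex.Re c * z.1 - complex.Im c * z.2 + complex.Re (bi i),
  complex.Im c * z.1 + complex.Re c * z.2 + complex.Im (bi i)).
have k0 : 0 <= (cabs c ^+ 2)^-1 by rewrite invr_ge0 sqr_ge0.
have [_ H] := @scales_power R _ _ lam2 f _ d k0
  ltac:(move=> i; rewrite sqr_cabs; exact: lebesgue2_affine).
have mcE : measurable (@of_coords R d @^-1` E).
  by rewrite -[X in measurable X]setTI; exact: measurable_of_coords.
have := H _ mcE; rewrite -[RHS]/(_ * lebesgue_Cd R d E)%E => <-.
rewrite -[LHS]/(power_measure lam2 d (@of_coords R d @^-1` ((fun z : CdM R d => c *: (z : V) + b) @^-1` E))).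
apply: (f_equal (power_measure lam2 d)).
have e1 : (fun z : CdM R d => c *: (z : V) + b) \o @of_coords R d = @of_coords R d \o tmap f (n:=d).
  apply/funext => t; apply/rowP => j; rewrite /= !mxE tnth_mktuple /f /bi valK.
  by apply/eqP; rewrite eq_complex ReD ImD ReM ImM /= [_ * _.2 + _ * _.1]addrC !eqxx.
exact: (f_equal (fun g => g @^-1` E) e1).
Qed.

End VolumeCd.

(** * Volumes of boxes and balls, and the normalising constant *)

Section VolumeBalls.
Variables (R : realType) (d : nat).
Notation V := 'rV[Cplx R]_d.
Notation lam2 := (prod_sf (@lebesgue_measure R) (@lebesgue_measure R)).

Lemma power_measure_box d' (T : measurableType d') (mu : {sigma_finite_measure set T -> \bar R})
    (A : set T) (a : R) n : measurable A -> mu A = a%:E ->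
  measurable [set t : n.-tuple T | forall i, A (tnth t i)] /\
  power_measure mu n [set t | forall i, A (tnth t i)] = (a ^+ n)%:E.
Proof.
move=> mA muA; elim: n => [|n [IHm IH]].
  have -> : [set t : 0.-tuple T | forall i, A (tnth t i)] = setT.
    by apply/seteqP; split => // t _ [].
  by split=> //; rewrite expr0 /= diracT.
split.
  have -> : [set t : n.+1.-tuple T | forall i, A (tnth t i)] =
      \bigcap_(i in [set: 'I_n.+1]) ((fun t => tnth t i) @^-1` A).
    by apply/seteqP; split => t tA i; [move=> _; exact: tA|exact: tA].
  apply: fin_bigcap_measurable => [|i _]; first exact: finite_finset.
  by rewrite -[X in measurable X]setTI; exact: measurable_tnth.
rewrite -[LHS]/(prod_sf mu (power_measure mu n) (@consT _ _ n @^-1` _)).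
have -> : @consT _ _ n @^-1` [set t : n.+1.-tuple T | forall i, A (tnth t i)] =
    A `*` [set t | forall i, A (tnth t i)].
  apply/seteqP; split => -[x t] /=.
    by move=> h; split; [have := h ord0; rewrite tnth0|move=> i; have := h (lift ord0 i); rewrite tnthS].
  by move=> [h1 h2] i; case: (unliftP ord0 i) => [j ->|->]; rewrite ?tnthS ?tnth0.
transitivity (mu A * power_measure mu n [set t | forall i, A (tnth t i)])%E.
  exact: product_measure1E.
by rewrite muA IH -EFinM exprS.
Qed.

Definition box (s : R) : set (CdM R d) := [set z | forall j : 'I_d,
  -s < complex.Re ((z : V) 0 j) < s /\ -s < complex.Im ((z : V) 0 j) < s].

Lemma lebesgue_box (s : R) : 0 < s -> measurable (box s) /\
  lebesgue_Cd R d (box s) = (((2 * s) ^+ 2) ^+ d)%:E.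
Proof.
move=> s0; pose I := `]-s, s[%classic : set (measurableTypeR R).
have mI : lebesgue_measure I = (2 * s)%:E.
  rewrite lebesgue_measure_itv /= lte_fin gtrN// -EFinB opprK; congr EFin; ring.
have mI0 : measurable I by exact: measurable_itv.
have mII : measurable (I `*` I) by exact: measurableX.
have lII : prod_sf (@lebesgue_measure R) (@lebesgue_measure R) (I `*` I) = ((2 * s) ^+ 2)%:E.
  transitivity (lebesgue_measure I * lebesgue_measure I)%E; first exact: product_measure1E.
  by rewrite mI -EFinM expr2.
have [m1 m2] := power_measure_box d mII lII.
have e1 : box s = @coords R d @^-1` [set t | forall i, (I `*` I) (tnth t i)].
  apply/seteqP; split => z H j; have := H j; rewrite ?tnth_mktuple /I /= !in_itv //.
have mB : measurable (box s).
  by rewrite e1 -[X in measurable X]setTI; exact: measurable_coords.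
split => //; rewrite -m2 -[LHS]/(power_measure lam2 d (@of_coords R d @^-1` box s)).
apply: (f_equal (power_measure lam2 d)); rewrite e1 -comp_preimage.
rewrite (_ : _ \o _ = id) ?preimage_id //.
apply/funext => t; apply: eq_from_tnth => j.
by rewrite tnth_mktuple mxE /=; case: (tnth t j).
Qed.

Lemma unit_ballE : @unit_ball R d = [set z | \sum_j cabs ((z : V) 0 j) ^+ 2 < 1].
Proof.
apply/funext => z; rewrite /unit_ball /=; congr (is_true _).
rewrite (eq_bigr (fun j => (cabs ((z : V) 0 j) ^+ 2)%:C%C)).
  by rewrite -rmorph_sum -[1 in LHS](rmorph1 (real_complex R)) ltcR.
by move=> j _; rewrite normE rmorphXn.
Qed.

(** If the mass were 0 or infinite, the normalising factor of [volume] would be the default value 0.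
    The ball is squeezed between two boxes. *)
Lemma unit_ball_mass : exists2 m : R, 0 < m & lebesgue_Cd R d (@unit_ball R d) = m%:E.
Proof.
have mU : measurable (@unit_ball R d).
  rewrite unit_ballE.
  have mf : measurable_fun [set: CdM R d] (fun z => \sum_j cabs ((z : V) 0 j) ^+ 2).
    apply: measurable_sum => j.
    rewrite (_ : (fun z => _) = fun z => complex.Re ((z : V) 0 j) ^+ 2 + complex.Im ((z : V) 0 j) ^+ 2).
      have [h1 h2] := measurable_coord R j.
      by apply: measurable_funD; apply: measurable_funX.
    by apply/funext => z; rewrite sqr_cabs.
  have := mf measurableT _ (measurable_itv `]-oo, 1[).
  by rewrite setTI; congr measurable; apply/seteqP; split => z /=; rewrite in_itv.
have [b1 l1] := lebesgue_box (s := 1) ltr01.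
(* In the small box each modulus is at most 2 s, and d (2 s)^2 < 1 for this s, also when d = 0. *)
pose s : R := (2 * d.+1%:R)^-1.
have s0 : 0 < s by rewrite invr_gt0 mulr_gt0.
have [b2 l2] := lebesgue_box s0.
have up : (lebesgue_Cd R d (@unit_ball R d) <= (((2 * 1) ^+ 2) ^+ d)%:E)%E.
  rewrite -l1; apply: le_measure; rewrite ?inE//.
  rewrite unit_ballE => z /= zs j.
  have : cabs ((z : V) 0 j) ^+ 2 < 1.
    apply: le_lt_trans zs; rewrite (bigD1 j)//= lerDl sumr_ge0// => i _; exact: sqr_ge0.
  rewrite expr_lt1// ?cabs_ge0// => c1.
  have := cabs_Re ((z : V) 0 j); have := cabs_Im ((z : V) 0 j).
  move=> /le_lt_trans/(_ c1); rewrite ltr_norml => h1 /le_lt_trans/(_ c1); rewrite ltr_norml => h2.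
  by split.
have lo : ((((2 * s) ^+ 2) ^+ d)%:E <= lebesgue_Cd R d (@unit_ball R d))%E.
  rewrite -l2; apply: le_measure; rewrite ?inE//.
  rewrite unit_ballE => z /= zs.
  apply: (@le_lt_trans _ _ (\sum_(j < d) (2 * s) ^+ 2)).
    apply: ler_sum => j _; apply: lerXn2r; rewrite ?nnegrE ?cabs_ge0 ?mulr_ge0 ?(ltW s0)//.
    apply: le_trans (cabs_le_ReIm _) _; have [h1 h2] := zs j.
    by rewrite mulr2n mulrDl mul1r; apply: lerD; rewrite ler_norml !ltW//; case/andP: h1; case/andP: h2.
  have -> : 2 * s = d.+1%:R^-1 by rewrite /s invfM mulrA divff ?mul1r.
  rewrite sumr_const card_ord -[_ *+ d]mulr_natl [_ ^+ 2]expr2 mulrA.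
  have h : d%:R / d.+1%:R < 1 :> R by rewrite ltr_pdivrMr// mul1r ltr_nat.
  apply: le_lt_trans h; rewrite ler_piMr ?divr_ge0//.
  by rewrite invf_le1// ler1n.
have p0 : 0 < ((2 * s) ^+ 2) ^+ d by rewrite !exprn_gt0// mulr_gt0.
have fin : lebesgue_Cd R d (@unit_ball R d) \is a fin_num.
  by rewrite ge0_fin_numE// (le_lt_trans up)// ltry.
exists (fine (lebesgue_Cd R d (@unit_ball R d))); last by rewrite fineK.
by rewrite -lte_fin fineK// (lt_le_trans _ lo).
Qed.

(** A copy of [volume] that carries the sigma-finite structure required by Tonelli's theorem. *)
Definition vol : set (CdM R d) -> \bar R := volume R d.
HB.instance Definition _ := Measure.on vol.

Lemma volE : exists2 m : R, 0 < m & forall A, vol A = (m%:E * lebesgue_Cd R d A)%E.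
Proof.
have [m m0 mE] := unit_ball_mass; exists m^-1; first by rewrite invr_gt0.
move=> A; rewrite -[LHS]/((fine (lebesgue_Cd R d (@unit_ball R d)))^-1%:E * lebesgue_Cd R d A)%E.
by rewrite mE.
Qed.

Lemma scales_vol (c : Cplx R) (b : V) : c != 0 ->
  scales vol (fun z : CdM R d => c *: (z : V) + b) ((cabs c ^+ 2)^-1 ^+ d).
Proof.
move=> c0; have [mf H] := scales_lebesgue_Cd b c0; split => // E mE.
by have [m m0 volm] := volE; rewrite !volm H// muleCA.
Qed.

Lemma vol_box (s : R) : 0 < s -> measurable (box s) /\ (0 < vol (box s) < +oo)%E.
Proof.
move=> s0; have [mb lb] := lebesgue_box s0; split => //.
have [m m0 ->] := volE; rewrite lb -EFinM ltry lte_fin andbT.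
by rewrite mulr_gt0// !exprn_gt0// mulr_gt0.
Qed.

Lemma vol_sigma_finite : sigma_finite setT vol.
Proof.
exists (fun n => box n.+1%:R); last first.
  by move=> n; have [//|mb /andP[_]] := @vol_box n.+1%:R.
apply/esym/seteqP; split => // z _.
exists (Num.bound (vnm (z : V))) => // j.
have : vnm (z : V) < (Num.bound (vnm (z : V))).+1%:R.
  by apply: lt_trans (archi_boundP (vnm_ge0 _)) _; rewrite ltr_nat.
move=> h; have cz := le_lt_trans (cabs_coord (z : V) j) h.
by rewrite -!ltr_norml (le_lt_trans (cabs_Re _) cz) (le_lt_trans (cabs_Im _) cz).
Qed.

HB.instance Definition _ := Measure_isSigmaFinite.Build _ _ _ vol vol_sigma_finite.

Definition cball (z : V) (r : R) : set (CdM R d) := [set w | vnm ((w : V) - z) < r].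

Lemma open_cball z r : open (cball z r : set V).
Proof.
rewrite openE => w zw; apply/nbhs_vnm; exists (r - vnm (w - z)); first by rewrite subr_gt0.
move=> v; rewrite ltrBrDl /cball /= => h; apply: le_lt_trans h.
by rewrite addrAC vnmD.
Qed.

Lemma vol_cballE z r : vol (cball z r) = vol (cball 0 r).
Proof.
have [_ H] := scales_vol (- z) (oner_neq0 (Cplx R)).
rewrite cabs1 expr1n invr1 expr1n in H.
have := H _ (open_measurable_Cd (@open_cball 0 r)); rewrite mul1e => <-.
by congr (vol _); apply/seteqP; split => w /=; rewrite /cball /= subr0 scale1r.
Qed.

Lemma vol_cball z r : 0 < r -> (0 < vol (cball z r) < +oo)%E.
Proof.
move=> r0; have mb0 : measurable (cball 0 r) by apply: open_measurable_Cd; exact: open_cball.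
rewrite vol_cballE.
have r4 : 0 < r / 4 by rewrite divr_gt0.
have [m1 /andP[v1 _]] := vol_box r4; have [m2 /andP[_ v2]] := vol_box r0.
apply/andP; split.
  apply: lt_le_trans v1 _; apply: le_measure; rewrite ?inE//.
  move=> w wb; rewrite /cball /= subr0; apply/vnm_lt => // j; have [h1 h2] := wb j.
  rewrite -!ltr_norml in h1 h2; apply: le_lt_trans (cabs_le_ReIm _) _; lra.
apply: le_lt_trans v2; apply: le_measure; rewrite ?inE//.
move=> w; rewrite /cball /= subr0 => wr j; have cw := le_lt_trans (cabs_coord (w : V) j) wr.
by rewrite -!ltr_norml (le_lt_trans (cabs_Re _) cw) (le_lt_trans (cabs_Im _) cw).
Qed.

End VolumeBalls.

(** * Square-integrable functions *)

Section SquareIntegrable.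
Context d' (T : measurableType d') (R : realType) (mu : {measure set T -> \bar R}).
Implicit Types f g : T -> Cplx R.

Definition mcplx f := measurable_fun setT (fun x => complex.Re (f x)) /\
  measurable_fun setT (fun x => complex.Im (f x)).

Definition sqint f : \bar R := \int[mu]_x (cabs (f x) ^+ 2)%:E.

Definition l2 f := mcplx f /\ (sqint f < +oo)%E.

Definition ip f g : Cplx R :=
  ((\int[mu]_x complex.Re (f x * (g x)^* )) +i* (\int[mu]_x complex.Im (f x * (g x)^* )))%C.

Lemma mcplx_sqr f : mcplx f -> measurable_fun setT (fun x => cabs (f x) ^+ 2).
Proof.
move=> [mr mi]; rewrite (_ : (fun x => _) = fun x => complex.Re (f x) ^+ 2 + complex.Im (f x) ^+ 2).
  by apply: measurable_funD; apply: measurable_funX.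
by apply/funext => x; rewrite sqr_cabs.
Qed.

Lemma Re_mulc (z w : Cplx R) : complex.Re (z * w^*) =
  complex.Re z * complex.Re w + complex.Im z * complex.Im w.
Proof. by case: z w => [a b] [c e] /=; ring. Qed.

Lemma Im_mulc (z w : Cplx R) : complex.Im (z * w^*) =
  complex.Im z * complex.Re w - complex.Re z * complex.Im w.
Proof. by case: z w => [a b] [c e] /=; ring. Qed.

Lemma mcplx_mulc f g : mcplx f -> mcplx g -> mcplx (fun x => f x * (g x)^*).
Proof.
move=> [fr fi] [gr gi]; split.
  under [fun x => _]eq_fun do rewrite Re_mulc.
  by apply: measurable_funD; apply: measurable_funM.
under [fun x => _]eq_fun do rewrite Im_mulc.
by apply: measurable_funB; apply: measurable_funM.
Qed.

Lemma mcplx_lin (a : Cplx R) f g : mcplx f -> mcplx g -> mcplx (fun x => a * f x + g x).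
Proof.
move=> [fr fi] [gr gi]; split.
  under [fun x => _]eq_fun do rewrite ReD ReM.
  apply: measurable_funD => //; apply: measurable_funB; apply: measurable_funM => //.
under [fun x => _]eq_fun do rewrite ImD ImM.
by apply: measurable_funD => //; apply: measurable_funD; apply: measurable_funM.
Qed.

Lemma mcplxB f g : mcplx f -> mcplx g -> mcplx (fun x => f x - g x).
Proof.
move=> mf mg; have := mcplx_lin (-1) mg mf; congr mcplx.
by apply/funext => x; rewrite mulN1r addrC.
Qed.

Lemma sqint_ge0 f : (0 <= sqint f)%E.
Proof. by apply: integral_ge0 => x _; rewrite lee_fin sqr_ge0. Qed.

Lemma l2_integrable_sqr f : l2 f -> mu.-integrable setT (fun x => (cabs (f x) ^+ 2)%:E).
Proof.
move=> [mf fi]; apply/integrableP; split; first exact/measurable_EFinP/mcplx_sqr.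
rewrite (eq_integral (fun x => (cabs (f x) ^+ 2)%:E)) // => x _.
by rewrite gee0_abs// lee_fin sqr_ge0.
Qed.

Lemma l2_integrable_mulc f g : l2 f -> l2 g ->
  mu.-integrable setT (EFin \o (fun x => complex.Re (f x * (g x)^*))) /\
  mu.-integrable setT (EFin \o (fun x => complex.Im (f x * (g x)^*))).
Proof.
move=> f2 g2; have [mr mi] := mcplx_mulc f2.1 g2.1.
have iS := integrableD measurableT (l2_integrable_sqr f2) (l2_integrable_sqr g2).
have B x : cabs (f x * (g x)^*) <= cabs (f x) ^+ 2 + cabs (g x) ^+ 2.
  rewrite cabsM cabs_conj; move: (cabs (f x)) (cabs (g x)) => a b; nra.
have S0 x : 0 <= cabs (f x) ^+ 2 + cabs (g x) ^+ 2 by rewrite addr_ge0 ?sqr_ge0.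
split; apply: (le_integrable measurableT _ _ iS).
- exact/measurable_EFinP.
- move=> x _; rewrite lee_fin [leRHS]ger0_norm ?S0//; exact: le_trans (cabs_Re _) (B x).
- exact/measurable_EFinP.
- move=> x _; rewrite lee_fin [leRHS]ger0_norm ?S0//; exact: le_trans (cabs_Im _) (B x).
Qed.

Lemma sqint_lin_le (a : Cplx R) f g : mcplx f -> mcplx g ->
  (sqint (fun x => (a * f x + g x)%R) <=
   (2 * cabs a ^+ 2)%:E * sqint f + 2%:E * sqint g)%E.
Proof.
move=> mf mg.
have mF := mcplx_sqr mf; have mG := mcplx_sqr mg.
have a0 : 0 <= 2 * cabs a ^+ 2 by rewrite mulr_ge0 ?sqr_ge0.
rewrite -!ge0_integralZl_EFin//; try (by move=> x _; rewrite lee_fin sqr_ge0); try exact/measurable_EFinP.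
rewrite -ge0_integralD//; first last.
- by apply/measurable_EFinP; apply: measurable_funM.
- by move=> x _; rewrite lee_fin mulr_ge0 ?sqr_ge0.
- by apply/measurable_EFinP; apply: measurable_funM.
- by move=> x _; rewrite lee_fin mulr_ge0 ?sqr_ge0.
apply: ge0_le_integral => //.
- by move=> x _; rewrite lee_fin sqr_ge0.
- by apply/measurable_EFinP; apply: mcplx_sqr; exact: mcplx_lin.
- by apply/measurable_EFinP; apply: measurable_funD; apply: measurable_funM.
move=> x _; rewrite -EFinM -EFinD lee_fin.
have := cabsD (a * f x) (g x); rewrite cabsM.
have := cabs_ge0 (a * f x + g x); have := cabs_ge0 (g x); have := cabs_ge0 (f x); have := cabs_ge0 a.
move: (cabs (a * f x + g x)) (cabs a) (cabs (f x)) (cabs (g x)) => S A F G A0 F0 G0 S0 SS.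
have : S ^+ 2 <= (A * F + G) ^+ 2 by rewrite lerXn2r ?nnegrE// addr_ge0// mulr_ge0.
have := sqr_ge0 (A * F - G); rewrite !expr2; nra.
Qed.

Lemma l2_lin (a : Cplx R) f g : l2 f -> l2 g -> l2 (fun x => a * f x + g x).
Proof.
move=> [mf fi] [mg gi]; split; first exact: mcplx_lin.
apply: (le_lt_trans (sqint_lin_le a mf mg)).
have K (r : R) h : 0 <= r -> (sqint h < +oo -> r%:E * sqint h < +oo)%E.
  by move=> r0 hi; apply: lte_mul_pinfty; rewrite ?lee_fin.
apply: lte_add_pinfty; apply: K => //.
by rewrite mulr_ge0 ?sqr_ge0.
Qed.

Lemma l2_sub f g : l2 f -> l2 (fun x => f x - g x) -> l2 g.
Proof.
move=> f2 fg2; have := l2_lin (-1) fg2 f2; congr l2.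
by apply/funext => x; rewrite mulN1r opprB subrK.
Qed.

Lemma ip_lin (a : Cplx R) f g h : l2 f -> l2 g -> l2 h ->
  ip (fun x => a * f x + g x) h = a * ip f h + ip g h.
Proof.
move=> f2 g2 h2; have [fr fi] := l2_integrable_mulc f2 h2.
have [gr gi] := l2_integrable_mulc g2 h2.
have K (p q : R) : mu.-integrable setT (EFin \o (fun x =>
    p * complex.Re (f x * (h x)^*) + q * complex.Im (f x * (h x)^*))).
  apply: (@eq_integrable _ _ _ _ _ _ (fun x => p%:E * (complex.Re (f x * (h x)^*))%:E +
    q%:E * (complex.Im (f x * (h x)^*))%:E)%E) => //.
  by apply: integrableD => //; apply: integrableZl.
have Z (p q : R) : \int[mu]_x (p * complex.Re (f x * (h x)^*) + q * complex.Im (f x * (h x)^*)) =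
  p * \int[mu]_x complex.Re (f x * (h x)^*) + q * \int[mu]_x complex.Im (f x * (h x)^*).
  rewrite RintegralD//; [|exact: (integrableZl _ p fr)|exact: (integrableZl _ q fi)].
  by rewrite !RintegralZl.
rewrite /ip; apply/eqP; rewrite eq_complex; apply/andP; split; apply/eqP; rewrite (ReD, ImD) (ReM, ImM) /=.
  rewrite (_ : (fun x => _) = fun x => (complex.Re a * complex.Re (f x * (h x)^*) +
      (- complex.Im a) * complex.Im (f x * (h x)^*)) + complex.Re (g x * (h x)^*)).
    by rewrite RintegralD// Z mulNr.
  by apply/funext => x; rewrite mulrDl ReD -mulrA ReM mulNr.
rewrite (_ : (fun x => _) = fun x => (complex.Im a * complex.Re (f x * (h x)^*) +
    complex.Re a * complex.Im (f x * (h x)^*)) + complex.Im (g x * (h x)^*)).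
  by rewrite RintegralD// Z addrC [X in _ + X]addrC; ring.
by apply/funext => x; rewrite mulrDl ImD -mulrA ImM [X in X + _]addrC.
Qed.

Lemma ip_self f : ip f f = (fine (sqint f))%:C%C.
Proof.
rewrite /ip; apply/eqP; rewrite eq_complex /=; apply/andP; split; apply/eqP.
  by congr fine; apply: eq_integral => x _; rewrite Re_mul_conj.
transitivity (\int[mu]_(x in setT) (fun=> 0 : R) x).
  by apply: eq_Rintegral => x _; rewrite Im_mulc mulrC subrr.
by rewrite Rintegral_cst// mul0r.
Qed.

Lemma ip_conj f g : l2 f -> l2 g -> ip g f = (ip f g)^*.
Proof.
move=> f2 g2; have [fr fi] := l2_integrable_mulc f2 g2.
rewrite /ip; apply/eqP; rewrite eq_complex /=; apply/andP; split; apply/eqP.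
  by apply: eq_Rintegral => x _; rewrite !Re_mulc; ring.
rewrite -[RHS]mulN1r -RintegralZl//.
by apply: eq_Rintegral => x _; rewrite !Im_mulc; ring.
Qed.

End SquareIntegrable.

Section HolomorphicMeasurable.
Variables (R : realType) (d : nat).
Notation V := 'rV[Cplx R]_d.

Lemma mcplx_holomorphic (Omega : set V) (f : V -> (Cplx R)^o) : open Omega -> (forall z, Omega z -> differentiable f z) ->
  (forall z, ~ Omega z -> f z = 0) -> mcplx (f : CdM R d -> Cplx R).
Proof.
move=> oO df f0; have mO := open_measurable_Cd oO.
have K (p : Cplx R -> R) : p 0 = 0 -> (forall x y, `|p x - p y| <= cabs (x - y)) ->
    measurable_fun [set: CdM R d] (fun z : CdM R d => p (f z)).
  move=> p0 pl; rewrite (_ : (fun z : CdM R d => p (f z)) = (fun z : CdM R d => p (f z)) \_ Omega).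
    apply/(measurable_restrictT _ mO); apply: (@continuous_measurable_Cd R d Omega (fun z => p (f z))) => // z.
    move=> /df/differentiable_continuous cf.
    apply/(@cvgrPdist_le _ _ _ (nbhs z) (nbhs_filter z)) => e e0.
    have cf' := (@cvg_cplx _ _ (nbhs z) (nbhs_filter z) _ _).1 cf _ e0.
    by apply: filterS cf' => w; apply: le_trans; rewrite distrC.
  apply/funext => z; rewrite patchE; case: ifPn => // /negP zO.
  by rewrite f0 ?p0// => Oz; apply: zO; rewrite inE.
split; apply: K => // x y; first by rewrite -ReN -ReD cabs_Re.
by rewrite -ImN -ImD cabs_Im.
Qed.

End HolomorphicMeasurable.

(** * Growth of integrals over circled sets *)

Lemma integral_scaled_indic d' (T : measurableType d') (R : realType) (mu : {measure set T -> \bar R})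
    (S : set T) (c : R) : measurable S -> 0 <= c ->
  (\int[mu]_x (c%:E * (\1_S x)%:E) = c%:E * mu S)%E.
Proof.
move=> mS c0; rewrite ge0_integralZl_EFin//.
  by rewrite (integral_indic _ _ mS)// setIT.
by apply/measurable_EFinP; exact: measurable_indic.
Qed.

Lemma le_integral_scaled d' (T : measurableType d') (R : realType) (mu : {measure set T -> \bar R})
    (F G : T -> \bar R) (c : R) :
  measurable_fun setT F -> measurable_fun setT G -> (forall x, 0 <= F x)%E ->
  (forall x, 0 <= G x)%E -> 0 <= c -> (forall x, F x <= c%:E * G x)%E ->
  (\int[mu]_x F x <= c%:E * \int[mu]_x G x)%E.
Proof.
move=> mF mG F0 G0 c0 FG; rewrite -ge0_integralZl_EFin//.
by apply: ge0_le_integral => //; apply: emeasurable_funM => //; exact: measurable_cst.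
Qed.

Lemma lee_indic_scaled (T : Type) (R : realType) (S : set T) (v : T) (a b c : \bar R) :
  (S v -> a <= c * b)%E -> ((\1_S v)%:E * a <= c * ((\1_S v)%:E * b))%E.
Proof.
rewrite indicE; have [/set_mem Sv ab|_ _] := boolP (v \in S).
  by rewrite !mul1e; exact: ab.
by rewrite !mul0e mule0.
Qed.

Lemma le_scaled_measure d' (T : measurableType d') (R : realType) (mu : {measure set T -> \bar R})
    (S : set T) (F : T -> \bar R) (c : R) :
  measurable S -> measurable_fun setT F -> 0 <= c -> (forall x, 0 <= F x)%E ->
  (forall x, S x -> c%:E <= F x)%E -> (c%:E * mu S <= \int[mu]_x F x)%E.
Proof.
move=> mS mF c0 F0 SF.
rewrite -integral_scaled_indic//; apply: ge0_le_integral => //.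
- by move=> x _; rewrite mule_ge0 ?lee_fin.
- by apply: emeasurable_funM => //; apply/measurable_EFinP; exact: measurable_indic.
move=> x _; rewrite indicE; have [/set_mem/SF|_] := boolP (x \in S).
  by rewrite mule1.
by rewrite mule0.
Qed.

Lemma lee_EFin_scaled (R : realType) (x y : \bar R) (a b c : R) :
  x = a%:E -> y = b%:E -> a <= c * b -> (x <= c%:E * y)%E.
Proof. by move=> -> -> abc; rewrite -EFinM lee_fin. Qed.

Section PolarFubini.
Variables (R : realType) (d : nat).
Notation V := 'rV[Cplx R]_d.
Notation leb := (@lebesgue_measure R).
Notation vol := (@vol R d).

Lemma measurable_rotation (zeta : V) (u : R) :
  measurable_fun [set: CdM R d * measurableTypeR R]
    (fun p => (zeta + polar u p.2 *: (p.1 : V) : CdM R d)).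
Proof.
have mc : measurable_fun [set: CdM R d * measurableTypeR R] (fun p => cos p.2 : measurableTypeR R).
  by apply: (measurableT_comp _ measurable_snd); apply: continuous_measurable_fun; exact: continuous_cos.
have ms : measurable_fun [set: CdM R d * measurableTypeR R] (fun p => sin p.2 : measurableTypeR R).
  by apply: (measurableT_comp _ measurable_snd); apply: continuous_measurable_fun; exact: continuous_sin.
have mre j : measurable_fun [set: CdM R d * measurableTypeR R]
    (fun p => complex.Re ((p.1 : V) 0 j) : measurableTypeR R).
  exact: (measurableT_comp (measurable_coord R j).1 measurable_fst).
have mim j : measurable_fun [set: CdM R d * measurableTypeR R]
    (fun p => complex.Im ((p.1 : V) 0 j) : measurableTypeR R).
  exact: (measurableT_comp (measurable_coord R j).2 measurable_fst).
apply: measurable_to_Cd => j.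
  rewrite (_ : (fun p => _) = fun p => complex.Re (zeta 0 j) +
     expR u * (cos p.2 * complex.Re ((p.1 : V) 0 j) - sin p.2 * complex.Im ((p.1 : V) 0 j))).
    apply: measurable_funD => //; apply: measurable_funM => //.
    by apply: measurable_funB; apply: measurable_funM; [exact: mc|exact: mre|exact: ms|exact: mim].
  by apply/funext => p; rewrite !mxE !(ReD, ReM, ImM) /=; ring.
rewrite (_ : (fun p => _) = fun p => complex.Im (zeta 0 j) +
   expR u * (cos p.2 * complex.Im ((p.1 : V) 0 j) + sin p.2 * complex.Re ((p.1 : V) 0 j))).
  apply: measurable_funD => //; apply: measurable_funM => //.
  by apply: measurable_funD; apply: measurable_funM; [exact: mc|exact: mim|exact: ms|exact: mre].
by apply/funext => p; rewrite !mxE !(ImD, ReM, ImM) /=; ring.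
Qed.

Definition circled (S : set V) := forall v (c : Cplx R), cabs c = 1 -> S v -> S (c *: v).

Lemma circled_iff S v (c : Cplx R) : circled S -> cabs c = 1 -> S (c *: v) <-> S v.
Proof.
move=> cS c1; split; last exact: cS.
have c0 : c != 0 by apply/eqP => c0; move: c1; rewrite c0 cabs0 => /eqP; rewrite eq_sym oner_eq0.
move=> Scv; have := cS _ (c^-1) _ Scv; rewrite cabsV c1 invr1 scalerA mulVf// scale1r; exact.
Qed.

(** This takes the place of polar coordinates: for each t the rotation by e^(it) preserves both the
    volume and S, so after exchanging the integrals the inner one does not depend on t. *)
Lemma polar_fubini (S : set V) (G : V -> R) (zeta : V) (u : R) : open S -> circled S ->
  measurable_fun [set: CdM R d] (G : CdM R d -> R) -> (forall z, 0 <= G z) ->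
  measurable_fun [set: CdM R d] (fun v : CdM R d =>
     (\1_S v)%:E * \int[leb]_(t in `[0%R, (2 * pi)%R]) (G (zeta + polar u t *: (v : V)))%:E)%E /\
  (\int[vol]_v ((\1_S v)%:E * \int[leb]_(t in `[0%R, (2 * pi)%R]) (G (zeta + polar u t *: (v : V)))%:E) =
   (2 * pi)%:E * \int[vol]_v ((\1_S v)%:E * (G (zeta + (expR u)%:C%C *: (v : V)))%:E))%E.
Proof.
move=> oS cS mG G0; set I := `[0, 2 * pi]%classic : set (measurableTypeR R).
have mI : measurable I by exact: measurable_itv.
have lI : leb I = (2 * pi)%:E.
  by rewrite /I lebesgue_measure_itv /= lte_fin mulr_gt0 ?pi_gt0// oppr0 adde0.
have mS : measurable (S : set (CdM R d)) by exact: open_measurable_Cd.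
pose H (p : CdM R d * measurableTypeR R) : \bar R :=
  ((\1_S p.1)%:E * ((\1_I p.2)%:E * (G (zeta + polar u p.2 *: (p.1 : V)))%:E))%E.
have mGr : measurable_fun [set: CdM R d * measurableTypeR R]
    (fun p => G (zeta + polar u p.2 *: (p.1 : V))).
  exact: (measurableT_comp mG (measurable_rotation zeta u)).
have mH : measurable_fun [set: CdM R d * measurableTypeR R] H.
  apply: emeasurable_funM.
    by apply/measurable_EFinP; apply: measurableT_comp => //; exact: measurable_indic.
  apply: emeasurable_funM; last exact/measurable_EFinP.
  by apply/measurable_EFinP; apply: measurableT_comp => //; exact: measurable_indic.
have H0 p : (0 <= H p)%E by rewrite !mule_ge0 ?lee_fin.
have FE v : fubini_F leb H v =
    ((\1_S v)%:E * \int[leb]_(t in I) (G (zeta + polar u t *: (v : V)))%:E)%E.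
  pose K (t : R) : \bar R := ((\1_I t)%:E * (G (zeta + polar u t *: (v : V)))%:E)%E.
  have K0 t : (0 <= K t)%E by rewrite mule_ge0 ?lee_fin.
  have mK : measurable_fun [set: measurableTypeR R] K.
    apply: emeasurable_funM; first by apply/measurable_EFinP; exact: measurable_indic.
    by apply/measurable_EFinP; exact: (measurableT_comp mGr (pair1_measurable v)).
  transitivity ((\1_S v)%:E * \int[leb]_t K t)%E.
    by rewrite -ge0_integralZl_EFin.
  congr (_ * _)%E; rewrite [RHS]integral_mkcond; apply: eq_integral => t _.
  by rewrite patchE /K indicE; case: ifPn; rewrite ?mul1e ?mul0e.
pose h (v : CdM R d) : \bar R := ((\1_S v)%:E * (G (zeta + (expR u)%:C%C *: (v : V)))%:E)%E.
have h0 v : (0 <= h v)%E by rewrite mule_ge0 ?lee_fin.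
have mh : measurable_fun [set: CdM R d] h.
  apply: emeasurable_funM; first by apply/measurable_EFinP; exact: measurable_indic.
  apply/measurable_EFinP; have e0 : (expR u)%:C%C != 0 :> Cplx R.
    by rewrite (inj_eq (@complexI _) _ 0) gt_eqF// expR_gt0.
  have [mm _] := scales_vol zeta e0.
  rewrite (_ : (fun v => _) = G \o (fun v : CdM R d => (expR u)%:C%C *: (v : V) + zeta)).
    exact: (measurableT_comp mG mm).
  by apply/funext => v /=; rewrite addrC.
have GE t : fubini_G vol H t = ((\1_I t)%:E * \int[vol]_v h v)%E.
  rewrite /fubini_G /H.
  have c1 : cabs (polar 0 t : Cplx R) = 1 by rewrite cabs_polar expR0.
  have c0 : polar 0 t != 0 :> Cplx R by apply/eqP => c0; move: c1; rewrite c0 cabs0 => /eqP; rewrite eq_sym oner_eq0.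
  have [mr sr] := scales_vol (0 : V) c0; rewrite c1 expr1n invr1 expr1n in sr.
  have <- : (\int[vol]_v h (polar 0 t *: (v : V) + 0)%R = \int[vol]_v h v)%E.
    rewrite (@scales_integral _ _ _ vol _ 1 h ler01 _ mh h0) ?mul1e//.
  have mhr : measurable_fun [set: CdM R d] (fun v => h (polar 0 t *: (v : V) + 0)).
    exact: (measurableT_comp mh mr).
  rewrite -ge0_integralZl_EFin//.
    apply: eq_integral => v _; rewrite /h addr0 muleCA.
    have Sv : (v \in S) = (polar 0 t *: (v : V) \in S).
      apply/idP/idP => /set_mem Sv; apply/mem_set; first exact: cS.
      exact: (circled_iff _ cS c1).1.
    rewrite !indicE Sv; congr (_ * (_ * _))%E.
    by rewrite scalerA -[u in LHS]addr0 -[t in LHS]add0r polarD /polar cos0 sin0 mulr1.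
split.
  rewrite [X in measurable_fun _ X](_ : _ = fubini_F leb H); last by apply/funext => v; rewrite FE.
  exact: measurable_fun_fubini_tonelli_F.
have FT : (\int[vol]_v fubini_F leb H v = \int[leb]_t fubini_G vol H t)%E.
  exact: fubini_tonelli.
transitivity (\int[vol]_v fubini_F leb H v)%E.
  by apply: eq_integral => v _; rewrite FE.
rewrite FT; transitivity (\int[leb]_t ((\1_I t)%:E * \int[vol]_v h v))%E.
  by apply: eq_integral => t _; rewrite GE.
rewrite ge0_integralZr//=.
- rewrite (integral_indic _ _ mI)// setIT.
  by apply: (f_equal (fun x : \bar R => (x * _)%E)); exact: lI.
- by apply/measurable_EFinP; exact: measurable_indic.
- by apply: integral_ge0 => v _; exact: h0.
Qed.

Lemma circle_meanE (g : Cplx R -> Cplx R) r u : cdiff_on g r -> expR u <= r ->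
  (\int[leb]_(t in `[0%R, (2 * pi)%R]) (cabs (g (polar u t)) ^+ 2)%:E = (circle_mean g u)%:E)%E.
Proof.
move=> dg ur; rewrite /circle_mean /itg /Rintegral fineK//.
apply: integrable_fin_num => //; apply: (@ctn_integrable _ _ 0 (2 * pi)) => t _.
exact: ctn_circle dg ur _.
Qed.

Definition sqn (f : V -> (Cplx R)^o) (z : V) : R := cabs (f z) ^+ 2.

Lemma measurable_sqn (Omega : set V) f : open Omega ->
  (forall z, Omega z -> differentiable f z) -> (forall z, ~ Omega z -> f z = 0) ->
  measurable_fun [set: CdM R d] (sqn f : CdM R d -> R).
Proof. by move=> oO df f0; apply: mcplx_sqr; exact: mcplx_holomorphic oO df f0. Qed.

(** By [polar_fubini] both sides, times 2 pi, are integrals over S of circle means on the lines l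
    |-> zeta + l v, taken at u = 0 and at u = h. The inequality then holds line by line. *)
Lemma growth_integral (S Omega : set V) f (zeta : V) (h : R) (k : nat) :
  open S -> circled S -> open Omega -> (forall z, Omega z -> differentiable f z) ->
  (forall z, ~ Omega z -> f z = 0) -> 0 < h ->
  (forall v (l : Cplx R), S v -> cabs l <= expR h -> Omega (zeta + l *: v)) ->
  (forall v, S v -> exists C, exists2 eps : R, 0 < eps &
     forall l : Cplx R, cabs l <= eps -> cabs (f (zeta + l *: v)) <= C * cabs l ^+ k) ->
  (\int[vol]_v ((\1_S v)%:E * (sqn f (zeta + (v : V)))%:E) <=
   (expR (- (2 * k%:R * h)))%:E *
     \int[vol]_v ((\1_S v)%:E * (sqn f (zeta + (expR h)%:C%C *: (v : V)))%:E))%E.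
Proof.
move=> oS cS oO df f0 h0 SO Sk.
have mG := measurable_sqn oO df f0.
have G0 z : 0 <= sqn f z by exact: sqr_ge0.
have [m0 e0] := polar_fubini zeta 0 oS cS mG G0.
have [mh eh] := polar_fubini zeta h oS cS mG G0.
have pp : (0 < (2 * pi)%:E :> \bar R)%E by rewrite lte_fin pi2_gt0.
rewrite -(lee_pmul2l _ pp)// [leRHS]muleCA -eh.
have -> : (\int[vol]_v ((\1_S v)%:E * (sqn f (zeta + (v : V)))%:E) =
    \int[vol]_v ((\1_S v)%:E * (sqn f (zeta + (expR 0)%:C%C *: (v : V)))%:E))%E.
  by apply: eq_integral => v _; rewrite expR0 scale1r.
rewrite -e0; clear e0 eh.
have LI := @le_integral_scaled _ (CdM R d) R vol _ _ (expR (- (2 * k%:R * h))) m0 mh.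
apply: LI.
- by move=> v; apply: mule_ge0; rewrite ?lee_fin//; apply: integral_ge0 => t _; rewrite lee_fin.
- by move=> v; apply: mule_ge0; rewrite ?lee_fin//; apply: integral_ge0 => t _; rewrite lee_fin.
- exact: expR_ge0.
move=> v; apply: lee_indic_scaled => Sv.
have dg : cdiff_on (fun l : Cplx R => f (zeta + l *: (v : V))) (expR h).
  move=> l lh; exists ('d f (zeta + l *: (v : V)) v).
  by apply: line_cdiff; apply: df; exact: SO.
have h0' : expR 0 <= expR h by rewrite ler_expR ltW.
have E w : expR w <= expR h -> (\int[leb]_(t in `[0%R, (2 * pi)%R])
    (sqn f (zeta + polar w t *: (v : V)))%:E = (circle_mean (fun l : Cplx R => f (zeta + l *: (v : V))) w)%:E)%E.
  by move=> wh; exact: (circle_meanE dg wh).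
apply: (lee_EFin_scaled (E _ h0') (E _ (lexx _))).
have [C [eps eps0 HC]] := Sk v Sv.
by have := circle_mean_growth dg h0 (lexx _) eps0 HC; rewrite subrr.
Qed.

(** Subharmonicity of |f|^2 in several variables: the one-variable inequality on every line through
    zeta, integrated over the ball. *)
Lemma mean_value_integral (Omega : set V) f (zeta : V) (r : R) :
  open Omega -> (forall z, Omega z -> differentiable f z) ->
  (forall z, ~ Omega z -> f z = 0) -> 0 < r -> cball zeta r `<=` Omega ->
  ((sqn f zeta)%:E * vol (cball zeta r) <= \int[vol]_(z in Omega) (sqn f z)%:E)%E.
Proof.
move=> oO df f0 r0 bO.
have mG := measurable_sqn oO df f0.
have G0 z : 0 <= sqn f z by exact: sqr_ge0.
pose S : set V := cball 0 r.
have oS : open S by exact: open_cball.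
have mS : measurable (S : set (CdM R d)) by exact: open_measurable_Cd.
have mO := open_measurable_Cd oO.
have cS : circled S by move=> v c c1; rewrite /S /cball /= !subr0 vnmZ c1 mul1r.
have [m0 e0] := polar_fubini zeta 0 oS cS mG G0.
have [mt et] := scales_vol zeta (oner_neq0 (Cplx R)).
rewrite cabs1 expr1n invr1 expr1n in et.
have vS : vol (cball zeta r) = vol S.
  have := et _ (open_measurable_Cd (@open_cball R d zeta r)); rewrite mul1e => <-.
  congr (vol _); apply/seteqP; split => w /=; rewrite /S /cball /= scale1r subr0 addrK //.
have tr : (\int[vol]_v ((\1_S v)%:E * (sqn f (zeta + (expR 0)%:C%C *: (v : V)))%:E) <=
    \int[vol]_(z in Omega) (sqn f z)%:E)%E.
  pose H (z : CdM R d) : \bar R := ((\1_Omega z)%:E * (sqn f z)%:E)%E.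
  have H0 z : (0 <= H z)%E by rewrite mule_ge0 ?lee_fin.
  have mH : measurable_fun [set: CdM R d] H.
    by apply: emeasurable_funM; apply/measurable_EFinP => //; exact: measurable_indic.
  have -> : (\int[vol]_(z in Omega) (sqn f z)%:E = \int[vol]_z H z)%E.
    rewrite integral_mkcond; apply: eq_integral => z _; rewrite patchE /H indicE.
    by case: ifPn; rewrite ?mul1e ?mul0e.
  have := @scales_integral _ _ _ vol _ 1 H ler01 (conj mt et) mH H0.
  rewrite mul1e => <-; apply: ge0_le_integral => //.
  - by move=> v _; apply: mule_ge0; rewrite lee_fin.
  - apply: emeasurable_funM; first by apply/measurable_EFinP; exact: measurable_indic.
    apply/measurable_EFinP; rewrite (_ : (fun v => _) = sqn f \o (fun v : CdM R d => 1 *: (v : V) + zeta)).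
      exact: (measurableT_comp mG mt).
    by apply/funext => v /=; rewrite expR0 addrC.
  - exact: (measurableT_comp mH mt).
  move=> v _; rewrite /H expR0 !scale1r [(zeta + _)%R]addrC.
  rewrite lee_wpmul2r ?lee_fin// !indicE ler_nat.
  have [/set_mem Sv|//] := boolP (v \in S).
  rewrite mem_set//; apply: bO; rewrite /cball /= addrK.
  by move: Sv; rewrite /S /cball /= subr0.
have pp : (0 < (2 * pi)%:E :> \bar R)%E by rewrite lte_fin pi2_gt0.
rewrite -(lee_pmul2l _ pp)// vS.
apply: (le_trans _ (lee_wpmul2l (ltW pp) tr)).
rewrite -e0; clear e0 tr.
have -> : ((2 * pi)%:E * ((sqn f zeta)%:E * vol S) =
    (2 * pi * sqn f zeta)%:E * vol S)%E.
  by rewrite EFinM muleA.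
have LM := @le_scaled_measure _ (CdM R d) R vol S _ (2 * pi * sqn f zeta) mS m0.
apply: LM.
- by rewrite mulr_ge0// ltW// pi2_gt0.
- by move=> v; apply: mule_ge0; rewrite ?lee_fin//; apply: integral_ge0 => t _; rewrite lee_fin.
move=> v Sv; rewrite indicE mem_set// mul1e.
have dg : cdiff_on (fun l : Cplx R => f (zeta + l *: (v : V))) (expR 0).
  move=> l lh; exists ('d f (zeta + l *: (v : V)) v).
  apply: line_cdiff; apply: df; apply: bO.
  move: Sv; rewrite /S /cball /= subr0 addrC addKr vnmZ; apply: le_lt_trans.
  by rewrite ler_piMl ?vnm_ge0// (le_trans lh)// expR0.
have -> : (\int[leb]_(t in `[0%R, (2 * pi)%R]) (sqn f (zeta + polar 0 t *: (v : V)))%:E =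
    (circle_mean (fun l : Cplx R => f (zeta + l *: (v : V))) 0)%:E)%E.
  exact: (circle_meanE dg (lexx _)).
rewrite lee_fin mulrC.
by have := mean_value_sqr dg; rewrite scale0r addr0.
Qed.

End PolarFubini.

Section CircledDecay.
Variables (R : realType) (d : nat).
Notation V := 'rV[Cplx R]_d.
Notation vol := (@vol R d).

Lemma translateE (D : set V) zeta : translate D zeta = [set v | D (zeta + v)].
Proof.
apply/seteqP; split => v /=; first by case=> w Dw <-; rewrite addrC subrK.
by move=> Dv; exists (zeta + v) => //; rewrite addrC addKr.
Qed.

Lemma open_translate (D : set V) zeta : open D -> open (translate D zeta).
Proof.
move=> oD; rewrite translateE openE => v /= Dv.
have /nbhs_vnm[r r0 Hr] : nbhs (zeta + v) D by exact: open_nbhs_nbhs.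
apply/nbhs_vnm; exists r => // w wr /=; rewrite addrA; exact: Hr.
Qed.

(* Openness lets the scalars |c| < 1 of the definition be pushed up to |c| = 1. *)
Lemma strictly_circled_le1 (D : set V) zeta v (c : Cplx R) : open D -> strictly_circled D zeta ->
  translate D zeta v -> cabs c <= 1 -> translate D zeta (c *: v).
Proof.
move=> oD cD Tv c1.
have /nbhs_vnm[r r0 Hr] : nbhs v (translate D zeta).
  by apply: open_nbhs_nbhs; split => //; exact: open_translate.
have K0 : 0 < 1 + vnm v by have := vnm_ge0 v; lra.
pose e : R := r / 2 / (1 + vnm v); have e0 : 0 < e by rewrite !divr_gt0.
have Tw : translate D zeta (v + e%:C%C *: v).
  apply: Hr; rewrite vnmZ cabs_real ger0_norm ?(ltW e0)//.
  rewrite /e -mulrA -mulrA mulrC; have : 0 < r / 2 by rewrite divr_gt0.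
  have : (1 + vnm v)^-1 * vnm v <= 1.
    by rewrite mulrC ler_pdivrMr// mul1r; have := vnm_ge0 v; lra.
  move: (_^-1 * vnm v) => x; nra.
have E0 : (1 + e)%:C%C != 0 :> Cplx R.
  by rewrite (inj_eq (@complexI _) _ 0) gt_eqF// addr_gt0.
have := cD (c / (1 + e)%:C%C); case.
  rewrite normE ltcR cabsM cabsV cabs_real ger0_norm ?addr_ge0 ?(ltW e0)//.
  by rewrite ltr_pdivrMr ?addr_gt0// mul1r; lra.
move=> _; apply; apply: subset_closure; exists (v + e%:C%C *: v) => //.
have -> : v + e%:C%C *: v = ((1 + e)%:C%C : Cplx R) *: v by rewrite rmorphD scalerDl scale1r.
by rewrite scalerA divfK.
Qed.

(** The factor gamma^(-2k) is the growth estimate with h = ln gamma, and gamma^(-2d) is the Jacobian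
    of the dilation. The centre of a nonempty D lies in Omega, but that of an empty D need not, so
    nothing is asked of the coefficients there. *)
Lemma circled_taylor_decay (Omega D : set V) f (zeta : V) (gamma : R) (k : nat) :
  open Omega -> (forall z, Omega z -> differentiable f z) ->
  (forall z, ~ Omega z -> f z = 0) ->
  open D -> strictly_circled D zeta -> 1 < gamma -> dilate D zeta gamma `<=` Omega ->
  (D !=set0 -> forall i, (taylor zeta d k f)`_i = 0) ->
  (\int[vol]_z ((\1_D z)%:E * (sqn f z)%:E) <=
   ((gamma ^- (k + d)) ^+ 2)%:E * \int[vol]_z (sqn f z)%:E)%E.
Proof.
move=> oO df f0 oD cD g1 DO Tf; set T := translate D zeta.
have g0 : 0 < gamma by lra.
have oT : open T by exact: open_translate.
have cT : circled T by move=> v c c1 Tv; apply: strictly_circled_le1; rewrite ?c1.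
have TO v (l : Cplx R) : T v -> cabs l <= gamma -> Omega (zeta + l *: v).
  move=> Tv lg; apply: DO; exists ((l / gamma%:C%C) *: v).
    apply: strictly_circled_le1 => //.
    rewrite cabsM cabsV cabs_real ger0_norm ?(ltW g0)//.
    by rewrite ler_pdivrMr// mul1r.
  rewrite scalerA mulrCA divff ?mulr1 1?addrC//.
  by rewrite (inj_eq (@complexI _) _ 0) gt_eqF.
have nT v : T v -> exists C, exists2 eps : R, 0 < eps &
     forall l : Cplx R, cabs l <= eps -> cabs (f (zeta + l *: v)) <= C * cabs l ^+ k.
  move=> Tv.
  have D0 : D !=set0 by case: Tv => w Dw _; exists w.
  have nz : near_hol f zeta.
    have Oz : Omega zeta.
      by have := TO v 0 Tv; rewrite scale0r addr0 cabs0; apply; exact: ltW.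
    by apply: filterS df _; apply: open_nbhs_nbhs.
  have [C C0 [r r0 Hr]] := taylor_vanish nz (Tf D0).
  have K0 : 0 < 1 + vnm v by have := vnm_ge0 v; lra.
  exists (C * vnm v ^+ k), (r / 2 / (1 + vnm v)); first by rewrite !divr_gt0.
  move=> l ll; rewrite -mulrA [vnm v ^+ k * _]mulrC -exprMn -vnmZ; apply: Hr.
    by move=> j; rewrite leqNgt ltn_ord.
  rewrite vnmZ; have : cabs l * (1 + vnm v) <= r / 2 by rewrite -ler_pdivlMr.
  have := vnm_ge0 v; have := cabs_ge0 l; move: (cabs l) (vnm v) => x y; nra.
have h0 : 0 < ln gamma by exact: ln_gt0.
have eh : expR (ln gamma) = gamma by rewrite lnK// posrE.
have TO' v (l : Cplx R) : T v -> cabs l <= expR (ln gamma) -> Omega (zeta + l *: v).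
  by rewrite eh; exact: TO.
have GI := growth_integral oT cT oO df f0 h0 TO' nT.
rewrite eh in GI.
have mG := measurable_sqn oO df f0.
have mD : measurable (D : set (CdM R d)) by exact: open_measurable_Cd.
pose H (z : CdM R d) : \bar R := ((\1_D z)%:E * (sqn f z)%:E)%E.
have H0 z : (0 <= H z)%E by apply: mule_ge0; rewrite lee_fin// sqr_ge0.
have mH : measurable_fun [set: CdM R d] H.
  by apply: emeasurable_funM; apply/measurable_EFinP => //; exact: measurable_indic.
have S1 := scales_vol zeta (oner_neq0 (Cplx R)).
rewrite cabs1 expr1n invr1 expr1n in S1.
have E1 : (\int[vol]_v ((\1_T v)%:E * (sqn f (zeta + (v : V)))%:E) = \int[vol]_z H z)%E.
  have := @scales_integral _ _ _ vol _ 1 H ler01 S1 mH H0.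
  rewrite mul1e => <-; apply: eq_integral => v _.
  rewrite /H scale1r [(zeta + _)%R]addrC; congr (_ * _)%E; rewrite !indicE; congr (_%:R%:E).
  by congr (nat_of_bool _); apply/idP/idP => /set_mem h; apply/mem_set; move: h; rewrite /T translateE /= addrC.
rewrite -[leLHS]/(\int[vol]_z H z)%E -E1; apply: le_trans GI _.
have gc0 : gamma%:C%C != 0 :> Cplx R by rewrite (inj_eq (@complexI _) _ 0) gt_eqF.
have S2 := scales_vol zeta gc0.
rewrite cabs_real ger0_norm ?(ltW g0)// in S2.
pose K (z : CdM R d) : \bar R := (sqn f z)%:E.
have K0 z : (0 <= K z)%E by rewrite lee_fin sqr_ge0.
have mK : measurable_fun [set: CdM R d] K by exact/measurable_EFinP.
have p0 : 0 <= ((gamma ^+ 2)^-1) ^+ d by rewrite exprn_ge0// invr_ge0 exprn_ge0// ltW.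
have E2 := @scales_integral _ _ _ vol _ _ K p0 S2 mK K0.
have -> : (((gamma ^- (k + d)) ^+ 2)%:E * \int[vol]_z (sqn f z)%:E =
   (expR (- (2 * k%:R * ln gamma)))%:E * \int[vol]_v K (gamma%:C%C *: (v : V) + zeta)%R)%E.
  rewrite E2 muleA -EFinM; congr (_%:E * _)%E.
  have -> : expR (- (2 * k%:R * ln gamma)) = ((gamma ^- k) ^+ 2).
    by rewrite -natrM expRN expRM_natl eh mulnC exprM exprVn.
  by rewrite exprD invfM exprMn; congr (_ * _); rewrite -!exprVn -!exprM mulnC.
apply: lee_wpmul2l; first by rewrite lee_fin expR_ge0.
apply: ge0_le_integral => //.
- by move=> v _; apply: mule_ge0; rewrite lee_fin// sqr_ge0.
- apply: emeasurable_funM.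
    by apply/measurable_EFinP; apply: measurable_indic; exact: open_measurable_Cd.
  apply/measurable_EFinP; rewrite (_ : (fun v => _) = sqn f \o (fun v : CdM R d => gamma%:C%C *: (v : V) + zeta)).
    by apply: (measurableT_comp mG); case: S2.
  by apply/funext => v /=; rewrite addrC.
- by apply: (measurableT_comp mK); case: S2.
move=> v _; rewrite /K [(zeta + _)%R]addrC indicE.
case: (v \in T); first by rewrite mul1e.
by rewrite mul0e lee_fin sqr_ge0.
Qed.

End CircledDecay.

(** * Bergman spaces *)

Section BergmanBasics.
Variables (R : realType) (d : nat).
Notation V := 'rV[Cplx R]_d.
Notation vol := (@vol R d).
Implicit Types (Omega : set V) (f g : V -> (Cplx R)^o).

(** Extension by zero turns integrals over Omega into integrals over the whole space, so the general
    facts on [l2] and [ip] apply. *)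
Lemma bergman_sqint Omega f : (forall z, ~ Omega z -> f z = 0) ->
  (\int[volume R d]_(z in Omega) (complex.Re (`|f z| ^+ 2))%:E = sqint vol f)%E.
Proof.
move=> f0; rewrite integral_mkcond; apply: eq_integral => z _; rewrite patchE.
have -> : complex.Re (`|f z| ^+ 2) = cabs (f z) ^+ 2 by rewrite normE -rmorphXn.
by case: ifPn => // /negP zO; rewrite f0 ?cabs0 ?expr0n// => Oz; apply: zO; rewrite inE.
Qed.

Lemma bergman_carrierP Omega f : bergman_carrier Omega f <->
  [/\ forall z, Omega z -> differentiable f z, forall z, ~ Omega z -> f z = 0 &
      (sqint vol f < +oo)%E].
Proof.
split=> -[h1 h2 h3]; split; [exact: h1|exact: h2| |exact: h1|exact: h2|].
  by rewrite -(bergman_sqint h2).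
by rewrite (bergman_sqint h2).
Qed.

Lemma bergman_l2 Omega f : open Omega -> bergman_carrier Omega f -> l2 vol f.
Proof.
by move=> oO /bergman_carrierP[h1 h2 h3]; split => //; exact: mcplx_holomorphic h2.
Qed.

Lemma bergman_innerE Omega f g : (forall z, ~ Omega z -> f z = 0) ->
  bergman_inner Omega f g = ip vol f g.
Proof.
move=> f0.
have E (p : Cplx R -> R) : p 0 = 0 ->
    \int[volume R d]_(z in Omega) p (f z * (g z)^* ) = \int[vol]_z p (f z * (g z)^* ).
  move=> p0; rewrite Rintegral_mkcond; apply: eq_Rintegral => z _; rewrite patchE.
  case: (boolP (z \in Omega)) => [_|/negP zO]; first by [].
  by rewrite f0 ?mul0r ?p0// => Oz; apply: zO; rewrite inE.
by apply: (f_equal2 (fun a b => (a +i* b)%C)); exact: E.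
Qed.

Lemma sqr_hnorm Omega (f : bergman Omega) : carrier f -> hnorm f ^+ 2 = fine (sqint vol f).
Proof.
move=> /bergman_carrierP[_ f0 _].
have E : inner f f = (fine (sqint vol f))%:C%C by rewrite -ip_self; exact: bergman_innerE.
rewrite /hnorm E /=.
by rewrite sqr_sqrtr// fine_ge0// sqint_ge0.
Qed.

Lemma sqint_hnorm Omega (f : bergman Omega) : carrier f -> sqint vol f = (hnorm f ^+ 2)%:E.
Proof.
move=> cf; rewrite sqr_hnorm// fineK//; case/bergman_carrierP: cf => _ _ fi.
by rewrite ge0_fin_numE// sqint_ge0.
Qed.

Lemma hnorm_ge0 (H : ipSpace R) (x : H) : 0 <= hnorm x.
Proof. exact: sqrtr_ge0. Qed.

(** K is vol(ball)^(-1/2), by the mean value inequality; translation invariance makes it independent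
    of z. *)
Lemma bergman_bound (r : R) : 0 < r -> exists2 K : R, 0 < K &
  forall Omega (f : bergman Omega) z, open Omega -> carrier f ->
    cball z r `<=` Omega -> cabs (f z) <= K * hnorm f.
Proof.
move=> r0; have /andP[v0 voo] := @vol_cball R d 0 r r0.
pose m := fine (vol (cball (0 : V) r)).
have mE : vol (cball (0 : V) r) = m%:E by rewrite fineK// ge0_fin_numE// ltW.
have m0 : 0 < m by rewrite -lte_fin -mE.
exists (Num.sqrt m)^-1; first by rewrite invr_gt0 sqrtr_gt0.
move=> Omega f z oO cf zO; have [df f0 fi] := (bergman_carrierP _ _).1 cf.
have := mean_value_integral oO df f0 r0 zO.
rewrite vol_cballE mE.
have -> : (\int[vol]_(z in Omega) (sqn f z)%:E = (hnorm f ^+ 2)%:E)%E.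
  rewrite -(sqint_hnorm cf) integral_mkcond; apply: eq_integral => w _.
  rewrite patchE; case: (boolP (w \in Omega)) => [_|/negP wO]; first by [].
  have fw : f w = 0 :> Cplx R by apply: f0 => Ow; apply: wO; rewrite inE.
  by rewrite fw cabs0 expr0n.
rewrite -EFinM lee_fin -ler_pdivlMr// => h.
rewrite -(@ler_pXn2r _ 2)// ?nnegrE ?cabs_ge0 ?mulr_ge0 ?hnorm_ge0 ?invr_ge0 ?sqrtr_ge0//.
by rewrite exprMn exprVn sqr_sqrtr 1?mulrC// ltW.
Qed.

Lemma bergman_lin Omega (a : Cplx R) (f g : bergman Omega) : open Omega ->
  carrier f -> carrier g -> carrier (a *: f + g).
Proof.
move=> oO cf cg; apply/bergman_carrierP.
have [df f0 _] := (bergman_carrierP _ _).1 cf.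
have [dg g0 _] := (bergman_carrierP _ _).1 cg.
split.
- by move=> z Oz; apply: differentiableD; [apply: differentiableZ; exact: df|exact: dg].
- move=> z zO; have fz : f z = 0 :> Cplx R := f0 z zO.
  have gz : g z = 0 :> Cplx R := g0 z zO.
  by rewrite -[LHS]/(a * f z + g z : Cplx R) fz gz mulr0 addr0.
by have [] := l2_lin a (bergman_l2 oO cf) (bergman_l2 oO cg).
Qed.

Lemma bergman_carrier0 Omega : bergman_carrier Omega (0 : V -> (Cplx R)^o).
Proof.
apply/bergman_carrierP; split => //.
rewrite /sqint (eq_integral (cst 0%E)) ?integral0 ?ltry//.
by move=> z _; rewrite [X in cabs X](_ : _ = 0)// cabs0 expr0n.
Qed.

Lemma bergman_sub Omega (f g : bergman Omega) : open Omega ->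
  carrier f -> carrier g -> carrier (f - g).
Proof. by move=> oO cf cg; rewrite addrC -scaleN1r; exact: bergman_lin. Qed.

(** Norm zero alone gives vanishing almost everywhere; the bound on point evaluations gives it at
    every point. *)
Lemma bergman_eq0 Omega (f : bergman Omega) : open Omega -> carrier f -> hnorm f = 0 -> f = 0.
Proof.
move=> oO cf nf0; have [_ f0 _] := (bergman_carrierP _ _).1 cf.
apply/funext => z; have [Oz|/f0//] := pselect (Omega z).
have /nbhs_vnm[r r0 Hr] : nbhs z Omega by exact: open_nbhs_nbhs.
have [K K0 HK] := bergman_bound r0.
apply: cabs_eq0; apply/eqP; rewrite eq_le cabs_ge0 andbT.
have := HK _ f z oO cf; rewrite nf0 mulr0; apply => w; rewrite /cball /= => wr.
by rewrite -(subrK z w) addrC; exact: Hr.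
Qed.

End BergmanBasics.

Lemma limn_einf_le_near (R : realType) (a : nat -> \bar R) (C : \bar R) :
  (\forall n \near \oo, a n <= C)%E -> (limn_einf a <= C)%E.
Proof.
move=> H; rewrite limn_einf_lim; apply: lime_le; first exact: is_cvg_einfs.
apply: filterS H => n; apply: le_trans.
by apply: ereal_inf_lbound; exists n => //=.
Qed.

Lemma cvg_sqr_cabs (R : realType) (u : nat -> Cplx R) (l : Cplx R) :
  u @ \oo --> (l : (Cplx R)^o) -> (fun n => cabs (u n) ^+ 2) @ \oo --> cabs l ^+ 2.
Proof.
move=> ul; suff H : (fun n => cabs (u n)) @ \oo --> cabs l by rewrite expr2; apply: cvgM.
apply/cvgrPdist_le => e e0; have H := (@cvg_cplx R nat \oo eventually_filter u l).1 ul _ e0; near=> n.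
have : cabs (u n - l) <= e by near: n.
apply: le_trans; rewrite ler_norml; apply/andP; split.
  by rewrite lerNl opprB lerBlDr -{1}(subrK l (u n)) cabsD.
by rewrite lerBlDr cabs_sub -{1}(subrK (u n) l) cabsD.
Unshelve. all: by end_near. Qed.

(** Fatou's lemma, as lower semicontinuity of the norm under pointwise convergence. *)
Lemma sqint_limit d' (T : measurableType d') (R : realType) (mu : {measure set T -> \bar R})
    (u : nat -> T -> Cplx R) (l : T -> Cplx R) (C : \bar R) :
  (forall n, mcplx (u n)) -> (forall x, (fun n => u n x) @ \oo --> (l x : (Cplx R)^o)) ->
  (\forall n \near \oo, sqint mu (u n) <= C)%E -> (sqint mu l <= C)%E.
Proof.
move=> mu_ ul uC.
have F := @fatou _ _ _ mu setT measurableT (fun n x => (cabs (u n x) ^+ 2)%:E).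
apply: le_trans (limn_einf_le_near uC); apply: le_trans (F _ _).
- rewrite le_eqVlt; apply/orP; left; apply/eqP; apply: eq_integral => x _.
  suff /cvg_limn_einf_sup[-> //] : (fun n => (cabs (u n x) ^+ 2)%:E) @ \oo --> (cabs (l x) ^+ 2)%:E.
  by apply/fine_cvgP; split; [exact: nearW|exact: (cvg_sqr_cabs (ul x))].
- by move=> n; apply/measurable_EFinP; exact: mcplx_sqr.
- by move=> n x _; rewrite lee_fin sqr_ge0.
Qed.

(** * Completeness of Bergman space *)

Section BergmanHilbert.
Variables (R : realType) (d : nat).
Notation V := 'rV[Cplx R]_d.
Notation vol := (@vol R d).
Implicit Types (Omega : set V) (f g : V -> (Cplx R)^o).

Lemma local_bound Omega z : open Omega -> Omega z -> exists2 r : R, 0 < r &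
  exists2 K : R, 0 < K & (forall w, vnm w < r -> Omega (z + w)) /\
    forall (f : bergman Omega) w, carrier f -> vnm w < r -> cabs (f (z + w)) <= K * hnorm f.
Proof.
move=> oO Oz; have /nbhs_vnm[r r0 Hr] : nbhs z Omega by exact: open_nbhs_nbhs.
have r2 : 0 < r / 2 by rewrite divr_gt0.
have [K K0 HK] := bergman_bound (R := R) d r2.
exists (r / 2) => //; exists K => //; split=> [w wr|f w cf wr].
  by apply: Hr; apply: lt_trans wr _; lra.
apply: HK => // x; rewrite /cball /= => xr.
have -> : x = z + (w + ((x : V) - (z + w))) :> V by rewrite addrA addrC subrK.
apply: Hr; apply: le_lt_trans (vnmD _ _) _; lra.
Qed.

(** The limit is built pointwise, since point evaluations are bounded; it is holomorphic by
    [limit_holomorphic], and convergence in norm follows from Fatou's lemma. *)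
Lemma bergman_complete Omega (u : nat -> bergman Omega) : open Omega ->
  (forall n, carrier (u n)) -> hcauchy u -> exists2 l : bergman Omega, carrier l & hcvg u l.
Proof.
move=> oO cu hu.
have u0 n z : ~ Omega z -> u n z = 0 by case/bergman_carrierP : (cu n) => _ + _; exact.
have du n z : Omega z -> differentiable (u n) z by case/bergman_carrierP : (cu n) => + _ _; exact.
have pw z : exists l : Cplx R, (fun n => u n z) @ \oo --> (l : (Cplx R)^o).
  have [Oz|zO] := pselect (Omega z); last first.
    exists 0; rewrite (_ : (fun n => u n z) = cst 0); first exact: cvg_cst.
    by apply/funext => n; exact: u0.
  have [r r0 [K K0 [_ HK]]] := local_bound oO Oz.
  apply: cvg_sub_cauchy => e e0.
  have [n0 Hn0] := hu (e / K) ltac:(by rewrite divr_gt0).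
  exists (u n0 z); exists n0 => // n /= n0n.
  have := HK (u n - u n0) 0 (bergman_sub oO (cu n) (cu n0)).
  rewrite vnm0 addr0 => /(_ r0) /le_trans; apply.
  by rewrite mulrC -ler_pdivlMr// ltW// Hn0.
have [l Hl] := boolp.choice pw.
have l0 z : ~ Omega z -> l z = 0.
  move=> zO; have lz : (fun=> 0 : (Cplx R)^o) @ \oo --> (l z : (Cplx R)^o).
    apply: cvg_trans (Hl z); apply: near_eq_cvg; apply: nearW => n; exact: u0.
  by apply/esym; apply: (cvg_unique _ (cvg_cst _) lz).
(* From n1 on the sequence stays within distance 1 of [u n1], which gives the local uniform bound on
   the tail. *)
have [n1 Hn1] := hu 1 ltr01.
have dl z : Omega z -> differentiable (l : V -> (Cplx R)^o) z.
  move=> Oz; have [r r0 [K K0 [Or HK]]] := local_bound oO Oz.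
  have LH := @limit_holomorphic R _ nat \oo eventually_filter (fun n => u (n + n1)%N) l z r (K * 1 + K * hnorm (u n1)) r0.
  apply: LH.
  - by move=> n w wr; apply: du; exact: Or.
  - move=> n w wr; set m := (n + n1)%N.
    rewrite -[X in cabs X](subrK (u n1 (z + w))); apply: le_trans (cabsD _ _) _.
    apply: lerD; last exact: HK.
    apply: (le_trans (HK (u m - u n1) w (bergman_sub oO (cu m) (cu n1)) wr)).
    by rewrite ler_wpM2l ?(ltW K0)// ltW// Hn1// leq_addl.
  - move=> w wr; have := Hl (z + w); by rewrite -(cvg_shiftn n1).
have ml := mcplx_holomorphic oO dl l0.
have mu n := (bergman_l2 oO (cu n)).1.
(* Fatou's lemma with m fixed and n tending to infinity. *)
have tail m (e : R) : 0 < e -> (\forall n \near \oo, hnorm (u n - u m) <= e) ->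
    (sqint vol (fun z : CdM R d => (u m z - l z)%R) <= (e ^+ 2)%:E)%E.
  move=> e0 H; apply: (@sqint_limit _ _ _ vol (fun n z => u m z - u n z)).
  - by move=> n; case: (bergman_l2 oO (bergman_sub oO (cu m) (cu n))).
  - by move=> z; apply: cvg_cplxB; [exact: cvg_cst|exact: Hl].
  apply: filterS H => n h.
  have -> : sqint vol (fun z : CdM R d => (u m z - u n z)%R) = sqint vol (u n - u m).
    by apply: eq_integral => z _; rewrite cabs_sub.
  rewrite sqint_hnorm; last exact: bergman_sub.
  by rewrite lee_fin lerXn2r ?nnegrE ?hnorm_ge0// ltW.
have cl : bergman_carrier Omega (l : V -> (Cplx R)^o).
  apply/bergman_carrierP; split => //.
  have [n0 Hn0] := hu 1 ltr01.
  have := tail n0 1 ltr01; rewrite expr1n => T.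
  have {}T := T ltac:(by exists n0 => // n /= h; rewrite ltW// Hn0).
  apply: (l2_sub (bergman_l2 oO (cu n0)) _).2; split; first exact: (mcplxB (mu n0) ml).
  by apply: le_lt_trans T _; rewrite ltry.
exists l => //; apply/cvgrPdist_le => e e0.
have e20 : 0 < e by [].
have [n0 Hn0] := hu e e20; exists n0 => // m /= n0m.
rewrite sub0r normrN ger0_norm ?hnorm_ge0//.
rewrite -(@ler_pXn2r _ 2)// ?nnegrE ?hnorm_ge0 ?(ltW e0)//.
have cum : carrier (u m - l : bergman Omega) by exact: bergman_sub.
rewrite -lee_fin -(sqint_hnorm cum); apply: tail => //.
by exists n0 => // n /= h; rewrite ltW// Hn0.
Qed.

Lemma bergman_hilbert Omega : open Omega -> is_hilbert (bergman Omega).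
Proof.
move=> oO; split.
- exact: bergman_carrier0.
- by move=> a x y; exact: bergman_lin.
- move=> a x y z cx cy cz.
  have x0 := ((bergman_carrierP _ _).1 cx).
  have y0 := ((bergman_carrierP _ _).1 cy).
  have s0 := ((bergman_carrierP _ _).1 (bergman_lin a oO cx cy)).
  rewrite /inner /= (bergman_innerE _ (let: And3 _ h _ := x0 in h)).
  rewrite (bergman_innerE _ (let: And3 _ h _ := y0 in h)).
  rewrite (bergman_innerE _ (let: And3 _ h _ := s0 in h)).
  exact: (ip_lin a (bergman_l2 oO cx) (bergman_l2 oO cy) (bergman_l2 oO cz)).
- move=> x y cx cy.
  have x0 := ((bergman_carrierP _ _).1 cx).
  have y0 := ((bergman_carrierP _ _).1 cy).
  rewrite /inner /= (bergman_innerE _ (let: And3 _ h _ := x0 in h)).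
  rewrite (bergman_innerE _ (let: And3 _ h _ := y0 in h)).
  exact: (ip_conj (bergman_l2 oO cx) (bergman_l2 oO cy)).
- move=> x cx; have [_ x0 _] := ((bergman_carrierP _ _).1 cx).
  rewrite /inner /= (bergman_innerE _ x0) ip_self.
  by rewrite -[0](rmorph0 (real_complex R)) lecR fine_ge0// sqint_ge0.
- move=> x cx xx; apply: bergman_eq0 => //.
  by rewrite /hnorm xx sqrtr0.
- by move=> u; exact: bergman_complete.
Qed.

End BergmanHilbert.

(** * Compactness of the restriction *)

Section LocalHolomorphy.
Variables (R : realType) (V : normedModType (Cplx R)).
Implicit Types (f : V -> (Cplx R)^o).

Lemma differentiable_near f g z : (\forall w \near z, differentiable f w) ->
  (\forall w \near z, f w = g w) -> differentiable g z.
Proof.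
move=> df fg; have [r r0 [M hf bf]] := hol_bounded df.
have [L _] := taylor2_ball r0 hf bf.
apply: (diff_of_eps L) => e e0.
have dz : differentiable f z by exact: (nbhs_singleton df).
have [dl dl0 H] := diff_eps dz e0.
have [s s0 Hs] := (nbhs_vnm _ _).1 fg.
exists (Num.min dl s); first by rewrite lt_min dl0.
move=> v; rewrite lt_min => /andP[v1 v2].
by rewrite -(Hs v v2) -[X in _ - g X]addr0 -(Hs 0) ?vnm0// addr0; exact: H.
Qed.

(** Equicontinuity of a bounded family. The constant is 24 = 8 + 64 / 4: for |v| <= r / 4 the
    quadratic remainder is at most 16 (M / r) |v|. *)
Lemma lipschitz_ball f z (r M : R) v : 0 < r -> hol_ball f z r -> bnd_ball f z r M ->
  vnm v <= r / 4 -> cabs (f (z + v) - f z) <= 24 * M / r * vnm v.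
Proof.
move=> r0 hf bf vr; have [L T] := taylor2_ball r0 hf bf.
have M0 : 0 <= M by apply: le_trans (cabs_ge0 _) (bf 0 _); rewrite vnm0.
rewrite -(subrK ('d f z v) (f (z + v) - f z)); apply: le_trans (cabsD _ _) _.
have q0 : 0 <= M / r by rewrite divr_ge0// ltW.
have := L v; have := T v vr; have := vnm_ge0 v.
have e1 : 64 * M / r ^+ 2 * vnm v ^+ 2 = 64 * (M / r) * (vnm v / r) * vnm v by field; exact: lt0r_neq0.
have e2 : 8 * M / r * vnm v = 8 * (M / r) * vnm v by field; exact: lt0r_neq0.
have e3 : 24 * M / r * vnm v = 24 * (M / r) * vnm v by field; exact: lt0r_neq0.
rewrite e1 e2 e3; have : vnm v / r <= 1 / 4 by rewrite ler_pdivrMr// mulrC mul1r.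
move: (M / r) q0 (vnm v) (cabs _) (cabs _) => q q0 x a b y4 x0 ha hb.
have qx : 0 <= q * x by rewrite mulr_ge0.
have : q * x * (x / r) <= q * x * (1 / 4) by rewrite ler_wpM2l.
move: (x / r) y4 ha => y y4 ha; lra.
Qed.

End LocalHolomorphy.

(** Along an ultrafilter every bounded function converges; this replaces the extraction of diagonal
    subsequences. *)
Lemma ultra_bounded_cvg T (G : set_system T) (R : realType) (u : T -> Cplx R) (B : R) :
  UltraFilter G -> (\forall n \near G, cabs (u n) <= B) -> exists l : Cplx R, u @ G --> (l : (Cplx R)^o).
Proof.
move=> UG uB.
have C (p : Cplx R -> R) : (forall x, `|p x| <= cabs x) ->
    exists c, forall e : R, 0 < e -> \forall n \near G, `|p (u n) - c| <= e.
  move=> pl.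
  have PF : ProperFilter ((p \o u) @ G) by apply: fmap_proper_filter.
  have FI : ((p \o u) @ G) `[-B, B]%classic.
    apply: (@filterS _ G _ _ _ _ uB) => n un /=; rewrite in_itv /= -ler_norml.
    exact: le_trans (pl _) un.
  have [c [_ cc]] := segment_compact PF FI; exists c => e e0.
  have [//|nG] := in_ultra_setVsetC [set n | `|p (u n) - c| <= e] UG.
  have [||x [/= x1 x2]] := cc [set x | ~ (`|x - c| <= e)] [set x | `|x - c| <= e].
  - exact: nG.
  - apply/nbhs_ballP; exists e => // y; rewrite /ball /= distrC; exact: ltW.
  by [].
have [a Ha] := C (@complex.Re R) (@cabs_Re R).
have [b Hb] := C (@complex.Im R) (@cabs_Im R).
exists (a +i* b)%C; apply/cvg_cplx => e e0.
have e2 : 0 < e / 2 by rewrite divr_gt0.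
apply: filterS2 (Ha _ e2) (Hb _ e2) => n h1 h2.
apply: le_trans (cabs_le_ReIm _) _; rewrite [e]splitr ReD ReN ImD ImN /=.
exact: lerD.
Qed.

Lemma sqint_le_sup d' (T : measurableType d') (R : realType) (mu : {measure set T -> \bar R})
    (f : T -> Cplx R) (S : set T) (e : R) : measurable S -> mcplx f ->
  (forall x, S x -> cabs (f x) <= e) -> (forall x, ~ S x -> f x = 0) ->
  (sqint mu f <= (e ^+ 2)%:E * mu S)%E.
Proof.
move=> mS mf fe f0.
rewrite -integral_scaled_indic ?sqr_ge0//; apply: ge0_le_integral => //.
- by move=> x _; rewrite lee_fin sqr_ge0.
- by apply/measurable_EFinP; exact: mcplx_sqr.
- by apply: emeasurable_funM => //; apply/measurable_EFinP; exact: measurable_indic.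
move=> x _; rewrite -EFinM lee_fin indicE; have [/set_mem Sx|/negP Sx] := boolP (x \in S).
  rewrite mulr1 lerXn2r ?nnegrE ?cabs_ge0 ?fe//.
  exact: le_trans (cabs_ge0 _) (fe x Sx).
by rewrite mulr0 f0 ?cabs0 ?expr0n// => h; apply: Sx; rewrite inE.
Qed.

Section RestrictionCompact.
Variables (R : realType) (d : nat) (Omega1 Omega2 : set 'rV[Cplx R]_d).
Notation V := 'rV[Cplx R]_d.
Notation vol := (@vol R d).
Hypotheses (o1 : open Omega1) (o2 : open Omega2) (rc : rel_compact Omega2 Omega1).
Notation J := (bergman_restr (Omega1 := Omega1) Omega2).

Lemma sub12 : Omega2 `<=` Omega1.
Proof. by apply: subset_trans rc.2; exact: subset_closure. Qed.

Lemma restr_in (f : V -> (Cplx R)^o) z : Omega2 z -> patch (fun=> 0) Omega2 f z = f z.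
Proof. by move=> h; rewrite patchE mem_set. Qed.

Lemma restr_out (f : V -> (Cplx R)^o) z : ~ Omega2 z -> patch (fun=> 0) Omega2 f z = 0.
Proof. by move=> h; rewrite patchE memNset. Qed.

Lemma restr_differentiable (f : V -> (Cplx R)^o) z :
  (forall w, Omega2 w -> differentiable f w) -> Omega2 z ->
  differentiable (patch (fun=> 0) Omega2 f : V -> (Cplx R)^o) z.
Proof.
move=> df Oz; have nO : \forall w \near z, Omega2 w by exact: open_nbhs_nbhs.
apply: (@differentiable_near R _ f); first by apply: filterS nO => w; exact: df.
by apply: filterS nO => w Ow; rewrite restr_in.
Qed.

Lemma restr_carrier (f : bergman Omega1) : carrier f -> carrier (J f).
Proof.
move=> cf; have [df f0 fi] := (bergman_carrierP _ _).1 cf; apply/bergman_carrierP.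
have dJ z : Omega2 z -> differentiable (J f) z.
  by apply: restr_differentiable => w /sub12; exact: df.
split; [exact: dJ|exact: restr_out|].
apply: le_lt_trans fi; have mf := (bergman_l2 o1 cf).1.
have mJ := mcplx_holomorphic o2 dJ (@restr_out f).
apply: ge0_le_integral => //.
- by move=> z _; rewrite lee_fin sqr_ge0.
- by apply/measurable_EFinP; exact: mcplx_sqr.
- by apply/measurable_EFinP; exact: mcplx_sqr.
move=> z _; rewrite lee_fin; have [Oz|Oz] := pselect (Omega2 z).
  by rewrite /bergman_restr restr_in.
by rewrite /bergman_restr restr_out// cabs0 expr0n sqr_ge0.
Qed.

Lemma restr_linear (a : Cplx R) (f g : bergman Omega1) :
  J (a *: f + g) = a *: J f + J g.
Proof.
apply/funext => z; rewrite [RHS]/(a * J f z + J g z : Cplx R).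
have [Oz|Oz] := pselect (Omega2 z); first by rewrite /bergman_restr !restr_in.
have E (h : bergman Omega1) : J h z = 0 :> Cplx R by exact: restr_out.
rewrite (E f) (E g); transitivity (0 : Cplx R); first exact: E.
by rewrite mulr0; exact/esym/(addr0 (0 : Cplx R)).
Qed.

Lemma vol_rel_compact : (vol Omega2 < +oo)%E.
Proof.
have [n _ Hn] : \forall n \near \oo, closure Omega2 `<=` [set z : V | vnm z < n%:R].
  apply: ((compact_near_coveringP (closure Omega2)).1 rc.1) => x _.
  exists ([set y | vnm (y - x) < 1], [set n | (Num.bound (vnm x + 1) <= n)%N]) => /=.
    split; last by exists (Num.bound (vnm x + 1)).
    exact: (near_vnm x).
  move=> [y n] /= [h1 h2]; rewrite -(subrK x y); apply: le_lt_trans (vnmD _ _) _.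
  have : (Num.bound (vnm x + 1))%:R <= n%:R :> R by rewrite ler_nat.
  have : vnm x + 1 < (Num.bound (vnm x + 1))%:R by apply: archi_boundP; have := vnm_ge0 x; lra.
  lra.
have v := @vol_cball R d 0 n.+1%:R (ltr0Sn _ _); case/andP: v => _; apply: le_lt_trans.
apply: le_measure; rewrite ?inE; [exact: open_measurable_Cd|by apply: open_measurable_Cd; exact: open_cball|].
move=> z Oz; rewrite /cball /= subr0; apply: lt_trans (Hn n (leqnn n) z _) _; last by rewrite ltr_nat.
exact: subset_closure.
Qed.

(** Montel's theorem. An ultrafilter finer than the tails gives a limit at every point at once,
    equicontinuity and compactness of the closure make the convergence uniform there, and finite
    volume turns uniform convergence into convergence in norm. *)
Lemma restr_compact (u : nat -> bergman Omega1) : (forall n, carrier (u n)) -> hbounded u ->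
  exists2 k : nat -> nat, {homo k : m n / (m < n)%N} &
  exists2 l : bergman Omega2, carrier l & hcvg (J \o u \o k) l.
Proof.
move=> cu [M HM].
have u0 n z : ~ Omega1 z -> u n z = 0 by case/bergman_carrierP : (cu n) => _ + _; exact.
have du n z : Omega1 z -> differentiable (u n) z by case/bergman_carrierP : (cu n) => + _ _; exact.
have lb z : Omega1 z -> exists2 r : R, 0 < r & exists2 B : R, 0 <= B &
    forall n, hol_ball (u n : V -> (Cplx R)^o) z r /\ bnd_ball (u n : V -> (Cplx R)^o) z r B.
  move=> Oz; have [r r0 [K K0 [Or HK]]] := local_bound o1 Oz.
  exists r => //; exists (K * M); first by rewrite mulr_ge0 ?(ltW K0)// (le_trans (hnorm_ge0 _) (HM 0%N)).
  move=> n; split=> w wr; first by apply: du; exact: Or.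
  by apply: (le_trans (HK _ _ (cu n) wr)); rewrite ler_wpM2l// ltW.
have [G [UG sG]] := ultraFilterLemma eventually_filter.
have PG : ProperFilter G by exact: ultra_proper.
have pw z : exists l : Cplx R, (fun n => u n z) @ G --> (l : (Cplx R)^o).
  have [Oz|zO] := pselect (Omega1 z).
    have [r r0 [B _ HB]] := lb z Oz; apply: (@ultra_bounded_cvg _ _ _ _ B) => //; apply: nearW => n.
    by have := (HB n).2 0; rewrite vnm0 addr0; exact.
  apply: (@ultra_bounded_cvg _ _ _ _ 0) => //; apply: nearW => n.
  by rewrite [X in cabs X](u0 n z zO) cabs0.
have [g Hg] := boolp.choice pw.
have dg z : Omega1 z -> differentiable (g : V -> (Cplx R)^o) z.
  move=> Oz; have [r r0 [B B0 HB]] := lb z Oz.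
  apply: (@limit_holomorphic R _ nat G PG u g z r B r0) => [n|n|w wr].
  - exact: (HB n).1.
  - exact: (HB n).2.
  - exact: Hg.
(* An e / 3 argument near each point, patched together by compactness. *)
have unif (e : R) : 0 < e -> \forall n \near G, forall z, closure Omega2 z -> cabs (u n z - g z) <= e.
  move=> e0; apply: ((compact_near_coveringP (closure Omega2)).1 rc.1 _ G (fun n z => cabs (u n z - g z) <= e)).
  move=> x /rc.2 Ox; have [r r0 [B B0 HB]] := lb x Ox.
  have L n v : vnm v <= r / 4 -> cabs (u n (x + v) - u n x) <= 24 * B / r * vnm v.
    exact: (lipschitz_ball r0 (HB n).1 (HB n).2).
  have e3 : 0 < e / 3 by rewrite divr_gt0.
  have q0 : 0 < 1 + 24 * B / r by have := divr_ge0 B0 (ltW r0); lra.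
  pose s := Num.min (r / 4) (e / 3 / (1 + 24 * B / r)).
  have s0 : 0 < s by rewrite lt_min !divr_gt0.
  have L3 n v : vnm v < s -> cabs (u n (x + v) - u n x) <= e / 3.
    rewrite lt_min => /andP[v1 v2]; apply: le_trans (L n v (ltW v1)) _.
    move: v2; rewrite ltr_pdivlMr// => v2; apply: ltW; apply: le_lt_trans v2.
    by rewrite mulrC ler_wpM2l ?vnm_ge0// lerDr.
  have Lg v : vnm v < s -> cabs (g (x + v) - g x) <= e / 3.
    move=> vs; apply: (@cabs_limit_le R nat G PG (fun n => u n (x + v) - u n x)).
      exact: (cvg_cplxB (Hg (x + v)) (Hg x)).
    by apply: nearW => n; exact: L3.
  have Hx := (@cvg_cplx R nat G _ (fun n => u n x) (g x)).1 (Hg x) _ e3.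
  exists ([set y | vnm (y - x) < s], [set n | cabs (u n x - g x) <= e / 3]) => /=.
    split; last exact: Hx.
    exact: (near_vnm x).
  move=> [y n] /= [h1 h2]; have := L3 n _ h1; have := Lg _ h1; rewrite addrCA subrr addr0 => a1 a2.
  have -> : u n y - g y = (u n y - u n x) + ((u n x - g x) - (g y - g x)) :> Cplx R by ring.
  apply: le_trans (cabsD _ _) _; apply: le_trans (lerD a2 (cabsB _ _)) _.
  move: h2 a1; move: (cabs _) (cabs _) => p q; lra.
(* Every set of G meets every tail, because G contains the tails; so an index beyond N with error at
   most 1 / (j + 1) exists, and iterating gives an increasing subsequence. *)
have pick jN : exists n, (jN.2 < n)%N /\ forall z, closure Omega2 z -> cabs (u n z - g z) <= jN.1.+1%:R^-1.
  case: jN => j N /=.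
  have h1 : \forall n \near G, (N < n)%N by apply: sG; exists N.+1.
  have h2 := unif j.+1%:R^-1 ltac:(by rewrite invr_gt0).
  by have [n [n1 n2]] := filter_ex (filterI h1 h2); exists n.
have [p Hp] := boolp.choice pick.
pose k := fix k j := if j is j'.+1 then p (j, k j') else p (0%N, 0%N).
have kk j z : closure Omega2 z -> cabs (u (k j) z - g z) <= j.+1%:R^-1.
  by case: j => [|j]; [exact: (Hp (0,0)%N).2|exact: (Hp (j.+1, k j)).2].
exists k; first by apply: homo_ltn; [exact: ltn_trans|move=> j; exact: (Hp (j.+1, k j)).1].
pose l : V -> (Cplx R)^o := patch (fun=> 0) Omega2 g.
have dl z : Omega2 z -> differentiable l z.
  by apply: restr_differentiable => w /sub12; exact: dg.
have l0 z : ~ Omega2 z -> l z = 0 by exact: restr_out.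
have ml := mcplx_holomorphic o2 dl l0.
have mO2 := open_measurable_Cd o2.
have est j : (sqint vol (fun z : CdM R d => (J (u (k j)) z - l z)%R) <= (j.+1%:R^-1 ^+ 2)%:E * vol Omega2)%E.
  apply: sqint_le_sup => //.
  - exact: (mcplxB (bergman_l2 o2 (restr_carrier (cu (k j)))).1 ml).
  - move=> z Oz; rewrite /l /bergman_restr !restr_in//; apply: kk; exact: subset_closure.
  - by move=> z Oz; rewrite /l /bergman_restr !restr_out// subrr.
have cl : bergman_carrier Omega2 l.
  apply/bergman_carrierP; split => //.
  have cJ := bergman_l2 o2 (restr_carrier (cu (k 0%N))).
  apply: (l2_sub cJ _).2; split; first exact: (mcplxB cJ.1 ml).
  apply: le_lt_trans (est 0%N) _; rewrite lte_mul_pinfty ?lee_fin ?sqr_ge0//.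
  exact: vol_rel_compact.
exists l => //.
pose W := fine (vol Omega2); have W0 : 0 <= W by rewrite fine_ge0.
have WE : vol Omega2 = W%:E by rewrite fineK// ge0_fin_numE// vol_rel_compact.
have hest j : hnorm (J (u (k j)) - l : bergman Omega2) <= j.+1%:R^-1 * Num.sqrt W.
  rewrite -(@ler_pXn2r _ 2)// ?nnegrE ?hnorm_ge0 ?mulr_ge0 ?invr_ge0 ?sqrtr_ge0//.
  have cc : carrier (J (u (k j)) - l : bergman Omega2).
    exact: (@bergman_sub R d Omega2 (J (u (k j))) l o2 (restr_carrier (cu (k j))) cl).
  rewrite -lee_fin -(sqint_hnorm cc) exprMn sqr_sqrtr// EFinM -WE; exact: est.
apply/cvgrPdist_le => e e0.
have e1 : 0 < e / (1 + Num.sqrt W) by rewrite divr_gt0// ltr_pwDl ?sqrtr_ge0.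
have := near_infty_natSinv_lt (PosNum e1); apply: filterS => j /= hj.
rewrite sub0r normrN ger0_norm ?hnorm_ge0//; apply: (le_trans (hest j)).
move: hj; rewrite ltr_pdivlMr ?ltr_pwDl ?sqrtr_ge0// mulrDr mulr1 => /ltW; apply: le_trans.
by rewrite lerDr invr_ge0.
Qed.

Lemma restr_compact_operator : is_compact_operator J.
Proof.
split; [exact: restr_carrier|by move=> a x y _ _; exact: restr_linear|exact: restr_compact].
Qed.

End RestrictionCompact.

(** * Min-max *)

Lemma conj_real (R : realType) (a : R) : (a%:C%C : Cplx R)^* = a%:C%C.
Proof. by apply/eqP; rewrite eq_complex /= oppr0 !eqxx. Qed.

Section MinMax.
Variables (R : realType) (H1 H2 : ipSpace R) (A : H1 -> H2).
Hypotheses (h1 : is_hilbert H1) (h2 : is_hilbert H2).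
Hypotheses (cA : forall x : H1, carrier x -> carrier (A x)).
Hypotheses (lA : forall (a : Cplx R) (x y : H1), carrier x -> carrier y ->
  A (a *: x + y) = a *: A x + A y).

Lemma ipD (H : ipSpace R) : is_hilbert H -> forall x y : H, carrier x -> carrier y ->
  carrier (x + y).
Proof. by move=> hH x y cx cy; rewrite -[x]scale1r; exact: (carrierP hH). Qed.

Lemma ipZ (H : ipSpace R) : is_hilbert H -> forall (a : Cplx R) (x : H), carrier x ->
  carrier (a *: x).
Proof.
by move=> hH a x cx; rewrite -[_ *: _]addr0; apply: (carrierP hH) => //; exact: carrier0 hH.
Qed.

Lemma inner0l (H : ipSpace R) : is_hilbert H -> forall x : H, carrier x -> inner 0 x = 0.
Proof.
move=> hH x cx; have c0 := carrier0 hH.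
have := innerP hH (-1) c0 c0 cx; rewrite scaler0 addr0 mulN1r addNr; exact.
Qed.

Lemma innerZl (H : ipSpace R) : is_hilbert H -> forall (a : Cplx R) (x y : H),
  carrier x -> carrier y -> inner (a *: x) y = a * inner x y.
Proof.
move=> hH a x y cx cy; have c0 := carrier0 hH.
by rewrite -[a *: x]addr0 (innerP hH)// inner0l// addr0.
Qed.

Lemma innerZr (H : ipSpace R) : is_hilbert H -> forall (a : Cplx R) (x y : H),
  carrier x -> carrier y -> inner x (a *: y) = a^* * inner x y.
Proof.
move=> hH a x y cx cy; rewrite (innerC hH) ?innerZl// ?rmorphM ?(innerC hH cy cx) ?conjCK//.
exact: ipZ.
Qed.

Lemma carrier_sum (H : ipSpace R) n (c : 'I_n -> Cplx R) (e : 'I_n -> H) : is_hilbert H ->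
  (forall i, carrier (e i)) -> carrier (\sum_i c i *: e i).
Proof.
move=> hH ce; elim/big_ind: _ => [|x y|i _]; [exact: carrier0 hH|exact: ipD|exact: ipZ].
Qed.

Lemma inner_suml (H : ipSpace R) n (c : 'I_n -> Cplx R) (e : 'I_n -> H) (y : H) :
  is_hilbert H -> (forall i, carrier (e i)) -> carrier y ->
  inner (\sum_i c i *: e i) y = \sum_i c i * inner (e i) y.
Proof.
move=> hH ce cy; pose P (x : H) (s : Cplx R) := carrier x /\ inner x y = s.
suff [] : P (\sum_i c i *: e i) (\sum_i c i * inner (e i) y) by [].
elim/big_rec2: _ => [|i s x _ [cx xs]]; first by split; [exact: carrier0 hH|exact: inner0l].
by split; [exact: (carrierP hH)|rewrite (innerP hH)// xs].
Qed.

Lemma inner_sumr (H : ipSpace R) n (c : 'I_n -> Cplx R) (e : 'I_n -> H) (y : H) :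
  is_hilbert H -> (forall i, carrier (e i)) -> carrier y ->
  inner y (\sum_i c i *: e i) = \sum_i (c i)^* * inner y (e i).
Proof.
move=> hH ce cy; rewrite (innerC hH) ?inner_suml//; last exact: carrier_sum.
rewrite rmorph_sum; apply: eq_bigr => i _.
by rewrite rmorphM [inner y _](innerC hH).
Qed.

Lemma op_sum n (c : 'I_n -> Cplx R) (e : 'I_n -> H1) : (forall i, carrier (e i)) ->
  A (\sum_i c i *: e i) = \sum_i c i *: A (e i).
Proof.
move=> ce; have c0 := carrier0 h1.
pose P (x : H1) (s : H2) := carrier x /\ A x = s.
suff [] : P (\sum_i c i *: e i) (\sum_i c i *: A (e i)) by [].
elim/big_rec2: _ => [|i s x _ [cx xs]].
  split=> //; have := lA (-1) c0 c0; rewrite scaler0 addr0 scaleN1r addNr; exact.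
by split; [exact: (carrierP h1)|rewrite lA// xs].
Qed.

(* The junk value 0 of [adjoint] cannot be a nonzero multiple of x <> 0, so on
   such eigenvectors the Riesz property holds. *)
Lemma eigenvector_inner (nu : R) (x y : H1) : nu != 0 ->
  is_eigenvector (adjoint A \o A) nu x -> carrier y ->
  inner (A y) (A x) = nu%:C%C * inner y x.
Proof.
move=> nu0 [cx x0 Tx] cy.
have n0 : nu%:C%C != 0 :> Cplx R by rewrite (inj_eq (@complexI _) _ 0).
have Tx0 : adjoint A (A x) <> 0.
  move=> T0; apply: x0; rewrite -[x]scale1r -(mulVf n0) -scalerA.
  by rewrite -[_ *: x]Tx /= T0 scaler0.
have ex : exists z : H1, carrier z /\ forall y : H1, carrier y -> inner (A y) (A x) = inner y z.
  by apply: contrapT => nex; apply: Tx0; rewrite /adjoint xgetPN// => z Pz; apply: nex; exists z.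
have [] := xgetPex 0 ex; rewrite -/(adjoint A (A x)) => _ -> //.
rewrite [adjoint _ _]Tx innerZr//; congr (_ * _).
exact: conj_real.
Qed.

(** No orthonormal basis is chosen. With s_i = sqrt (nu_i - mu) the Gram matrix satisfies (nu_j -
    mu) G_ij = s_i s_j G_ij, because G_ij = 0 for different eigenvalues. Hence <A f, A f> - mu <f,
    f> = <g, g> >= 0 for g = sum_i c_i s_i e_i. *)
Lemma eigenvectors_inner n (e : 'I_n -> H1) (nu : 'I_n -> R) (mu : R) (c : 'I_n -> Cplx R) :
  0 < mu -> (forall i, mu <= nu i) -> (forall i, is_eigenvector (adjoint A \o A) (nu i) (e i)) ->
  forall f, f = \sum_i c i *: e i ->
  mu * complex.Re (inner f f) <= complex.Re (inner (A f) (A f)).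
Proof.
move=> mu0 mnu eig f fE; have ce i : carrier (e i) by case: (eig i).
have nu0 i : nu i != 0 by rewrite gt_eqF// (lt_le_trans mu0).
pose G i j := inner (e i) (e j).
have AG i j : inner (A (e i)) (A (e j)) = (nu j)%:C%C * G i j by exact: eigenvector_inner.
have AG' i j : inner (A (e i)) (A (e j)) = (nu i)%:C%C * G i j.
  rewrite (innerC h2) ?AG; [|exact: cA|exact: cA].
  by rewrite rmorphM /G [inner (e i) _](innerC h1)//; congr (_ * _); exact: conj_real.
pose s i : Cplx R := (Num.sqrt (nu i - mu))%:C%C.
have sG i j : ((nu j)%:C%C - mu%:C%C) * G i j = s i * s j * G i j.
  have [eij|nij] := eqVneq (nu i) (nu j).
    rewrite /s eij -rmorphM -expr2 sqr_sqrtr ?rmorphB// subr_ge0//.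
  have := AG i j; rewrite AG' => /eqP; rewrite -subr_eq0 -mulrBl mulf_eq0 -rmorphB.
  rewrite (inj_eq (@complexI _) _ 0) subr_eq0 (negbTE nij) /= => /eqP ->.
  by rewrite !mulr0.
pose g := \sum_i (c i * s i) *: e i.
have cf : carrier f by rewrite fE; exact: carrier_sum.
have cg : carrier g by exact: carrier_sum.
have E1 : inner (A f) (A f) = \sum_i \sum_j (c i * (c j)^* * ((nu j)%:C%C * G i j)).
  rewrite fE op_sum// inner_suml//; [|by move=> i; exact: cA|by apply: carrier_sum => // i; exact: cA].
  apply: eq_bigr => i _; rewrite inner_sumr//; [|by move=> j; exact: cA|exact: cA].
  by rewrite mulr_sumr; apply: eq_bigr => j _; rewrite AG mulrA.
have E2 : inner f f = \sum_i \sum_j (c i * (c j)^* * G i j).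
  rewrite {1}fE (inner_suml c h1 ce cf); apply: eq_bigr => i _.
  rewrite fE (inner_sumr c h1 ce (ce i)).
  by rewrite mulr_sumr; apply: eq_bigr => j _; rewrite mulrA.
have E3 : inner g g = \sum_i \sum_j (c i * (c j)^* * (s i * s j * G i j)).
  rewrite {1}/g (inner_suml _ h1 ce cg); apply: eq_bigr => i _.
  rewrite /g (inner_sumr _ h1 ce (ce i)).
  rewrite mulr_sumr; apply: eq_bigr => j _.
  have -> : (c j * s j)^* = (c j)^* * s j.
    by rewrite rmorphM; congr (_ * _); exact: conj_real.
  by rewrite /G; ring.
have E : inner (A f) (A f) = mu%:C%C * inner f f + inner g g.
  rewrite E1 E2 E3 mulr_sumr -big_split; apply: eq_bigr => i _.
  rewrite mulr_sumr -big_split; apply: eq_bigr => j _ /=.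
  by rewrite -sG; ring.
have := inner_ge0 h1 cg; rewrite lecE => /andP[_ g0].
by rewrite E ReD ReM /= mul0r subr0 lerDl.
Qed.

Lemma functionals_kernel (K : finType) n (phi : K -> H1 -> Cplx R) (e : 'I_n -> H1) :
  (forall k (a : Cplx R) (x y : H1), carrier x -> carrier y ->
     phi k (a *: x + y) = a * phi k x + phi k y) ->
  (#|K| < n)%N -> lin_indep e -> (forall i, carrier (e i)) ->
  exists c : 'I_n -> Cplx R, \sum_i c i *: e i != 0 /\ forall k, phi k (\sum_i c i *: e i) = 0.
Proof.
move=> lphi Kn ie ce.
pose M : 'M[Cplx R]_(n, #|K|) := \matrix_(i, k) phi (enum_val k) (e i).
have kM : kermx M != 0.
  by rewrite -mxrank_eq0 mxrank_ker -lt0n subn_gt0 (leq_ltn_trans (rank_leq_col _)).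
pose c := nz_row (kermx M).
have c0 : c != 0 by rewrite nz_row_eq0.
have cM : c *m M = 0 by apply/sub_kermxP; exact: nz_row_sub.
exists (fun i => c 0 i); split.
  apply: contra_neq c0 => s0; apply/rowP => i; rewrite mxE.
  exact: (ie (fun i => c 0 i) s0).
move=> k; have c00 := carrier0 h1.
have phi0 : phi k 0 = 0.
  by have := lphi k (-1) 0 0 c00 c00; rewrite scaler0 addr0 mulN1r addNr.
have -> : phi k (\sum_i c 0 i *: e i) = \sum_i c 0 i * phi k (e i).
  pose P (x : H1) (s : Cplx R) := carrier x /\ phi k x = s.
  suff [] : P (\sum_i c 0 i *: e i) (\sum_i c 0 i * phi k (e i)) by [].
  elim/big_rec2: _ => [|i s x _ [cx xs]]; first by split.
  by split; [exact: (carrierP h1)|rewrite lphi// xs].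
transitivity ((c *m M) 0 (enum_rank k)); last by rewrite cM mxE.
by rewrite mxE; apply: eq_bigr => i _; rewrite mxE enum_rankK.
Qed.

(** If mu > 0 is admissible in the supremum, some nonzero combination f of the n eigenvectors is
    killed by all [phi k], and mu |f|^2 <= |A f|^2 <= C |f|^2. *)
Lemma nth_eigenvalue_le (K : finType) n (phi : K -> H1 -> Cplx R) (C : R) : 0 <= C ->
  (forall k (a : Cplx R) (x y : H1), carrier x -> carrier y ->
     phi k (a *: x + y) = a * phi k x + phi k y) ->
  (#|K| < n)%N ->
  (forall f : H1, carrier f -> (forall k, phi k f = 0) -> hnorm (A f) ^+ 2 <= C * hnorm f ^+ 2) ->
  nth_eigenvalue (adjoint A \o A) n <= C.
Proof.
move=> C0 lphi Kn HC; rewrite /nth_eigenvalue; set S := [set _ | _].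
(* Once the eigenvalues are exhausted, the supremum is the default value 0. *)
have [->|S0] := eqVneq S set0; first by rewrite sup0.
apply: ge_sup; first exact/set0P.
move=> mu [e ie eige].
have /boolp.choice[nu eig] : forall i, exists nu : R,
    mu <= nu /\ is_eigenvector (adjoint A \o A) nu (e i).
  by move=> i; have [nu h1' h2'] := eige i; exists nu.
have [mu0|mu0] := leP mu 0; first exact: le_trans mu0 C0.
have mnu i : mu <= nu i by case: (eig i).
have {}eig i : is_eigenvector (adjoint A \o A) (nu i) (e i) by case: (eig i).
have ce i : carrier (e i) by case: (eig i).
have [c [f0 pf]] := functionals_kernel lphi Kn ie ce.
have := eigenvectors_inner mu0 mnu eig (erefl (\sum_i c i *: e i)).
move: f0 pf; set f := \sum_i _ => f0 pf.
have cf : carrier f by exact: carrier_sum.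
have re (H : ipSpace R) (x : H) : is_hilbert H -> carrier x -> complex.Re (inner x x) = hnorm x ^+ 2.
  move=> hH cx; rewrite /hnorm sqr_sqrtr//.
  by have := inner_ge0 hH cx; rewrite lecE => /andP[].
rewrite !re//; last exact: cA.
move=> /le_trans/(_ (HC f cf pf)); rewrite ler_pM2r// -re// lt_neqAle.
have := inner_ge0 h1 cf; rewrite lecE => /andP[/eqP i0 r0]; rewrite r0 andbT eq_sym.
apply: contra f0 => /eqP r1; apply/eqP; apply: (inner_eq0 h1) => //.
by apply/eqP; rewrite eq_complex r1 i0 !eqxx.
Qed.

End MinMax.

(** * Singular values of the restriction *)

Section CoverBound.
Variables (R : realType) (d : nat) (Omega1 Omega2 : set 'rV[Cplx R]_d).
Notation V := 'rV[Cplx R]_d.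
Notation vol := (@vol R d).
Hypotheses (o1 : open Omega1) (o2 : open Omega2) (rc : rel_compact Omega2 Omega1).
Notation J := (bergman_restr (Omega1 := Omega1) Omega2).
Variables (N : nat) (D : 'I_N -> set V) (zeta : 'I_N -> V) (gamma : 'I_N -> R).
Hypothesis cov : is_relative_cover Omega1 Omega2 D zeta gamma.

Lemma restr_sqint_cover (f : bergman Omega1) : carrier f ->
  (sqint vol (J f) <= \sum_j \int[vol]_z ((\1_(D j) z)%:E * (sqn f z)%:E))%E.
Proof.
move=> cf; have mJ := mcplx_sqr (bergman_l2 o2 (restr_carrier o1 o2 rc cf)).1.
have mf := mcplx_sqr (bergman_l2 o1 cf).1.
pose h j (z : CdM R d) : \bar R := ((\1_(D j) z)%:E * (sqn f z)%:E)%E.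
have mh j : measurable_fun [set: CdM R d] (h j).
  apply: emeasurable_funM; apply/measurable_EFinP; last exact: mf.
  by apply: measurable_indic; apply: open_measurable_Cd; exact: (rcover_open cov).
have h0 j z : (0 <= h j z)%E by apply: mule_ge0; rewrite lee_fin// sqr_ge0.
have -> : (\sum_j \int[vol]_z ((\1_(D j) z)%:E * (sqn f z)%:E) = \int[vol]_z \sum_j h j z)%E.
  rewrite ge0_integral_sum//.
apply: ge0_le_integral => //.
- by move=> z _; rewrite lee_fin sqr_ge0.
- exact/measurable_EFinP.
- exact: emeasurable_sum.
move=> z _; have [Oz|Oz] := pselect (Omega2 z); last first.
  have -> : J f z = 0 :> Cplx R by exact: restr_out.
  by rewrite cabs0 expr0n sume_ge0.
have -> : J f z = f z by exact: restr_in.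
have [j _ Dz] := rcover_cover cov Oz.
rewrite (bigD1 j)//= {1}/h indicE mem_set// mul1e leeDl// sume_ge0//.
Qed.

Lemma nth_eigenvalue_restr_le (k : 'I_N -> nat) n : (\sum_j taylor_dim d (k j) < n)%N ->
  nth_eigenvalue (adjoint J \o J) n <= \sum_j (gamma j ^- (k j + d)) ^+ 2.
Proof.
move=> kn; pose K : finType := {j : 'I_N & 'I_(taylor_dim d (k j))}.
(* For empty [D j] the centre may lie outside Omega1, where [taylor] need not be linear in f; the
   functional is then set to 0. *)
pose phi (p : K) (f : bergman Omega1) : Cplx R :=
  if `[< D (tag p) !=set0 >] then (taylor (zeta (tag p)) d (k (tag p)) f)`_(tagged p) else 0.
have Oz j : D j !=set0 -> Omega1 (zeta j).
  move=> [z Dz]; apply: (rcover_dilate cov); exists j => //.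
  exists 0; last by rewrite scaler0 add0r.
  rewrite -(scale0r (z - zeta j)).
  apply: strictly_circled_le1; [exact: (rcover_open cov)|exact: (rcover_circled cov)|by exists z|].
  by rewrite cabs0.
have nh j (f : bergman Omega1) : carrier f -> D j !=set0 -> near_hol f (zeta j).
  move=> /bergman_carrierP[df _ _] /Oz Ozj; apply: filterS df _.
  exact: open_nbhs_nbhs.
apply: (nth_eigenvalue_le (bergman_hilbert o1) (bergman_hilbert o2) _ _ (phi := phi)).
- by move=> f; exact: restr_carrier.
- by move=> a f g _ _; exact: restr_linear.
- by apply: sumr_ge0 => j _; exact: sqr_ge0.
- move=> p a f g cf cg; rewrite /phi; case: asboolP => [D0|_]; last by rewrite mulr0 addr0.
  exact: (taylor_linear _ _ a _ (nh _ _ cf D0) (nh _ _ cg D0)).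
- apply: leq_ltn_trans kn; rewrite card_tagged sumnE big_map big_enum /=.
  by apply: leq_sum => j _; rewrite card_ord.
move=> f cf pf; have [df f0 fi] := (bergman_carrierP _ _).1 cf.
have cJ := restr_carrier o1 o2 rc cf.
rewrite -lee_fin -(sqint_hnorm cJ) EFinM -(sqint_hnorm cf).
apply: le_trans (restr_sqint_cover cf) _.
rewrite -sumEFin ge0_sume_distrl; last by move=> j _; rewrite lee_fin sqr_ge0.
apply: lee_sum => j _.
have CT := @circled_taylor_decay R d Omega1 (D j) f (zeta j) (gamma j) (k j) o1 df f0
  (@rcover_open _ _ _ _ _ _ _ _ cov j) (@rcover_circled _ _ _ _ _ _ _ _ cov j) (@rcover_scaling _ _ _ _ _ _ _ _ cov j).
apply: CT.
  by move=> z hz; apply: (rcover_dilate cov); exists j.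
move=> D0 i; have [ik|ki] := ltnP i (taylor_dim d (k j)); last first.
  by rewrite nth_default// size_taylor.
have := pf (Tagged (fun j => 'I_(taylor_dim d (k j))) (Ordinal ik)).
by rewrite /phi /= asboolT.
Qed.

End CoverBound.

(** * Choice of the orders and the bound on the gauge *)

(** The shift (d + 1) / 2 is the (d - 1) / 2 of [taylor_dim_le] plus 1 for the passage from m to m +
    1. *)
Lemma taylor_dim_lt (R : realType) (d m : nat) (s : R) : (0 < d)%N ->
  m%:R < s - (d%:R + 1) / 2 -> (taylor_dim d m.+1)%:R < s ^+ d.
Proof.
case: d => // d _ ms; have d2 : 0 <= d%:R / 2 :> R by rewrite divr_ge0.
have m0 : 0 <= m%:R :> R by [].
rewrite -natr1 in ms; apply: le_lt_trans (taylor_dim_le _ _ _) _.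
rewrite -natr1; have s0 : 0 <= s by lra.
have h : m%:R + 1 + d%:R / 2 < s by lra.
by rewrite ltr_pXn2r// nnegrE; lra.
Qed.

Lemma exists_orders (R : realType) (d N n : nat) (g : 'I_N -> R) : (0 < d)%N -> (0 < N)%N ->
  (forall j, 0 < g j) ->
  let t := dual_norm d g * n%:R `^ d%:R^-1 in
  0 < dual_norm d g /\ ((0 < n)%N ->
  exists k : 'I_N -> nat, (\sum_j taylor_dim d (k j) < n)%N /\
    forall j, t / g j - (d%:R + 1) / 2 <= (k j)%:R).
Proof.
move=> d0 N0 g0 t; pose S : R := \sum_j (g j ^+ d)^-1.
have dn0 : d%:R != 0 :> R by rewrite pnatr_eq0 -lt0n.
have S0 : 0 < S.
  rewrite /S (bigD1 (Ordinal N0))//= ltr_pwDl ?invr_gt0 ?exprn_gt0//.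
  by apply: sumr_ge0 => j _; rewrite invr_ge0 exprn_ge0// ltW.
have cE : dual_norm d g = S `^ (- d%:R^-1).
  rewrite /dual_norm; congr (_ `^ _); apply: eq_bigr => j _.
  by rewrite ger0_norm ?(ltW (g0 j))// powRN powR_mulrn ?(ltW (g0 j)).
have c0 : 0 < dual_norm d g by rewrite cE powR_gt0.
split=> // n0; have cd : dual_norm d g ^+ d = S^-1.
  by rewrite -powR_mulrn ?(ltW c0)// cE -powRrM mulNr mulVf// powRN powRr1// ltW.
have nR : 0 < n%:R :> R by rewrite ltr0n.
have t0 : 0 < t by rewrite mulr_gt0// powR_gt0.
have td : t ^+ d = S^-1 * n%:R.
  rewrite exprMn cd; congr (_ * _).
  by rewrite -powR_mulrn ?powR_ge0// -powRrM mulVf// powRr1.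
pose y j := t / g j - (d%:R + 1) / 2.
have exk j : exists k, y j <= k%:R.
  exists (Num.bound `|y j|); apply: le_trans (ler_norm _) _.
  by apply/ltW/archi_boundP.
pose k j := ex_minn (exk j); exists k.
have kP j : y j <= (k j)%:R /\ (taylor_dim d (k j))%:R < (t / g j) ^+ d.
  rewrite /k; case: ex_minnP => m ym mmin; split=> //.
  (* If k_j = 0 no coefficient is counted; otherwise k_j - 1 lies below the threshold. *)
  case: m ym mmin => [|m] ym mmin.
    have -> : taylor_dim d 0 = 0%N by case: (d) d0.
    by rewrite exprn_gt0// divr_gt0.
  have ymm : m%:R < y j.
    by rewrite ltNge; apply/negP => /mmin; rewrite ltnn.
  exact: taylor_dim_lt.
split; last by move=> j; exact: (kP j).1.
rewrite -(ltr_nat R) natr_sum.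
have -> : n%:R = \sum_j (t / g j) ^+ d.
  under eq_bigr do rewrite expr_div_n td.
  by rewrite -mulr_sumr -/S mulrAC mulVf ?mul1r// lt0r_neq0.
apply: ltr_sum => [|j _]; last exact: (kP j).2.
by apply/hasP; exists (Ordinal N0); rewrite ?mem_index_enum.
Qed.

Section GaugeBound.
Variables (R : realType) (d : nat) (Omega1 Omega2 : set 'rV[Cplx R]_d).
Notation V := 'rV[Cplx R]_d.
Hypotheses (d0 : (0 < d)%N) (o1 : open Omega1) (o2 : open Omega2) (rc : rel_compact Omega2 Omega1).
Notation J := (bergman_restr (Omega1 := Omega1) Omega2).

Lemma exp_gauge_restr_le N (D : 'I_N -> set V) (zeta : 'I_N -> V) (gamma : 'I_N -> R) :
  is_relative_cover Omega1 Omega2 D zeta gamma ->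
  (exp_gauge (dual_norm d (efficiency gamma)) d%:R^-1 J <=
   (N%:R * expR (- ((d%:R - 1) / 2) * min_entry (efficiency gamma)))%:E)%E.
Proof.
set Gamma := efficiency gamma; move=> cov; have N0 := rcover_size cov.
have g1 j : 1 < gamma j by exact: (rcover_scaling cov).
have g0 j : 0 < Gamma j by exact: ln_gt0.
apply: ge_ereal_sup => _ [n /= n0 <-]; rewrite lee_fin.
have [c0 /(_ n0)[k [kn kt]]] := exists_orders n d0 N0 g0.
have {kn} := nth_eigenvalue_restr_le o1 o2 rc cov kn.
set t := dual_norm d Gamma * _ in kt *; set m := min_entry Gamma.
set E := expR (- t - (d%:R - 1) / 2 * m) => H.
have mg j : m <= Gamma j.
  apply: ge_inf; last by exists j.
  by exists 0 => _ [i _ <-]; exact: ltW.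
have d1 : 1 <= d%:R :> R by rewrite ler1n.
(* By the choice of k_j, (k_j + d) Gamma_j >= t + (d - (d + 1) / 2) Gamma_j, and Gamma_j >= m. *)
have gE j : gamma j ^- (k j + d) <= E.
  have gj : gamma j = expR (Gamma j) by rewrite lnK// posrE; have := g1 j; lra.
  rewrite gj -expRM_natl -expRN ler_expR natrD.
  have := kt j; rewrite lerBlDr ler_pdivrMr// => kt'.
  have : (d%:R - 1) / 2 * m <= (d%:R - 1) / 2 * Gamma j.
    by rewrite ler_wpM2l// divr_ge0// subr_ge0.
  move: kt'; rewrite -/t; move: (k j)%:R (Gamma j) (d%:R : R) => a b x; nra.
have E0 : 0 < E by exact: expR_gt0.
(* The sum is at most N E^2; the weaker (N E)^2 already gives the factor N of the claim. *)
have ev : nth_eigenvalue (adjoint J \o J) n <= (N%:R * E) ^+ 2.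
  apply: le_trans H _; apply: (@le_trans _ _ (\sum_(j < N) E ^+ 2)).
    apply: ler_sum => j _; rewrite lerXn2r ?nnegrE ?(ltW E0)//.
    by rewrite invr_ge0 exprn_ge0//; have := g1 j; lra.
  rewrite sumr_const card_ord -[leLHS]mulr_natl [leRHS]exprMn.
  apply: ler_wpM2r; first exact: sqr_ge0.
  by rewrite -natrX ler_nat expnS expn1 leq_pmulr.
have sE : singular_value J n <= N%:R * E.
  rewrite /singular_value -[leRHS]ger0_norm ?mulr_ge0 ?(ltW E0)//.
  by rewrite -sqrtr_sqr; exact: ler_wsqrtr.
have -> : N%:R * expR (- ((d%:R - 1) / 2) * m) = N%:R * E * expR t.
  by rewrite -mulrA -expRD; congr (_ * expR _); ring.
by rewrite ler_wpM2r ?expR_ge0.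
Qed.

Lemma restr_in_E2 N (D : 'I_N -> set V) (zeta : 'I_N -> V) (gamma : 'I_N -> R) :
  is_relative_cover Omega1 Omega2 D zeta gamma ->
  in_E2 (dual_norm d (efficiency gamma)) d%:R^-1 J.
Proof.
move=> cov; split; [exact: bergman_hilbert|exact: bergman_hilbert|exact: restr_compact_operator|].
by apply: le_lt_trans (exp_gauge_restr_le cov) _; rewrite ltry.
Qed.

End GaugeBound.

(** * Existence of a relative cover *)

Section CoverExists.
Variables (R : realType) (d : nat).
Notation V := 'rV[Cplx R]_d.

Lemma closure_vnm (S : set V) (B : R) (x : V) : (forall v, S v -> vnm v <= B) ->
  closure S x -> vnm x <= B.
Proof.
move=> SB cx; rewrite leNgt; apply/negP => Bx.
have /cx[y [/SB yB /= yx]] : nbhs x [set y | vnm (y - x) < vnm x - B].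
  by apply: (near_vnm x); rewrite subr_gt0.
have := vnmD (x - y) y; rewrite subrK -opprB vnmN.
by move: yx yB; lra.
Qed.

(** Along an ultrafilter the bounded coordinates converge, and finitely many coordinates control the
    norm. *)
Lemma compact_closed_ball (B : R) : compact [set v : V | vnm v <= B].
Proof.
rewrite compact_ultra => F UF FB.
have PF : ProperFilter F by exact: ultra_proper.
have ex j : exists l : Cplx R, (fun v : V => v 0 j) @ F --> (l : (Cplx R)^o).
  apply: (@ultra_bounded_cvg _ _ _ _ B) => //.
  by apply: filterS FB => v; apply: le_trans; exact: cabs_coord.
have [l Hl] := boolp.choice ex; pose p : V := \row_j l j.
have near_p (e : R) : 0 < e -> \forall v \near F, vnm (v - p) <= e.
  move=> e0; have H : \forall v \near F, forall j, cabs ((v - p) 0 j) <= e.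
    apply: filter_forall => j; have := (@cvg_cplx R _ F _ _ _).1 (Hl j) _ e0.
    by move=> /(_ _)/filterS; apply => v; rewrite !mxE.
  by apply: filterS H => v; apply: vnm_le_coord; exact: ltW.
exists p; split.
  apply/ler_addgt0Pr => e e0; have [v [v1 v2]] := filter_ex (filterI FB (near_p e e0)).
  have := vnmD (p - v) v; rewrite subrK -opprB vnmN; move: v1 v2 => /=; lra.
move=> A /nbhs_vnm[r r0 Hr]; have r2 : 0 < r / 2 by rewrite divr_gt0.
apply: filterS (near_p _ r2) => v vr; rewrite -(subrK p v) addrC; apply: Hr.
by apply: le_lt_trans vr _; lra.
Qed.

Lemma strictly_circled_cball (z : V) (r : R) : 0 < r -> strictly_circled (cball z r : set V) z.
Proof.
move=> r0 mu; rewrite normE ltcR => mu1; rewrite translateE.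
have T : [set v | (cball z r : set V) (z + v)] = [set v : V | vnm v < r].
  by apply/seteqP; split => v; rewrite /cball /= addrC addKr.
rewrite T; set S := (X in rel_compact X _).
have SB v : S v -> vnm v <= cabs mu * r.
  by case=> w /= wr <-; rewrite vnmZ ler_wpM2l ?cabs_ge0// ltW.
split=> [|v /(closure_vnm SB) vr].
  apply: (@subclosed_compact _ _ [set v : V | vnm v <= cabs mu * r]).
  - exact: closed_closure.
  - exact: compact_closed_ball.
  - by move=> v; exact: closure_vnm.
by apply: le_lt_trans vr _; rewrite gtr_pMl.
Qed.

(** Needed because the first claim presupposes no cover. Finitely many balls whose doubles lie in
    Omega1 cover the compact closure, so gamma = 2 is a scaling; a point of Omega2 makes their
    number positive. *)
Lemma exists_relative_cover (Omega1 Omega2 : set V) :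
  open Omega1 -> Omega2 !=set0 -> rel_compact Omega2 Omega1 ->
  exists N (D : 'I_N -> set V) (zeta : 'I_N -> V) (gamma : 'I_N -> R),
    is_relative_cover Omega1 Omega2 D zeta gamma.
Proof.
move=> o1 [w Ow] [cO cO1].
have ex z : exists r : R, 0 < r /\ (Omega1 z -> forall v, vnm v < 2 * r -> Omega1 (z + v)).
  have [Oz|] := pselect (Omega1 z); last by exists 1.
  have /nbhs_vnm[r r0 Hr] : nbhs z Omega1 by exact: open_nbhs_nbhs.
  exists (r / 2); split; first by rewrite divr_gt0.
  by move=> _ v; rewrite mulrCA divff ?mulr1//; exact: Hr.
have [r rP] := boolp.choice ex.
move: (cO); rewrite compact_cover => /(_ V (closure Omega2) (fun z => cball z (r z) : set V)).
case.
- by move=> z _; exact: open_cball.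
- by move=> z Oz; exists z => //; rewrite /cball /= subrr vnm0; exact: (rP z).1.
move=> F FO FC; pose s : seq V := finmap.enum_fset F.
have sF z : z \in s -> closure Omega2 z by move=> zs; have := FO z zs; rewrite inE.
pose zeta (i : 'I_(size s)) := nth 0 s i.
have zO i : Omega1 (zeta i) by apply/cO1/sF; exact: mem_nth.
exists (size s), (fun i => cball (zeta i) (r (zeta i)) : set V), zeta, (fun=> 2); split.
- have [z /= zF _] := FC w (subset_closure Ow).
  by have : z \in s by []; case: (s).
- by move=> i; exact: open_cball.
- by move=> i; apply: strictly_circled_cball; exact: (rP _).1.
- move=> z Oz; have [x xF zx] := FC z (subset_closure Oz).
  have xs : x \in s by [].
  by exists (Ordinal (etrans (index_mem x s) xs)) => //; rewrite /zeta /= nth_index.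
- by move=> i; rewrite ltr1n.
move=> z [i _ [v]]; rewrite translateE /cball /= addrC addKr => vr <-.
rewrite addrC; apply: (rP _).2 => //; rewrite vnmZ cabs_real ger0_norm//.
by rewrite ltr_pM2l.
Qed.

End CoverExists.

Theorem theorem4p7 (R : realType) (d : nat) (Omega1 Omega2 : set (Cd R d)) :
  (0 < d)%N ->
  open Omega1 -> Omega1 !=set0 ->
  open Omega2 -> Omega2 !=set0 ->
  rel_compact Omega2 Omega1 ->
  let J := bergman_restr (Omega1 := Omega1) Omega2 in
  in_E d%:R^-1 J /\
  forall (N : nat) (D : 'I_N -> set (Cd R d)) (zeta : 'I_N -> Cd R d)
         (gamma : 'I_N -> R),
    is_relative_cover Omega1 Omega2 D zeta gamma ->
    let Gamma := efficiency gamma in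
    let c := dual_norm d Gamma in
    in_E2 c d%:R^-1 J /\
    (exp_gauge c d%:R^-1 J <=
       (N%:R * expR (- ((d%:R - 1) / 2) * min_entry Gamma))%:E)%E.
Proof.
move=> d0 o1 _ o2 n2 rc J; split.
  have [N [D [zeta [gamma cov]]]] := exists_relative_cover o1 n2 rc.
  exists (dual_norm d (efficiency gamma)); last exact: (restr_in_E2 d0 o1 o2 rc cov).
  apply: (exists_orders 1 d0 (rcover_size cov) _).1 => j.
  by apply: ln_gt0; exact: (rcover_scaling cov).
move=> N D zeta gamma cov Gamma c; split.
  exact: (restr_in_E2 d0 o1 o2 rc cov).
exact: (exp_gauge_restr_le d0 o1 o2 rc cov).
Qed.
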